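(* Let $0<r<1$, let $n\geq 3$ be an integer, let $0<\nu\leq 1$, and let $f: D_r\rightarrow\mathbb{R}$ be a bounded, integrable function with $f\in C^{n-2,\nu}(D_r)$. Let $$\omega(z)=\frac{1}{2\pi}\iint_{D_r}\log|z-\zeta|\, f(\zeta)\, d\sigma_\zeta$$ be the logarithmic potential of $f$. Then $\omega\in C^{n}(D_r)$. Moreover, let $\mathbf{j}=(j_1,j_2)$ be a multi-index with $|\mathbf{j}|=n$, written as $\mathbf{j}=e_1+e_2+\cdots+e_n$ with each $e_\tau\in\{(1,0),(0,1)\}$, and put $\theta_\tau:=e_1+\cdots+e_\tau$ and $\phi_\tau:=e_{\tau+2}+\cdots+e_n$ for $\tau=1,\ldots,n-1$ (with $\phi_{n-1}=(0,0)$). Let $R>r$, and extend $f$ to vanish outside $D_r$. Then for every $z\in D_r$, \begin{align*} \partial^{\mathbf{j}}\omega(z)={}&\frac{1}{2\pi}\iint_{D_R}\partial^{\mathbf{j}}\log|z-\zeta|\cdot\bigl(f(\zeta)-P_{n-2}[f](z,\zeta)\bigr)\,d\sigma_\zeta\\ &-\frac{1}{2\pi}\sum_{\tau=1}^{n-1}\int_{\partial D_R}\partial^{\theta_\tau}\log|z-\zeta|\cdot P_{\tau-1}[\partial^{\phi_\tau}f](z,\zeta)\cdot\langle N(\zeta),e_{\tau+1}\rangle\,|d\zeta|, \end{align*} where $N(\zeta)=(N_1(\zeta),N_2(\zeta))$ is the unit outward normal at $\zeta\in\partial D_R$ and $\langle\cdot,\cdot\rangle$ is the Euclidean inner product on 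$\mathbb{R}^2$.
   Context: Identify $\mathbb{C}$ with $\mathbb{R}^2$ and write $z=x_1+ix_2$, $\zeta=y_1+iy_2$. For $R>0$, $D_R:=\{z\in\mathbb{C}:|z|<R\}$; $d\sigma_\zeta$ is the area element and $|d\zeta|$ is arc length. For a multi-index $\mathbf{j}=(j_1,j_2)$ of nonnegative integers, $|\mathbf{j}|=j_1+j_2$ and $\partial^{\mathbf{j}}=\partial_1^{j_1}\partial_2^{j_2}$ with $\partial_1=\partial/\partial x_1$, $\partial_2=\partial/\partial x_2$; in particular all derivatives $\partial^{\mathbf{j}}\log|z-\zeta|$ and $\partial^{\theta_\tau}\log|z-\zeta|$ are taken with respect to the variable $z$. The space $C^{k,\nu}(D_r)$, $0<\nu\leq1$, is the subspace of $C^k(D_r)$ consisting of functions whose $k$-th order partial derivatives are locally Hölder continuous with exponent $\nu$ in $D_r$ (i.e. Hölder continuous with exponent $\nu$ on compact subsets of $D_r$). For an integer $k\geq 0$ and a function $g$ of class $C^k$ near $z$, the Taylor polynomial is $$P_k[g](z,\zeta):=\sum_{|\iota|\leq k}\frac{(\zeta-z)^{\iota}}{\iota!}\,\partial^{\iota}g(z),\qquad P_0[g](z,\zeta)=g(z),$$ where $\iota=(\iota_1,\iota_2)$ ranges over multi-indices, $(\zeta-z)^{\iota}=(y_1-x_1)^{\iota_1}(y_2-x_2)^{\iota_2}$, and $\iota!=\iota_1!\,\iota_2!$. It is regarded as a polynomial in $\zeta$, defined for all $\zeta\in\mathbb{C}$. *)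

(* Defs.v *)
From HB Require Import structures.
From mathcomp Require Import all_boot all_order all_algebra.
From mathcomp Require Import all_classical all_reals all_analysis.

Set Implicit Arguments.
Unset Strict Implicit.
Unset Printing Implicit Defensive.

Import Order.TTheory GRing.Theory Num.Theory.
Import numFieldNormedType.Exports.

Local Open Scope classical_set_scope.
Local Open Scope ring_scope.

(* The complex plane is R * R with z = x_1 + i x_2 encoded as (x_1, x_2).  The
   norm `|z| that the library puts on a product is the sup norm, hence the
   explicit Euclidean modulus; the topologies coincide. *)

Definition cmod (R : realType) (z : R * R) : R :=
  Num.sqrt (z.1 ^+ 2 + z.2 ^+ 2).

Definition disc (R : realType) (r : R) : set (R * R) := [set z | cmod z < r].

(* The Borel structure `measurableTypeR R` is given explicitly: on a bare `R` the
   library infers a measurable type with a different display than the one on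
   which `lebesgue_measure` lives. *)
Definition area (R : realType) :
    set (measurableTypeR R * measurableTypeR R) -> \bar R :=
  (@lebesgue_measure R \x @lebesgue_measure R)%E.

Definition multi_index := (nat * nat)%type.

Definition midx_size (j : multi_index) : nat := (j.1 + j.2)%N.

Definition d1 (R : realType) (g : R * R -> R) : R * R -> R :=
  fun z => 'D_((1, 0) : R * R) g z.

Definition d2 (R : realType) (g : R * R -> R) : R * R -> R :=
  fun z => 'D_((0, 1) : R * R) g z.

Definition pd (R : realType) (j : multi_index) (g : R * R -> R) : R * R -> R :=
  iter j.1 (@d1 R) (iter j.2 (@d2 R) g).

(* Partial derivatives of order at most k, in any order of differentiation,
   exist and are continuous at every point of U (meant for open U). *)
Fixpoint Ck (R : realType) (k : nat) (U : set (R * R)) (g : R * R -> R) : Prop :=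
  (forall z, U z -> {for z, continuous g}) /\
  if k is k'.+1 then
    [/\ forall z, U z -> derivable g z ((1, 0) : R * R),
        forall z, U z -> derivable g z ((0, 1) : R * R),
        Ck k' U (d1 g) & Ck k' U (d2 g)]
  else True.

Definition locally_holder (R : realType) (nu : R) (U : set (R * R))
    (g : R * R -> R) : Prop :=
  forall K : set (R * R), compact K -> K `<=` U ->
    exists C : R, forall z w, K z -> K w ->
      `|g z - g w| <= C * cmod (z - w) `^ nu.

Definition Cknu (R : realType) (k : nat) (nu : R) (U : set (R * R))
    (g : R * R -> R) : Prop :=
  Ck k U g /\
  forall j : multi_index, midx_size j = k -> locally_holder nu U (pd j g).

Definition taylor (R : realType) (k : nat) (g : R * R -> R) (z zeta : R * R) : R :=
  \sum_(a < k.+1) \sum_(b < k.+1 | (a + b <= k)%N)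
    (zeta.1 - z.1) ^+ a * (zeta.2 - z.2) ^+ b / (a`! * b`!)%:R *
    pd (a : nat, b : nat) g z.

(* The value at z = zeta is a junk value, irrelevant for all integrals. *)
Definition log_kernel (R : realType) (zeta : R * R) : R * R -> R :=
  fun z => ln (cmod (z - zeta)).

Definition log_potential (R : realType) (r : R) (f : R * R -> R) (z : R * R) : R :=
  (2 * pi)^-1 * \int[@area R]_(zeta in disc r) (log_kernel zeta z * f zeta).

Definition circle_pt (R : realType) (rho t : R) : R * R :=
  (rho * cos t, rho * sin t).

(* Integrals over the circle |zeta| = rho are taken in the angular parameter
   t in [0, 2 pi], for which |d zeta| = rho dt. *)
Definition circle_integrable (R : realType) (rho : R) (g : R * R -> R) : Prop :=
  (@lebesgue_measure R).-integrable `[0, 2 * pi]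
    (fun t => (g (circle_pt rho t) * rho)%:E).

Definition circle_integral (R : realType) (rho : R) (g : R * R -> R) : R :=
  \int[@lebesgue_measure R]_(t in `[0, 2 * pi]) (g (circle_pt rho t) * rho).

(* The unit outward normal at zeta of the circle centred at 0 through zeta. *)
Definition normal (R : realType) (zeta : R * R) : R * R :=
  (zeta.1 / cmod zeta, zeta.2 / cmod zeta).

Definition dot_midx (R : realType) (v : R * R) (e : multi_index) : R :=
  v.1 * e.1%:R + v.2 * e.2%:R.

Definition theta (e : nat -> multi_index) (tau : nat) : multi_index :=
  \sum_(1 <= i < tau.+1) e i.

Definition phi (n : nat) (e : nat -> multi_index) (tau : nat) : multi_index :=
  \sum_(tau.+2 <= i < n.+1) e i.

Definition area_integrand (R : realType) (r : R) (n : nat) (j : multi_index)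
    (f : R * R -> R) (z zeta : R * R) : R :=
  pd j (log_kernel zeta) z *
  (patch (fun=> 0) (disc r) f zeta - taylor (n - 2) f z zeta).

Definition boundary_integrand (R : realType) (n : nat) (e : nat -> multi_index)
    (f : R * R -> R) (tau : nat) (z zeta : R * R) : R :=
  pd (theta e tau) (log_kernel zeta) z *
  taylor (tau - 1) (pd (phi n e tau) f) z zeta *
  dot_midx (normal zeta) (e tau.+1).

(* Main.v *)
(* Regularize log|w| to L_s(w) = log(|w|^2 + s) / 2, which is smooth for s > 0.
   All derivatives of W_s(z) = int L_s(z - zeta) f(zeta) then pass under the
   integral.  Subtract from f its Taylor polynomial at z; iterating Green's
   formula on the polynomial part, whose derivatives eventually vanish, turns it
   into exactly the boundary terms of the statement.  As s -> 0, every derivative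
   of order m <= n of L_s converges with an error at most C s^c |w|^(-m-2c), for
   any 0 < c <= 1, while the Taylor remainder of order m - 2 is
   O(|zeta - z|^(m-2+nu)) locally uniformly in z; with c = nu/4 the product is
   s^c times an integrable singularity.  So all derivatives of W_s up to order n
   converge locally uniformly and the limit is differentiated term by term. *)
Require Import Defs.
From HB Require Import structures.
From mathcomp Require Import all_boot all_order all_algebra.
From mathcomp Require Import all_classical all_reals all_analysis.
From mathcomp Require Import measurable_realfun ring lra zify.
Import Order.TTheory GRing.Theory Num.Theory.
Import numFieldNormedType.Exports.
Local Open Scope classical_set_scope.
Local Open Scope ring_scope.
Set Implicit Arguments.
Unset Strict Implicit.
Unset Printing Implicit Defensive.

(** * Partial derivatives in the plane *)

Section PlaneCalculus.
Context {R : realType}.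
Implicit Types (U : set (R * R)) (f g : R * R -> R) (z w : R * R) (b : bool).

(** Polar coordinates are avoided: off the axes, |w|^(2(c-1)) is at most |w_1|^(c-1) |w_2|^(c-1), so
    Tonelli's theorem reduces the area estimates to one singular integral on a line. The value c =
    nu/4 is fitted to this majorant: kernel error times Taylor remainder has the exponent nu - 2 -
    2c, which equals 2(c-1) exactly when 4c = nu. The formula depends on an ordering of the
    directions and on a radius, whereas [pd] knows only the multi-index, and [Ck] asks for
    derivatives in any order. So one candidate is fixed for each multi-index, with sorted directions
    and radius r + 1. That differentiation leads from one candidate to the next is inherited from
    the regularized integrals, which depend on the multi-index alone. Any other ordering or radius
    gives a second limit of the same regularized derivative, hence the same value. Orders 0 and 1
    fit the scheme with the zero polynomial. Directions are indexed by a Boolean, so that each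
    argument is written once for both coordinates. *)

Definition dir b : R * R := if b then (0, 1) else (1, 0).
Definition mdir b : multi_index := if b then (0, 1)%N else (1, 0)%N.
Definition coord b z : R := if b then z.2 else z.1.
Definition upd b z (t : R) : R * R := if b then (z.1, t) else (t, z.2).
Definition dd b g : R * R -> R := fun z => 'D_(dir b) g z.

Lemma upd_coord b z : upd b z (coord b z) = z.
Proof. by case: b z => [] []. Qed.

Lemma coord_upd b c z t : coord b (upd c z t) = if b == c then t else coord b z.
Proof. by case: b; case: c. Qed.

Lemma upd_upd b z s t : upd b (upd b z s) t = upd b z t.
Proof. by case: b. Qed.

Lemma updC b z s t : upd b (upd (~~ b) z s) t = upd (~~ b) (upd b z t) s.
Proof. by case: b. Qed.

Lemma shift_dir b z h : h *: dir b + z = upd b z (h + coord b z).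
Proof.
by case: b; case: z => x y; congr pair; rewrite /= /GRing.scale /= ?mulr0 ?mulr1 ?add0r.
Qed.

Lemma is_derive_upd b f z t d :
  is_derive (upd b z t) (dir b) f d <-> is_derive t 1 (fun s => f (upd b z s)) d.
Proof.
have E : (fun h : R => h^-1 *: ((f \o shift (upd b z t)) (h *: dir b) - f (upd b z t))) =
    (fun h : R => h^-1 *: (((fun s => f (upd b z s)) \o shift t) (h *: (1 : R)) -
       f (upd b z t))).
  apply/funext => h /=; rewrite shift_dir upd_upd coord_upd eqxx.
  by rewrite [h *: 1]mulr1.
by split=> -[H1 H2]; constructor; move: H1 H2; rewrite /derivable /derive E.
Qed.

Lemma is_derive_dir b f z d :
  is_derive z (dir b) f d <-> is_derive (coord b z) 1 (fun s => f (upd b z s)) d.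
Proof. by rewrite -is_derive_upd upd_coord. Qed.

Lemma coord_MVT b f (df : R * R -> R) z t :
  (forall s, `|s - coord b z| <= `|t - coord b z| ->
     is_derive (upd b z s) (dir b) f (df (upd b z s))) ->
  exists2 s, `|s - coord b z| <= `|t - coord b z| &
    f (upd b z t) - f z = df (upd b z s) * (t - coord b z).
Proof.
set x := coord b z => H.
have cts s : `|s - x| <= `|t - x| -> {for s, continuous (fun s => f (upd b z s))}.
  move=> /H /is_derive_upd [/derivable1_diffP/differentiable_continuous ? _]; exact.
have [tx|xt] := leP t x.
- have bd s : s \in `[t, x] -> `|s - x| <= `|t - x|.
    rewrite in_itv /= => /andP[? ?]; rewrite !ler0_norm ?subr_le0 //; lra.
  have [||s s1 s2] := @MVT_segment R (fun s => f (upd b z s))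
    (fun s => df (upd b z s)) t x tx.
  + move=> s sI; apply/is_derive_upd/H/bd; exact: subset_itv_oo_cc sI.
  + apply: continuous_in_subspaceT => s; rewrite inE => /bd; exact: cts.
  + exists s; first exact: bd.
    by apply: oppr_inj; rewrite -mulrN !opprB -s2 upd_coord.
- have bd s : s \in `[x, t] -> `|s - x| <= `|t - x|.
    rewrite in_itv /= => /andP[? ?]; rewrite !ger0_norm ?subr_ge0 //; lra.
  have [||s s1 s2] := @MVT_segment R (fun s => f (upd b z s))
    (fun s => df (upd b z s)) x t (ltW xt).
  + move=> s sI; apply/is_derive_upd/H/bd; exact: subset_itv_oo_cc sI.
  + apply: continuous_in_subspaceT => s; rewrite inE => /bd; exact: cts.
  + by exists s; [exact: bd|rewrite -s2 upd_coord].
Qed.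

(** Sup-norm ball in coordinates: unlike in a Euclidean disc, one coordinate may be changed freely
    within its own range. *)
Definition box z (e : R) : set (R * R) :=
  [set w | forall b, `|coord b w - coord b z| < e].

Lemma nbhs_box z U : nbhs z U <-> exists2 e : R, 0 < e & box z e `<=` U.
Proof.
split.
- move=> /nbhs_ballP[e /= e0 H]; exists e => // w wz; apply: H; split.
  + by have := wz false; rewrite distrC.
  + by have := wz true; rewrite distrC.
- move=> [e e0 H]; apply/nbhs_ballP; exists e => // w [/= H1 H2]; apply: H => -[] /=;
  by rewrite distrC.
Qed.

Lemma open_box U z : open U -> U z -> exists2 e : R, 0 < e & box z e `<=` U.
Proof. by move=> oU Uz; apply/nbhs_box; apply: open_nbhs_nbhs. Qed.

Lemma box_upd b z w e t :
  box z e w -> `|t - coord b z| < e -> box z e (upd b w t).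
Proof. by move=> H ht c; rewrite coord_upd; case: eqP => [->|_]. Qed.

Lemma box_center z e : 0 < e -> box z e z.
Proof. by move=> e0 b; rewrite subrr normr0. Qed.

Lemma continuous_boxP g z : {for z, continuous g} <->
  forall e, 0 < e -> exists2 d, 0 < d & forall w, box z d w -> `|g w - g z| < e.
Proof.
split=> H.
- move=> e e0; have /cvgrPdist_lt/(_ e e0)/nbhs_box[d d0 dH] := H.
  by exists d => // w /dH /=; rewrite distrC.
- apply/cvgrPdist_lt => e e0; apply/nbhs_box; have [d d0 dH] := H e e0.
  by exists d => // w /dH /=; rewrite distrC.
Qed.

Lemma CkS k U g : Ck k.+1 U g <->
  (forall z, U z -> {for z, continuous g}) /\
  forall b, (forall z, U z -> derivable g z (dir b)) /\ Ck k U (dd b g).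
Proof.
split=> [[H1 [H2 H3 H4 H5]]|[H1 H2]].
  by split; [exact: H1|case; split; [exact: H3|exact: H5|exact: H2|exact: H4]].
split; first exact: H1.
by split; [exact: (H2 false).1|exact: (H2 true).1|exact: (H2 false).2|exact: (H2 true).2].
Qed.

Lemma Ck_continuous k U g z : Ck k U g -> U z -> {for z, continuous g}.
Proof. by case: k => [|k] [H _]; apply: H. Qed.

Lemma Ck_dd b k U g : Ck k.+1 U g -> Ck k U (dd b g).
Proof. by move=> /CkS[_ /(_ b)[]]. Qed.

Lemma Ck_is_derive b k U g z : Ck k.+1 U g -> U z ->
  is_derive z (dir b) g (dd b g z).
Proof. by move=> /CkS[_ /(_ b)[H _]] Uz; apply/derivableP/H. Qed.

Lemma CkW k U g : Ck k.+1 U g -> Ck k U g.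
Proof.
elim: k g => [|k IH] g; first by move=> [].
move=> /CkS[cg H]; apply/CkS; split; first exact: cg.
move=> b; have [H1 H2] := H b.
by split; [exact: H1|apply: IH].
Qed.

Lemma Ck_le m k U g : (m <= k)%N -> Ck k U g -> Ck m U g.
Proof.
move=> /subnK <-; elim: (k - m)%N => [//|i IH]; rewrite addSn => /CkW; exact: IH.
Qed.

Lemma open_near_eq U g h z : open U -> {in U, g =1 h} -> U z -> \near z, g z = h z.
Proof.
by move=> oU gh Uz; apply: filterS (open_nbhs_nbhs (conj oU Uz)) => w Uw; apply: gh; rewrite inE.
Qed.

Lemma eq_continuous U g h z : open U -> {in U, g =1 h} -> U z ->
  {for z, continuous g} -> {for z, continuous h}.
Proof.
move=> oU gh Uz; rewrite /prop_for /continuous_at -(gh z) ?inE //; apply: cvg_trans.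
by apply: near_eq_cvg; apply: filterS (open_near_eq oU gh Uz) => w ->.
Qed.

Lemma eq_dd b U g h : open U -> {in U, g =1 h} -> {in U, dd b g =1 dd b h}.
Proof.
move=> oU gh z /set_mem Uz; rewrite /dd; apply: near_eq_derive.
exact: open_near_eq gh Uz.
Qed.

Lemma eq_Ck k U g h : open U -> {in U, g =1 h} -> Ck k U g -> Ck k U h.
Proof.
move=> oU; elim: k g h => [|k IH] g h gh.
  by move=> [H _]; split=> // z Uz; apply: eq_continuous (H z Uz); eauto.
move=> /CkS[H1 H2]; apply/CkS; split.
  by move=> z Uz; apply: eq_continuous (H1 z Uz); eauto.
move=> b; have [H3 H4] := H2 b; split.
  move=> z Uz; apply: near_eq_derivable (H3 z Uz); exact: open_near_eq gh Uz.
by apply: IH H4; apply: eq_dd.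
Qed.

(** The mean value theorem is used twice: in direction [b] for the increment of [f] in the other
    direction, then in that other direction for [dd b f]. The left side is symmetric in the two
    coordinates, which is what makes mixed derivatives comparable. *)
Lemma second_difference b U f z e h : Ck 2 U f -> box z e `<=` U -> 0 < h < e ->
  exists2 w, box z e w &
    f (upd (~~ b) (upd b z (coord b z + h)) (coord (~~ b) z + h))
    - f (upd b z (coord b z + h)) - f (upd (~~ b) z (coord (~~ b) z + h)) + f z
    = h ^+ 2 * dd (~~ b) (dd b f) w.
Proof.
move=> Cf zU /andP[h0 he].
set x := coord b z; set y := coord (~~ b) z.
have e0 : 0 < e by exact: lt_trans he.
have inb w t c : box z e w -> `|t - coord c z| <= `|coord c z + h - coord c z| ->
    box z e (upd c w t).
  move=> zw; rewrite (addrC (coord c z)) addrK (gtr0_norm h0) => H.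
  by apply: box_upd => //; apply: le_lt_trans he.
have [|s s1 s2] := @coord_MVT b (fun w => f (upd (~~ b) w (y + h)) - f w)
  (fun w => dd b f (upd (~~ b) w (y + h)) - dd b f w) z (x + h).
- move=> s hs; apply/is_derive_upd; apply: is_deriveB.
  + rewrite (_ : (fun s => _) = (fun s => f (upd b (upd (~~ b) z (y + h)) s))); last first.
      by apply/funext => u; rewrite updC.
    rewrite -updC; apply/is_derive_upd; apply: Ck_is_derive Cf _; apply: zU.
    apply: (inb _ s b) => //; apply: (inb) => //; exact: box_center.
  + apply/is_derive_upd; apply: Ck_is_derive Cf _; apply: zU.
    apply: (inb _ s b) => //; exact: box_center.
- have bs : box z e (upd b z s) by apply: inb => //; exact: box_center.
  have [|t t1 t2] := @coord_MVT (~~ b) (dd b f) (dd (~~ b) (dd b f)) (upd b z s) (y + h).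
  + move=> t; rewrite coord_upd (_ : (~~ b == b) = false) ?addbb; last by case: (b).
    move=> ht; apply: (@Ck_is_derive _ 0 U); first exact: Ck_dd.
    by apply: zU; apply: inb.
  + move: t1 t2; rewrite coord_upd (_ : (~~ b == b) = false); last by case: (b).
    move=> t1 t2; exists (upd (~~ b) (upd b z s) t); first exact: inb.
    rewrite t2 in s2.
    transitivity (dd (~~ b) (dd b f) (upd (~~ b) (upd b z s) t) * (y + h - y) * (x + h - x)).
      by rewrite -s2; ring.
    ring.
Qed.

Lemma dist_halves (u x y e : R) : `|u - y| < e / 2 -> `|u - x| < e / 2 -> `|x - y| <= e.
Proof. by rewrite !ltr_norml ler_norml => /andP[? ?] /andP[? ?]; apply/andP; split; lra. Qed.

(** Schwarz's theorem: the second difference over one small square is h^2 times either mixed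
    derivative, each taken at its own nearby point, and both are continuous at [z]. *)
Lemma dd_comm b U f z : open U -> Ck 2 U f -> U z ->
  dd (~~ b) (dd b f) z = dd b (dd (~~ b) f) z.
Proof.
move=> oU Cf Uz; apply/eqP; rewrite -subr_eq0 -normr_eq0; apply/eqP/le_anti.
rewrite normr_ge0 andbT; apply/ler_addgt0Pr => e e0; rewrite add0r.
have [d d0 dU] := open_box oU Uz.
have cont c : {for z, continuous (dd (~~ c) (dd c f))}.
  by apply: (@Ck_continuous 0 U) => //; do 2 apply: Ck_dd.
have e20 : 0 < e / 2 by rewrite divr_gt0.
have [d1 d10 d1H] := (continuous_boxP _ _).1 (cont b) _ e20.
have [d2 d20 d2H] := (continuous_boxP _ _).1 (cont (~~ b)) _ e20.
pose D := Num.min d (Num.min d1 d2).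
have D0 : 0 < D by rewrite !lt_min d0 d10 d20.
have sub w : box z D w -> [/\ U w, box z d1 w & box z d2 w].
  move=> H; have H' c : [/\ `|coord c w - coord c z| < d, `|coord c w - coord c z| < d1 &
    `|coord c w - coord c z| < d2] by have := H c; rewrite !lt_min => /and3P[].
  by split; [apply: dU => c|move=> c|move=> c]; have [] := H' c.
have DU : box z D `<=` U by move=> w /sub[].
have hD : 0 < D / 2 < D by apply/andP; split; lra.
have [w1 w1D E1] := second_difference b Cf DU hD.
have [w2 w2D] := second_difference (~~ b) Cf DU hD.
rewrite negbK updC => E2.
have {E1 E2} : (D / 2) ^+ 2 * dd (~~ b) (dd b f) w1 = (D / 2) ^+ 2 * dd b (dd (~~ b) f) w2.
  by apply: etrans (esym E1) (etrans _ E2); congr (_ + f z); rewrite addrAC.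
have D2 : (D / 2) ^+ 2 != 0 by rewrite expf_neq0 // gt_eqF //; lra.
move=> /(mulfI D2) E.
have [_ w1d _] := sub _ w1D; have [_ _ w2d] := sub _ w2D.
have := d1H _ w1d; have := d2H _ w2d; rewrite negbK E; exact: dist_halves.
Qed.

End PlaneCalculus.

(** * Derivatives indexed by multi-indices *)

Section MultiIndex.
Context {R : realType}.
Implicit Types (U : set (R * R)) (f g : R * R -> R) (z w : R * R) (b : bool)
  (i j : multi_index).

Lemma midx_sizeD i j : midx_size (i + j) = (midx_size i + midx_size j)%N.
Proof. by rewrite /midx_size /=; lia. Qed.

Lemma addm_mdir b (p q : nat) :
  ((p, q) : multi_index) + mdir b = if b then (p, q.+1) else (p.+1, q).
Proof. by case: b; congr pair; [exact: addn0|exact: addn1|exact: addn1|exact: addn0]. Qed.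

Lemma midx_size_mdir b : midx_size (mdir b) = 1%N.
Proof. by case: b. Qed.

Lemma Ck_iter b k p U g : Ck (k + p) U g -> Ck k U (iter p (@dd R b) g).
Proof.
elim: p k => [|p IH] k; first by rewrite addn0.
by rewrite addnS => H; apply: Ck_dd; apply: IH.
Qed.

Lemma Ck_pd k j U g : Ck (k + midx_size j) U g -> Ck k U (pd j g).
Proof.
move=> H; apply: (@Ck_iter false); apply: (@Ck_iter true).
by rewrite -addnA.
Qed.

Lemma eq_pd j U g h : open U -> {in U, g =1 h} -> {in U, pd j g =1 pd j h}.
Proof.
move=> oU gh; rewrite /pd; elim: j.1 => [|p IH] /=.
  by elim: j.2 => [//|q IH] /=; apply: (@eq_dd _ true).
exact: (@eq_dd _ false).
Qed.

(** [pd] applies the first-coordinate derivatives last, so [b = false] holds by definition; for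
    [b = true] the new derivative is moved inside past the others by [dd_comm]. *)
Lemma dd_pd b j U g : open U -> Ck (midx_size j).+1 U g ->
  {in U, dd b (pd j g) =1 pd (j + mdir b) g}.
Proof.
case: j => p q oU; case: b; last by move=> _ z _; rewrite addm_mdir.
elim: p => [|p IH] Cg z Uz; first by rewrite addm_mdir.
rewrite (_ : pd (p.+1, q) g = dd false (pd (p, q) g)) //.
rewrite (_ : pd ((p.+1, q) + mdir true) g = dd false (pd ((p, q) + mdir true) g)) //.
rewrite (@dd_comm _ false U) //; last by move: Uz; rewrite inE.
  by apply: (@eq_dd _ false) Uz => //; apply: IH; apply: CkW.
by apply: Ck_pd; exact: Cg.
Qed.

Lemma pd_pd i j U g : open U -> Ck (midx_size i + midx_size j) U g ->
  {in U, pd i (pd j g) =1 pd (j + i) g}.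
Proof.
case: i => p q oU; elim: p => [|p IH].
  elim: q => [|q IH] Cg z Uz; first by rewrite addr0.
  have E : {in U, pd (0%N, q) (pd j g) =1 pd (j + (0, q)%N) g}.
    by apply: IH; apply: CkW.
  rewrite (_ : pd (0%N, q.+1) (pd j g) = dd true (pd (0%N, q) (pd j g))) //.
  rewrite (eq_dd true oU E) // (dd_pd true oU) //.
    by rewrite -addrA addm_mdir.
  apply: Ck_le Cg; rewrite midx_sizeD /midx_size /=; lia.
move=> Cg z Uz.
have E : {in U, pd (p, q) (pd j g) =1 pd (j + (p, q)) g}.
  by apply: IH; apply: CkW.
rewrite (_ : pd (p.+1, q) (pd j g) = dd false (pd (p, q) (pd j g))) //.
rewrite (eq_dd false oU E) // (dd_pd false oU) //.
  by rewrite -addrA addm_mdir.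
apply: Ck_le Cg; rewrite midx_sizeD /midx_size /=; lia.
Qed.

Lemma pd_dd b j U g : open U -> Ck (midx_size j).+1 U g ->
  {in U, pd j (dd b g) =1 pd (j + mdir b) g}.
Proof.
move=> oU Cg z Uz; rewrite addrC -(@pd_pd _ _ U) //; first by case: (b).
by rewrite midx_size_mdir addn1.
Qed.

End MultiIndex.

(** * Derivatives of the regularized kernel *)

Section Kernel.
Context {R : realType}.
Implicit Types (z w : R * R) (b : bool) (j : multi_index) (s : R).

Definition qs s w : R := w.1 ^+ 2 + w.2 ^+ 2 + s.
Definition logk s w : R := ln (qs s w) / 2.
(** The whole plane for s > 0 and the punctured plane for s = 0, so that the same smoothness lemmas
    serve the regularized kernels and the logarithm itself. *)
Definition qpos s : set (R * R) := [set w | 0 < qs s w].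

(* Families homogeneous of degree [- m] jointly in [w] and [sqrt s]. *)
Inductive hom (m : nat) : (R -> R * R -> R) -> Prop :=
| hom_mono (c : R) (a1 a2 k : nat) : (a1 + a2 + m = 2 * k)%N ->
    hom m (fun s w => c * (w.1 ^+ a1 * w.2 ^+ a2) / qs s w ^+ k)
| hom_add K1 K2 : hom m K1 -> hom m K2 -> hom m (fun s w => K1 s w + K2 s w).

Lemma continuous_coord b w : {for w, continuous (@coord R b)}.
Proof. by case: b; [exact: cvg_snd|exact: cvg_fst]. Qed.

Lemma continuousX (T : topologicalType) (f : T -> R) n x :
  {for x, continuous f} -> {for x, continuous (fun y => f y ^+ n)}.
Proof.
move=> cf; apply: (@continuous_comp _ _ _ f (fun u => u ^+ n)) => //.
exact: exprn_continuous.
Qed.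

Lemma continuous_qs s w : {for w, continuous (qs s)}.
Proof.
apply: cvgD; last exact: cvg_cst.
by apply: cvgD; apply: continuousX;
  [exact: (@continuous_coord false)|exact: (@continuous_coord true)].
Qed.

Lemma open_qpos s : open (qpos s).
Proof.
rewrite /qpos -[X in open X]/(qs s @^-1` [set x | 0 < x]).
by apply: open_comp; [move=> w _; exact: continuous_qs|exact: open_gt].
Qed.

Lemma hom_continuous m K s w : hom m K -> 0 < qs s w -> {for w, continuous (K s)}.
Proof.
move=> hK q0; elim: hK => [c a b k _|K1 K2 _ c1 _ c2]; last exact: cvgD.
apply: cvgM.
  apply: cvgM; first exact: cvg_cst.
  by apply: cvgM; apply: continuousX;
    [exact: (@continuous_coord false)|exact: (@continuous_coord true)].
apply: cvgV; first by rewrite expf_neq0 // gt_eqF.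
by apply: continuousX; exact: continuous_qs.
Qed.

Lemma qs_upd b s w t : qs s (upd b w t) = t ^+ 2 + (coord (~~ b) w ^+ 2 + s).
Proof. by case: b; rewrite /qs /=; ring. Qed.

Lemma is_derive_powr (n : nat) (x : R) :
  is_derive x 1 (fun t => t ^+ n) (n%:R * x ^+ n.-1).
Proof.
rewrite (_ : (fun t => _) = id ^+ n); last by rewrite exprfctE.
by apply: is_derive_eq; rewrite /GRing.scale /= mulr1.
Qed.

Lemma is_derive_invq (k : nat) (A x : R) : x ^+ 2 + A != 0 ->
  is_derive x 1 (fun t => (t ^+ 2 + A) ^- k)
    (- (2 * k%:R) * x / (x ^+ 2 + A) ^+ k.+1).
Proof.
move=> A0.
have D1 : is_derive x 1 (fun t => t ^+ 2 + A) (2 * x).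
  have := is_deriveD (is_derive_powr 2 x) (is_derive_cst A x 1).
  by rewrite addr0 /= expr1.
have D2 := is_deriveX k D1; rewrite exprfctE in D2.
have D3 := @is_deriveV R (fun t => (t ^+ 2 + A) ^+ k) x _ 1 (expf_neq0 k A0) D2.
apply: (is_derive_eq D3).
rewrite /GRing.scale /=.
case: k {D2 D3} => [|k] /=; first by rewrite !mul0r mulr0 mulr0 oppr0 !mul0r.
set q := x ^+ 2 + A in A0 *.
have q0 : q ^+ k != 0 by rewrite expf_neq0.
by rewrite !exprS; field; rewrite A0 q0.
Qed.

(** Along one coordinate x, the derivative of x^A / q^k is A x^(A-1) / q^k - 2k x^(A+1) / q^(k+1),
    and both terms have degree lower by one. [K'] is one family for all [s], so that its members at
    s and at 0 can later be compared. *)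
Lemma hom_derive b m K : hom m K -> exists2 K', hom m.+1 K' &
  forall s w, 0 < qs s w -> is_derive w (dir b) (K s) (K' s w).
Proof.
elim=> [c a1 a2 k E|K1 K2 _ [K1' h1 d1] _ [K2' h2 d2]]; last first.
  exists (fun s w => K1' s w + K2' s w); first exact: hom_add.
  by move=> s w q; apply: is_deriveD; [apply: d1|apply: d2].
pose A := if b then a2 else a1; pose B := if b then a1 else a2.
have mono s w : c * (w.1 ^+ a1 * w.2 ^+ a2) / qs s w ^+ k =
    (c * coord (~~ b) w ^+ B) * (coord b w ^+ A * qs s w ^- k).
  by rewrite /A /B; case: (b) => /=; ring.
pose Kd s w := (c * coord (~~ b) w ^+ B) *
   (A%:R * coord b w ^+ A.-1 / qs s w ^+ k
    - 2 * k%:R * coord b w ^+ A.+1 / qs s w ^+ k.+1).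
have der s w : 0 < qs s w ->
    is_derive w (dir b) (fun w => c * (w.1 ^+ a1 * w.2 ^+ a2) / qs s w ^+ k) (Kd s w).
  move=> q; apply/is_derive_dir.
  have E1 : qs s w = coord b w ^+ 2 + (coord (~~ b) w ^+ 2 + s).
    by rewrite -qs_upd upd_coord.
  rewrite (_ : (fun t => _) = (fun t => (c * coord (~~ b) w ^+ B) *:
     (t ^+ A * (t ^+ 2 + (coord (~~ b) w ^+ 2 + s)) ^- k))); last first.
    apply/funext => t; rewrite mono !coord_upd eqxx qs_upd.
    by case: (b).
  have q' : coord b w ^+ 2 + (coord (~~ b) w ^+ 2 + s) != 0 by rewrite -E1 gt_eqF.
  have D := is_deriveZ (c * coord (~~ b) w ^+ B)
     (is_deriveM (is_derive_powr A (coord b w)) (is_derive_invq k q')).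
  apply: (is_derive_eq D).
  rewrite /Kd E1 /GRing.scale /= !exprS; ring.
have hB : hom m.+1 (fun s w => - (2 * k%:R * c) * (w.1 ^+ (if b then a1 else a1.+1) *
    w.2 ^+ (if b then a2.+1 else a2)) / qs s w ^+ k.+1).
  by apply: hom_mono; case: (b) => /=; lia.
(* For [A = 0] the truncated exponent [A.-1] would give a monomial of the wrong degree, so the term
   with zero coefficient is left out. *)
case: (posnP A) => A0.
  exists (fun s w => - (2 * k%:R * c) * (w.1 ^+ (if b then a1 else a1.+1) *
    w.2 ^+ (if b then a2.+1 else a2)) / qs s w ^+ k.+1) => // s w q.
  apply: (is_derive_eq (der _ _ q)).
  rewrite /Kd A0 !mul0r sub0r.
  by move: A0; rewrite /B /A; case: (b) => /= ->; ring.
exists (fun s w => (c * A%:R) * (w.1 ^+ (if b then a1 else a1.-1) *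
    w.2 ^+ (if b then a2.-1 else a2)) / qs s w ^+ k +
  (- (2 * k%:R * c) * (w.1 ^+ (if b then a1 else a1.+1) *
    w.2 ^+ (if b then a2.+1 else a2)) / qs s w ^+ k.+1)).
  apply: hom_add => //; apply: hom_mono.
  by move: A0; rewrite /A; case: (b) => /=; lia.
move=> s w q; apply: (is_derive_eq (der _ _ q)).
by rewrite /Kd /A /B; case: (b) => /=; ring.
Qed.

Lemma hom_Ck k m K s : hom m K -> Ck k (qpos s) (K s).
Proof.
elim: k m K => [|k IH] m K hK.
  by split=> // w qw; exact: hom_continuous hK qw.
apply/CkS; split=> [w qw|b]; first exact: hom_continuous hK qw.
have [K' hK' dK'] := hom_derive b hK; split=> [w qw|].
  by have [] := dK' _ _ qw.
apply: (@eq_Ck _ k _ (K' s)); last exact: IH hK'.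
  exact: open_qpos.
by move=> w; rewrite inE => qw; have [_ <-] := dK' _ _ qw.
Qed.

(** The logarithm is not homogeneous, but its first derivatives w_b / q are; the homogeneous
    families therefore start at order 1. *)
Lemma hom_logk b : exists2 K, hom 1 K &
  forall s w, 0 < qs s w -> is_derive w (dir b) (logk s) (K s w).
Proof.
exists (fun s w => 1 * (w.1 ^+ (~~ b) * w.2 ^+ b) / qs s w ^+ 1).
  by apply: hom_mono; case: b.
move=> s w q; apply/is_derive_dir.
have E1 : qs s w = coord b w ^+ 2 + (coord (~~ b) w ^+ 2 + s).
  by rewrite -qs_upd upd_coord.
rewrite (_ : (fun t => _) = (fun t => 2^-1 *: ln (t ^+ 2 + (coord (~~ b) w ^+ 2 + s)))); last first.
  by apply/funext => t; rewrite /logk qs_upd /GRing.scale /= mulrC.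
set A := _ + s in E1 *.
have D1 : is_derive (coord b w) 1 (fun t => t ^+ 2 + A) (2 * coord b w).
  have := is_deriveD (is_derive_powr 2 (coord b w)) (is_derive_cst A (coord b w) 1).
  by rewrite addr0 /= expr1.
have D2 : is_derive (coord b w ^+ 2 + A) 1 (@ln R) (coord b w ^+ 2 + A)^-1.
  by apply: is_derive1_ln; rewrite -E1.
have D := is_deriveZ (2^-1 : R)
  (@is_derive1_comp R (@ln R) (fun t => t ^+ 2 + A) (coord b w) _ _ D2 D1).
apply: (is_derive_eq D).
rewrite -E1 /GRing.scale /=; have := lt0r_neq0 q.
by case: (b) => /= q0; rewrite ?expr1 ?expr0; field.
Qed.

Lemma logk_continuous s w : 0 < qs s w -> {for w, continuous (logk s)}.
Proof.
move=> q; apply: cvgM; last exact: cvg_cst.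
apply: (@continuous_comp _ _ _ (qs s) (@ln R) w); first exact: continuous_qs.
exact: continuous_ln.
Qed.

Lemma logk_Ck k s : Ck k (qpos s) (logk s).
Proof.
case: k => [|k]; first by split=> // w; exact: logk_continuous.
apply/CkS; split=> [w|b]; first exact: logk_continuous.
have [K' hK' dK'] := hom_logk b; split=> [w qw|].
  by have [] := dK' _ _ qw.
apply: (@eq_Ck _ k _ (K' s)); [exact: open_qpos| |exact: hom_Ck hK'].
by move=> w; rewrite inE => qw; have [_ <-] := dK' _ _ qw.
Qed.

Lemma hom_step b (f : R -> R * R -> R) m K : hom m K ->
  (forall s, {in qpos s, f s =1 K s}) ->
  exists2 K', hom m.+1 K' & forall s, {in qpos s, dd b (f s) =1 K' s}.
Proof.
move=> hK fK; have [K' hK' dK'] := hom_derive b hK; exists K' => // s w qw.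
rewrite (eq_dd b (@open_qpos s) (fK s)) //.
by rewrite inE in qw; have [_ <-] := dK' _ _ qw.
Qed.

Lemma pd_logk j : (0 < midx_size j)%N -> exists2 K, hom (midx_size j) K &
  forall s, {in qpos s, pd j (logk s) =1 K s}.
Proof.
have base b : exists2 K, hom 1 K & forall s, {in qpos s, dd b (logk s) =1 K s}.
  have [K' hK' dK'] := hom_logk b; exists K' => // s w; rewrite inE => qw.
  by have [_ <-] := dK' _ _ qw.
case: j => p q; elim: p => [|p IH].
  elim: q => [//|[|q] IH] _; first exact: (base true).
  have [//|K hK eK] := IH; exact: (@hom_step true (fun s => pd (0, q.+1)%N (logk s)) _ _ hK eK).
case: (posnP (p + q)) => [/eqP|pq _].
  by rewrite addn_eq0 => /andP[/eqP-> /eqP->] _; exact: (base false).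
have [//|K hK eK] := IH.
exact: (@hom_step false (fun s => pd (p, q)%N (logk s)) _ _ hK eK).
Qed.

End Kernel.

(** * The Euclidean modulus *)

Section Cmod.
Context {R : realType}.
Implicit Types (z w : R * R) (b : bool).

Lemma cmod_ge0 w : 0 <= cmod w. Proof. exact: sqrtr_ge0. Qed.

Lemma sqr_cmod w : cmod w ^+ 2 = w.1 ^+ 2 + w.2 ^+ 2.
Proof. by rewrite sqr_sqrtr // addr_ge0 // sqr_ge0. Qed.

Lemma cmod_eq0 w : (cmod w == 0) = (w == 0).
Proof.
rewrite -sqrf_eq0 sqr_cmod paddr_eq0 ?sqr_ge0 // !sqrf_eq0.
by case: w => x y.
Qed.

Lemma cmod_gt0 w : (0 < cmod w) = (w != 0).
Proof. by rewrite lt_def cmod_ge0 andbT cmod_eq0. Qed.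

Lemma coord_le_cmod b w : `|coord b w| <= cmod w.
Proof.
rewrite -ler_sqr ?nnegrE ?cmod_ge0 // sqr_cmod real_normK ?num_real //.
by case: b; [rewrite lerDr|rewrite lerDl]; rewrite sqr_ge0.
Qed.

Lemma cmod_le_sum w : cmod w <= `|w.1| + `|w.2|.
Proof.
rewrite -ler_sqr ?nnegrE ?cmod_ge0 ?addr_ge0 // sqr_cmod sqrrD !real_normK ?num_real //.
by rewrite addrAC lerDl mulrn_wge0 // mulr_ge0.
Qed.

Lemma cmodN w : cmod (- w) = cmod w.
Proof. by rewrite /cmod /= !sqrrN. Qed.

Lemma cmod_distC z w : cmod (z - w) = cmod (w - z).
Proof. by rewrite -cmodN opprB. Qed.

Lemma cmodD z w : cmod (z + w) <= cmod z + cmod w.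
Proof.
rewrite -ler_sqr ?nnegrE ?addr_ge0 ?cmod_ge0 // sqrrD !sqr_cmod /=.
set p := cmod z * cmod w.
have p0 : 0 <= p by rewrite mulr_ge0 ?cmod_ge0.
have H : z.1 * w.1 + z.2 * w.2 <= p.
  have [H|H] := leP (z.1 * w.1 + z.2 * w.2) 0; first exact: le_trans p0.
  rewrite -ler_sqr ?nnegrE // ?(ltW H) // /p exprMn !sqr_cmod.
  (* Cauchy-Schwarz by Lagrange's identity: this square is the difference of the two sides. *)
  have := sqr_ge0 (z.1 * w.2 - z.2 * w.1); move: (z.1) (z.2) (w.1) (w.2) => x y x' y' h.
  rewrite -subr_ge0; apply: le_trans h _; rewrite le_eqVlt; apply/orP; left; apply/eqP; ring.
rewrite -/p -mulr_natl; move: H.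
move: p {p0} (z.1) (z.2) (w.1) (w.2) => p x y x' y' H.
rewrite -[(x + x') ^+ 2 + _](_ :
  (x ^+ 2 + y ^+ 2) + 2 * (x * x' + y * y') + (x' ^+ 2 + y' ^+ 2) = _); last ring.
by rewrite lerD2r lerD2l ler_pM2l.
Qed.

Lemma cmod_continuous w : {for w, continuous (@cmod R)}.
Proof.
apply: (@continuous_comp _ _ _ (fun w => w.1 ^+ 2 + w.2 ^+ 2) (@Num.sqrt R) w).
  by apply: cvgD; apply: continuousX;
    [exact: (@continuous_coord _ false)|exact: (@continuous_coord _ true)].
exact: sqrt_continuous.
Qed.

(** Holds at [z = zeta] as well: [ln 0] is 0 by convention, so both sides vanish there. *)
Lemma log_kernelE (zeta z : R * R) : log_kernel zeta z = logk 0 (z - zeta).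
Proof.
rewrite /log_kernel /logk; have -> : qs 0 (z - zeta) = cmod (z - zeta) ^+ 2.
  by rewrite sqr_cmod /qs addr0.
have := cmod_ge0 (z - zeta); rewrite le_eqVlt => /predU1P[<-|c0].
  by rewrite expr0n /= ln0 // mul0r.
by rewrite lnXn // mulr2n; lra.
Qed.

End Cmod.

(** * Error of the regularized kernel *)

Section KernelBound.
Context {R : realType}.
Implicit Types (w : R * R) (s x c : R).

(** Interpolates between the bounds 1 and x: with x = s / |w|^2 the additional singularity becomes
    |w|^(-2c) instead of |w|^(-2). *)
Lemma min1_powR x c : 0 <= x -> 0 < c <= 1 -> Num.min 1 x <= x `^ c.
Proof.
move=> x0 /andP[c0 c1]; have [x1|x1] := leP 1 x.
  by rewrite -(powRr0 x) ler_powR // ltW.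
have [->|xn0] := eqVneq x 0; first by rewrite powR0 // gt_eqF.
by apply: ger1_powR => //; rewrite lt_def xn0 x0 ltW.
Qed.

(** Raising k by one adds (1+x)^(-k) x/(1+x), and x/(1+x) is at most both 1 and x; hence the factor
    k. *)
Lemma expV_diff_le (k : nat) x : 0 <= x ->
  0 <= 1 - (1 + x) ^- k <= k%:R * Num.min 1 x.
Proof.
move=> x0; have x1 : 0 < 1 + x by apply: ltr_pwDl.
have inv1 n : 0 < (1 + x) ^- n <= 1.
  by rewrite invr_gt0 exprn_gt0 //= invf_le1 ?exprn_gt0 // exprn_ege1 // lerDl.
apply/andP; split; first by rewrite subr_ge0; case/andP: (inv1 k).
elim: k => [|k IH]; first by rewrite expr0 invr1 subrr mul0r.
have -> : 1 - (1 + x) ^- k.+1 = (1 - (1 + x) ^- k) + (1 + x) ^- k * (x / (1 + x)).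
  by rewrite exprS; field; rewrite !lt0r_neq0 ?exprn_gt0.
rewrite -natr1 mulrDl mul1r; apply: lerD => //.
have /andP[i0 i1] := inv1 k.
have h : 0 <= x / (1 + x) <= Num.min 1 x.
  rewrite divr_ge0 ?(ltW x1) //= le_min !ler_pdivrMr // mul1r lerDr ler01 /=.
  by rewrite mulrDr mulr1 lerDl mulr_ge0.
case/andP: h => h0 h1; apply: le_trans h1; rewrite -[leRHS]mul1r.
by apply: ler_wpM2r.
Qed.

Lemma qs_gt0 s w : 0 <= s -> w != 0 -> 0 < qs s w.
Proof.
by move=> s0 w0; rewrite /qs -sqr_cmod ltr_pwDl // exprn_gt0 // cmod_gt0.
Qed.

(** With x = s / |w|^2 one has q = |w|^2 (1 + x), so a monomial changes between s and 0 by the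
    relative factor 1 - (1+x)^(-k), while at s = 0 it is at most |c| |w|^(-m) by homogeneity. *)
Lemma hom_bound m K : hom m K -> exists2 C, 0 <= C & forall s w, 0 <= s -> w != 0 ->
  `|K s w - K 0 w| <= C * Num.min 1 (s / cmod w ^+ 2) / cmod w ^+ m.
Proof.
elim=> [c a1 a2 k E|K1 K2 _ [C1 h1 H1] _ [C2 h2 H2]]; last first.
  exists (C1 + C2); first exact: addr_ge0.
  move=> s w s0 w0; rewrite !mulrDl opprD addrACA.
  by apply: le_trans (ler_normD _ _) _; apply: lerD; [apply: H1|apply: H2].
exists (`|c| * k%:R); first by rewrite mulr_ge0.
move=> s w s0 w0; set y := cmod w; have y0 : 0 < y by rewrite cmod_gt0.
set x := s / y ^+ 2; have x0 : 0 <= x by rewrite divr_ge0 ?exprn_ge0 // ltW.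
have yn : y != 0 by rewrite gt_eqF.
have x1n : 1 + x != 0 by rewrite gt_eqF // ltr_pwDl.
have -> : qs s w = y ^+ 2 * (1 + x) by rewrite /qs -sqr_cmod -/y /x; field.
have -> : qs 0 w = y ^+ 2 by rewrite /qs -sqr_cmod addr0.
rewrite -mulrBr exprMn -exprM.
have -> : ((y ^+ (2 * k) * (1 + x) ^+ k)^-1 - y ^- (2 * k)) =
   - (y ^- (2 * k) * (1 - (1 + x) ^- k)).
  by field; rewrite !expf_neq0.
have /andP[d0 d1] := expV_diff_le k x0.
have yk : 0 <= y ^- (2 * k) by rewrite invr_ge0 exprn_ge0 // ltW.
rewrite mulrN normrN 2!normrM (normrM (y ^- _)) (ger0_norm d0) (ger0_norm yk).
have -> : `|c| * `|w.1 ^+ a1 * w.2 ^+ a2| * (y ^- (2 * k) * (1 - (1 + x) ^- k)) =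
  (`|c| * (1 - (1 + x) ^- k)) * (`|w.1 ^+ a1 * w.2 ^+ a2| * y ^- (2 * k)) by ring.
apply: ler_pM; [exact: mulr_ge0|exact: mulr_ge0| |].
  by rewrite -mulrA ler_wpM2l.
rewrite -E exprD invfM mulrA ler_piMl ?invr_ge0 ?exprn_ge0 ?(ltW y0) //.
rewrite ler_pdivrMr ?exprn_gt0 // mul1r normrM !normrX exprD.
by apply: ler_pM; rewrite ?exprn_ge0 //; apply: lerXn2r;
  rewrite ?nnegrE ?cmod_ge0 //; [exact: (coord_le_cmod false)|exact: (coord_le_cmod true)].
Qed.

(** For x < 1, ln(1+x) <= x <= x^c. For x >= 1, ln(1+x) = ln(1 + 1/x) + ln x, where the first term
    is at most 1 <= x^c and ln x = ln(x^c) / c <= x^c / c; hence the constant 1 + 1/c. *)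
Lemma ln1D_le x c : 0 <= x -> 0 < c <= 1 -> 0 <= ln (1 + x) <= (1 + c^-1) * x `^ c.
Proof.
move=> x0 /andP[c0 c1]; rewrite ln_ge0 ?lerDl //=.
have p0 : 0 <= c^-1 * x `^ c by rewrite mulr_ge0 ?invr_ge0 ?powR_ge0 ?(ltW c0).
rewrite mulrDl mul1r; have [x1|x1] := leP 1 x; last first.
  apply: le_trans (le_ln1Dx _) _; first by apply: lt_le_trans x0; rewrite ltrN10.
  have := @min1_powR x c x0; rewrite c0 c1 => /(_ isT).
  by rewrite (min_r (ltW x1)) => h; apply: le_trans h _; rewrite lerDl.
have x00 : 0 < x by apply: lt_le_trans x1.
have -> : 1 + x = (1 + x^-1) * x by rewrite mulrDl mulVf ?gt_eqF // mul1r addrC.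
rewrite lnM ?posrE //; last by rewrite addr_gt0 ?invr_gt0.
apply: lerD.
  apply: le_trans (le_ln1Dx _) _.
    by apply: lt_trans (_ : 0 < _); rewrite ?ltrN10 ?invr_gt0.
  by apply: le_trans (_ : 1 <= _); [rewrite invf_le1|rewrite -(powRr0 x) ler_powR // ltW].
rewrite ler_pdivlMl // -ln_powR; apply/ltW/ln_sublinear.
by rewrite powR_gt0.
Qed.

(** Positive orders are homogeneous and follow from [hom_bound]. At order 0 the difference is ln(1 +
    s / |w|^2) / 2, which is unbounded at the origin and needs [ln1D_le]. *)
Lemma pd_logk_cvg (j : multi_index) c : 0 < c <= 1 ->
  exists2 C, 0 <= C & forall s w, 0 <= s -> w != 0 ->
  `|pd j (logk s) w - pd j (logk 0) w|
    <= C * (s / cmod w ^+ 2) `^ c / cmod w ^+ midx_size j.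
Proof.
move=> c01; have [j0|j0] := posnP (midx_size j); last first.
  have [K hK eK] := @pd_logk R _ j0; have [C C0 HC] := hom_bound hK.
  exists C => // s w s0 w0; rewrite !eK ?inE; [|exact: qs_gt0..].
  apply: le_trans (HC _ _ s0 w0) _; rewrite ler_wpM2r ?invr_ge0 ?exprn_ge0 ?cmod_ge0 //.
  by apply: ler_wpM2l => //; apply: min1_powR => //; rewrite divr_ge0 ?exprn_ge0 ?cmod_ge0.
have -> : j = (0, 0)%N.
  by move/eqP: j0; rewrite addn_eq0; case: j => p q /andP[/eqP/= -> /eqP/= ->].
have C0 : 0 <= 1 + c^-1 by rewrite addr_ge0 // invr_ge0 ltW //; case/andP: c01.
exists (1 + c^-1) => // s w s0 w0; rewrite expr0 divr1 /pd /= /logk.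
have y0 : 0 < cmod w ^+ 2 by rewrite exprn_gt0 // cmod_gt0.
have x0 : 0 <= s / cmod w ^+ 2 by rewrite divr_ge0 // ltW.
have -> : qs s w = cmod w ^+ 2 * (1 + s / cmod w ^+ 2).
  by rewrite /qs -sqr_cmod; field; rewrite -cmod_eq0 in w0.
have -> : qs 0 w = cmod w ^+ 2 by rewrite /qs -sqr_cmod addr0.
rewrite lnM ?posrE //; last by rewrite ltr_pwDl.
rewrite mulrDl addrAC subrr add0r.
have /andP[l0 l1] := ln1D_le x0 c01.
rewrite ger0_norm ?divr_ge0 //; apply: le_trans l1.
by rewrite ler_pdivrMr // ler_peMr // ler1n.
Qed.

End KernelBound.

(** * Derivatives of locally uniform limits *)

Section DerivativeOfLimit.
Context {R : realType}.
Implicit Types (U : set (R * R)) (z w : R * R) (b : bool) (F H : R -> R * R -> R).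

Lemma is_derive1_eps (g : R -> R) x l :
  (forall e, 0 < e -> exists2 d, 0 < d &
     forall t, `|t| < d -> `|g (t + x) - g x - t * l| <= e * `|t|) ->
  is_derive x 1 g l.
Proof.
move=> D; have C : (fun h : R => h^-1 *: ((g \o shift x) (h *: (1 : R)) - g x)) @ 0^' --> l.
  apply/cvgrPdist_le => e e0; have [d d0 dD] := D _ e0.
  apply/nbhs_ballP; exists d => // t; rewrite -ball_normE /= sub0r normrN => td t0.
  have t0' : 0 < `|t| by rewrite normr_gt0.
  rewrite -(ler_pM2r t0') -normrM; apply: le_trans (dD t td).
  rewrite -normrN /GRing.scale /= mulr1.
  rewrite le_eqVlt; apply/orP; left; apply/eqP; congr `|_|; field.
  exact: t0.
by constructor; [exact: cvgP C|exact: cvg_lim C].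
Qed.

(** The box size [d] is fixed before the tolerance [e], so one neighbourhood of [z] serves all
    tolerances. *)
Definition lucvg U F (G : R * R -> R) := forall z, U z ->
  exists2 d, 0 < d & forall e, 0 < e -> exists2 s0, 0 < s0 &
    forall s w, 0 < s <= s0 -> box z d w -> `|F s w - G w| <= e.

Lemma lucvg_continuous U F G : lucvg U F G ->
  (forall s z, 0 < s -> U z -> {for z, continuous (F s)}) ->
  forall z, U z -> {for z, continuous G}.
Proof.
move=> FG cF z Uz; apply/continuous_boxP => e e0.
have [d d0 D] := FG _ Uz; have e40 : 0 < e / 4 by rewrite divr_gt0.
have [s s0 Hs] := D _ e40.
have [d1 d10 D1] := (continuous_boxP _ _).1 (cF s z s0 Uz) _ e40.
exists (Num.min d d1); first by rewrite lt_min d0 d10.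
move=> w zw; have zw1 : box z d w by move=> b; have := zw b; rewrite lt_min => /andP[].
have zw2 : box z d1 w by move=> b; have := zw b; rewrite lt_min => /andP[].
have ss : 0 < s <= s by rewrite s0 lexx.
have := Hs _ _ ss zw1; have := Hs _ _ ss (box_center z d0); have := D1 _ zw2.
move: (F s w) (F s z) (G w) (G z) => p q p0 q0.
rewrite !ltr_norml !ler_norml => /andP[? ?] /andP[? ?] /andP[? ?]; apply/andP; split; lra.
Qed.

(** The mean value theorem turns the difference quotient of [F s] into a value of [H s] near [z].
    This is close to [K z], because [H s] is uniformly close to [K] there and [K] is continuous,
    with a bound independent of the increment. *)
Lemma lucvg_is_derive b U F G H K z : open U -> lucvg U F G -> lucvg U H K ->
  (forall s w, 0 < s -> U w -> is_derive w (dir b) (F s) (H s w)) ->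
  {for z, continuous K} -> U z -> is_derive z (dir b) G (K z).
Proof.
move=> oU FG HK dF cH Uz; apply/is_derive_dir/is_derive1_eps => e e0.
have [d1 d10 D1] := FG _ Uz; have [d2 d20 D2] := HK _ Uz.
have [d3 d30 D3] := open_box oU Uz.
have e20 : 0 < e / 2 by rewrite divr_gt0.
have [d4 d40 D4] := (continuous_boxP _ _).1 cH _ e20.
exists (Num.min (Num.min d1 d2) (Num.min d3 d4)); first by rewrite !lt_min d10 d20 d30 d40.
move=> t; rewrite !lt_min => /andP[/andP[t1 t2] /andP[t3 t4]].
set x := coord b z; rewrite upd_coord.
have tB r u : `|t| < r -> `|u - x| <= `|t| -> box z r (upd b z u).
  move=> tr ut; apply: box_upd; last exact: le_lt_trans tr.
  by apply: box_center; apply: le_lt_trans tr.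
(* The error of [F s] against [G] is made small after [t] is fixed, so it tends to 0 without
   spoiling the factor |t| of the bound. *)
apply/ler_addgt0Pr => eta eta0; have eta30 : 0 < eta / 2 by rewrite divr_gt0.
have [s1 s10 S1] := D1 _ eta30; have [s2 s20 S2] := D2 _ e20.
pose s := Num.min s1 s2; have s0 : 0 < s by rewrite lt_min s10 s20.
have [|u u1 u2] := @coord_MVT _ b (F s) (H s) z (t + x).
  by rewrite addrK => u ut; apply: dF => //; apply: D3; apply: tB.
rewrite addrK in u1; rewrite addrK in u2.
have Sw1 : 0 < s <= s1 by rewrite s0 ge_min lexx.
have Sw2 : 0 < s <= s2 by rewrite s0 ge_min lexx orbT.
have A1 := S1 _ _ Sw1 (box_center z d10).
have A2 := S1 _ _ Sw1 (tB _ (t + x) t1 _); rewrite addrK lexx in A2; have {}A2 := A2 isT.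
have A3 := S2 _ _ Sw2 (tB _ u t2 u1).
have A4 := D4 _ (tB _ u t4 u1).
have A5 : `|H s (upd b z u) - K z| <= e.
  by move: A3 A4; rewrite !ltr_norml !ler_norml => /andP[? ?] /andP[? ?];
    apply/andP; split; lra.
have A6 : `|F s (upd b z (t + x)) - F s z - t * K z| <= e * `|t|.
  by rewrite u2 [_ * t]mulrC -mulrBr normrM mulrC ler_wpM2r.
move: A1 A2 A6; move: (F s z) (G z) (F s _) (G _) (t * K z) (e * `|t|) => p p0 q q0 r r0.
by rewrite !ler_norml => /andP[? ?] /andP[? ?] /andP[? ?]; apply/andP; split; lra.
Qed.

End DerivativeOfLimit.

(** * Taylor polynomials with Hölder remainder *)

Section TaylorPolynomial.
Context {R : realType}.
Implicit Types (U : set (R * R)) (g f : R * R -> R) (z w zeta : R * R) (b : bool)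
  (F : multi_index -> R) (N : nat).

Lemma is_derive_bigsum (V : normedModType R) (I : Type) (r : seq I) (P : pred I)
    (f : I -> V -> R) (df : I -> R) x v :
  (forall i, P i -> is_derive x v (f i) (df i)) ->
  is_derive x v (fun y => \sum_(i <- r | P i) f i y) (\sum_(i <- r | P i) df i).
Proof.
move=> H; elim: r => [|i r IH].
  rewrite big_nil (_ : (fun y => _) = cst 0); last first.
    by apply/funext => y; rewrite big_nil.
  exact: is_derive_cst.
rewrite big_cons (_ : (fun y => _) = (fun y => (if P i then f i y else 0) +
    \sum_(i <- r | P i) f i y)); last first.
  by apply/funext => y; rewrite big_cons; case: (P i); rewrite ?add0r.
case: (boolP (P i)) => Pi; first exact: is_deriveD (H i Pi) IH.
rewrite -[X in is_derive _ _ _ X]add0r.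
exact: is_deriveD (is_derive_cst _ _ _) IH.
Qed.

(* Degree less than [N]: with [tpoly 0 = 0] the kernel derivatives of order at
   most 1, which need no Taylor subtraction, fit the general pattern. *)
Definition tpoly N F z zeta : R :=
  \sum_(a < N) \sum_(b < N | (a + b < N)%N)
    (zeta.1 - z.1) ^+ a * (zeta.2 - z.2) ^+ b / (a`! * b`!)%:R * F (a : nat, b : nat).

Lemma taylorE k g z zeta :
  taylor k g z zeta = tpoly k.+1 (fun i => pd i g z) z zeta.
Proof. by []. Qed.

Lemma tpoly0 F z zeta : tpoly 0 F z zeta = 0.
Proof. by rewrite /tpoly big_ord0. Qed.

Lemma tpoly_center N F z : tpoly N.+1 F z z = F (0, 0)%N.
Proof.
rewrite /tpoly big_ord_recl big_mkcond big_ord_recl /= !expr0 !mul1r.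
rewrite !big1 ?addr0 ?fact0 ?muln1 ?invr1 ?mul1r // => i _.
  by apply: big1 => k _; rewrite subrr expr0n !mul0r.
by case: ifP => // _; rewrite subrr expr0n mulr0 !mul0r.
Qed.

Lemma fact_cancel (n : nat) (A B u v : R) :
  A * (n.+1%:R * B) * (u * (n.+1%:R^-1 * v)) = A * B * (u * v).
Proof.
have n0 : n.+1%:R != 0 :> R by rewrite pnatr_eq0.
by move: (n.+1%:R) n0 => m m0; field.
Qed.

Lemma fact_cancel_l (n : nat) (A B u v : R) :
  n.+1%:R * A * B * (n.+1%:R^-1 * u * v) = A * B * (u * v).
Proof. by rewrite -(fact_cancel n); ring. Qed.

(** The coefficients form an arbitrary family [F], which makes the class closed under
    differentiation: a derivative shifts the index of [F] and lowers the degree bound, since the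
    exponent cancels against the factorial. *)
Lemma is_derive_tpoly b N F z zeta :
  is_derive zeta (dir b) (tpoly N F z) (tpoly N.-1 (fun i => F (i + mdir b)) z zeta).
Proof.
pose x b := coord b zeta - coord b z.
have dpow c k : is_derive zeta (dir b) (fun w => (coord c w - coord c z) ^+ k)
    (if c == b then k%:R * x c ^+ k.-1 else 0).
  apply/is_derive_dir.
  rewrite (_ : (fun s => _) = if c == b then (fun s => s - coord c z) ^+ k
     else cst (x c ^+ k)); last first.
    by apply/funext => s; rewrite coord_upd; case: eqP => _; rewrite ?exprfctE.
  case: eqP => [->|_]; last exact: is_derive_cst.
  have D := is_deriveX k (is_deriveB (@is_derive_id R R (coord b zeta) 1)
    (@is_derive_cst R R R (coord b z) (coord b zeta) 1)).
  by apply: (is_derive_eq D); rewrite subr0 /GRing.scale /= mulr1.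
pose dT (i j : nat) := if b
  then x false ^+ i * (j%:R * x true ^+ j.-1) / (i`! * j`!)%:R * F (i, j)
  else (i%:R * x false ^+ i.-1) * x true ^+ j / (i`! * j`!)%:R * F (i, j).
have dterm (i j : nat) : is_derive zeta (dir b) (fun w =>
    (w.1 - z.1) ^+ i * (w.2 - z.2) ^+ j / (i`! * j`!)%:R * F (i, j)) (dT i j).
  have D := is_deriveM (is_deriveM (dpow false i) (dpow true j))
    (is_derive_cst ((i`! * j`!)%:R^-1 * F (i, j)) zeta (dir b)).
  rewrite (_ : (fun w => _) = (fun w => (coord false w - coord false z) ^+ i) *
     (fun w => (coord true w - coord true z) ^+ j) * cst ((i`! * j`!)%:R^-1 * F (i, j)));
     last by apply/funext => w /=; rewrite mulrA.
  apply: (is_derive_eq D); rewrite scaler0 add0r /dT /GRing.scale /=.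
  by case: (b) => /=; rewrite /x /=; ring.
have Ed : is_derive zeta (dir b) (tpoly N F z)
    (\sum_(i < N) \sum_(j < N | (i + j < N)%N) dT i j).
  by apply: is_derive_bigsum => i _; apply: is_derive_bigsum => j _; exact: dterm.
apply: (is_derive_eq Ed) => {Ed dterm dpow}; rewrite /tpoly.
case: N => [|N]; first by rewrite !big_ord0.
under [RHS]eq_bigr do under eq_bigr do rewrite addm_mdir.
case: b @dT => dT /=.
(* Second coordinate: the row i = N contains only j = 0, and all terms with j = 0 are killed; the
   others are reindexed from j + 1 to j. *)
- rewrite big_ord_recr /= [X in _ + X]big1 ?addr0; last first.
    move=> j; rewrite ltnS -[X in (_ <= X)%N]addn0 leq_add2l leqn0 => /eqP ->.
    by rewrite /dT !mul0r mulr0 !mul0r.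
  apply: eq_bigr => i _; rewrite big_mkcond big_ord_recl /= [X in X + _](_ : _ = 0); last first.
    by case: ifP => // _; rewrite /dT !mul0r mulr0 !mul0r.
  rewrite add0r [RHS]big_mkcond; apply: eq_bigr => j _ /=.
  rewrite /bump /= add1n addnS ltnS; case: ifP => // _.
  rewrite /dT /=; congr (_ * _).
  by rewrite !natrM !invfM fact_cancel.
(* First coordinate: the row i = 0 is killed, and after the shift of i the last column violates the
   degree condition. *)
- rewrite big_ord_recl /= [X in X + _]big1 ?add0r; last first.
    by move=> j _; rewrite /dT !mul0r.
  apply: eq_bigr => i _; rewrite big_mkcond big_ord_recr /= [X in _ + X](_ : _ = 0); last first.
    by rewrite /bump /= add1n addSn ltnS ltnNge leq_addl.
  rewrite addr0 [RHS]big_mkcond; apply: eq_bigr => j _ /=.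
  rewrite /bump /= add1n addSn ltnS; case: ifP => // _.
  rewrite /dT /=; congr (_ * _).
  by rewrite !natrM !invfM fact_cancel_l.
Qed.

Lemma eq_tpoly N F F' z zeta : (forall i, (midx_size i < N)%N -> F i = F' i) ->
  tpoly N F z zeta = tpoly N F' z zeta.
Proof.
by move=> FF; apply: eq_bigr => i _; apply: eq_bigr => j ij; rewrite FF.
Qed.

Lemma ler_cmod w u : (forall b, `|coord b w| <= `|coord b u|) -> cmod w <= cmod u.
Proof.
move=> H; rewrite ler_sqrt ?addr_ge0 ?sqr_ge0 //.
have S (x y : R) : `|x| <= `|y| -> x ^+ 2 <= y ^+ 2.
  move=> xy; rewrite -[leLHS]real_normK ?num_real // -[leRHS]real_normK ?num_real //.
  by rewrite lerXn2r ?nnegrE.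
by apply: lerD; apply: S; [exact: (H false)|exact: (H true)].
Qed.

End TaylorPolynomial.

(** * Taylor's formula under a Hölder condition *)

Section TaylorRemainder.
Context {R : realType}.
Implicit Types (U : set (R * R)) (g f : R * R -> R) (z w zeta : R * R) (b : bool).

(** The path from [z] to [w] follows one axis and then the other, through the corner [p]. None of
    its points is farther from [z] than [w] is, so bounds on that disc suffice; the two legs give
    the factor 2. *)
Lemma lipschitz_coord g (g' : bool -> R * R -> R) M z w : 0 <= M ->
  (forall b v, cmod (v - z) <= cmod (w - z) ->
     is_derive v (dir b) g (g' b v) /\ `|g' b v| <= M) ->
  `|g w - g z| <= 2 * M * cmod (w - z).
Proof.
move=> M0 dg; set y := cmod _; pose p := upd false z w.1.
have inp s : `|s - z.1| <= `|w.1 - z.1| -> cmod (upd false z s - z) <= y.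
  by move=> H; apply: ler_cmod => -[] //=; rewrite subrr normr0.
have inw s : `|s - z.2| <= `|w.2 - z.2| -> cmod (upd true p s - z) <= y.
  by move=> H; apply: ler_cmod => -[].
have [s s1 s2] := @coord_MVT _ false g (g' false) z w.1 (fun s H => (dg false _ (inp s H)).1).
have [t t1 t2] := @coord_MVT _ true g (g' true) p w.2 (fun s H => (dg true _ (inw s H)).1).
have wE : upd true p w.2 = w by rewrite /p /upd /=; case: (w).
rewrite wE in t2.
have -> : g w - g z = (g w - g p) + (g p - g z) by ring.
rewrite s2 t2; apply: le_trans (ler_normD _ _) _.
have -> : 2 * M * y = M * y + M * y by ring.
by apply: lerD; rewrite normrM; apply: ler_pM => //;
  [exact: (dg true _ (inw _ t1)).2|exact: (coord_le_cmod true (w - z))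
  |exact: (dg false _ (inp _ s1)).2|exact: (coord_le_cmod false (w - z))].
Qed.

(** Induction on the order: the remainder vanishes at [z], and its partial derivatives are the
    remainders of [dd b g] at one order less, so [lipschitz_coord] gains a factor |w - z| at the
    cost of a factor 2. *)
Lemma taylor_holder (nu A : R) U z d : open U -> 0 <= nu -> 0 <= A ->
  (forall w, cmod (w - z) <= d -> U w) ->
  forall N g, Ck N U g ->
  (forall i, midx_size i = N -> forall w, cmod (w - z) <= d ->
     `|pd i g w - pd i g z| <= A * cmod (w - z) `^ nu) ->
  forall w, cmod (w - z) <= d ->
    `|g w - tpoly N.+1 (fun i => pd i g z) z w|
      <= 2 ^+ N * A * (cmod (w - z) ^+ N * cmod (w - z) `^ nu).
Proof.
move=> oU nu0 A0 zU; elim=> [|N IH] g Cg Hg w wd.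
  rewrite /tpoly !big_ord1_cond /= !expr0 !mul1r fact0 muln1 invr1 mul1r.
  exact: (Hg (0, 0)%N).
set y := cmod (w - z).
have y0 : 0 <= y := cmod_ge0 _.
have cz0 : cmod (z - z) = 0 by apply/eqP; rewrite cmod_eq0 subrr.
have Uz : U z by apply: zU; rewrite cz0 (le_trans _ wd).
pose h w := g w - tpoly N.+2 (fun i => pd i g z) z w.
pose h' b w := dd b g w - tpoly N.+1 (fun i => pd (i + mdir b) g z) z w.
pose M := 2 ^+ N * A * (y ^+ N * y `^ nu).
have dh b v : cmod (v - z) <= y -> is_derive v (dir b) h (h' b v) /\ `|h' b v| <= M.
  move=> vy; have vd : cmod (v - z) <= d by exact: le_trans wd.
  split; first by apply: is_deriveB; [apply: Ck_is_derive Cg _; apply: zU|exact: is_derive_tpoly].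
  rewrite /h' -(@eq_tpoly _ _ (fun i => pd i (dd b g) z)); last first.
    by move=> i iN; rewrite (pd_dd b oU) ?inE //; apply: Ck_le Cg.
  have /IH/(_ _ v vd) H : Ck N U (dd b g) by exact: Ck_dd.
  apply: le_trans (H _) _ => {H}.
    move=> i iN u ud; rewrite !(pd_dd b oU) ?inE ?iN //; last exact: zU.
    by apply: Hg => //; rewrite midx_sizeD midx_size_mdir iN addn1.
  apply: ler_wpM2l; first by rewrite mulr_ge0 // exprn_ge0.
  apply: ler_pM; rewrite ?exprn_ge0 ?powR_ge0 ?cmod_ge0 //.
    by apply: lerXn2r; rewrite ?nnegrE ?cmod_ge0.
  by apply: ge0_ler_powR; rewrite ?nnegrE ?cmod_ge0.
have My : 0 <= M by rewrite /M !mulr_ge0 ?exprn_ge0 ?powR_ge0.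
have hz : h z = 0 by rewrite /h tpoly_center subrr.
rewrite -/(h w) -[h w]subr0 -{1}hz.
have -> : 2 ^+ N.+1 * A * (y ^+ N.+1 * y `^ nu) = 2 * M * y by rewrite /M !exprS; ring.
exact: (@lipschitz_coord _ h').
Qed.

End TaylorRemainder.

(** * Remainder bounds uniform in the centre *)

Section RemainderBound.
Context {R : realType}.
Implicit Types (U : set (R * R)) (g f : R * R -> R) (z w zeta : R * R) (b : bool).

Definition cdisc (s : R) : set (R * R) := [set z | cmod z <= s].

Lemma cdisc_compact s : compact (cdisc s).
Proof.
apply: (@subclosed_compact _ _ (`[- s, s] `*` `[- s, s])).
- rewrite /cdisc -[X in closed X]/(@cmod R @^-1` [set x | x <= s]).
  apply: closed_comp; last exact: closed_le.
  by move=> w _; exact: cmod_continuous.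
- by apply: compact_setX; exact: segment_compact.
- move=> w /= ws; split=> /=; rewrite in_itv /= -ler_norml;
    apply: le_trans ws; [exact: (coord_le_cmod false)|exact: (coord_le_cmod true)].
Qed.

Lemma compact_continuous_bounded (K : set (R * R)) g : compact K ->
  (forall z, K z -> {for z, continuous g}) ->
  exists2 B, 0 <= B & forall z, K z -> `|g z| <= B.
Proof.
move=> cK cg.
have : compact (g @` K).
  apply: continuous_compact => //; apply: continuous_in_subspaceT => z.
  by rewrite inE; exact: cg.
move=> /compact_bounded[M [Mr MB]].
exists (`|M| + 1); first by rewrite addr_ge0.
move=> z Kz; apply: (MB (`|M| + 1)); last by exists z.
by rewrite (le_lt_trans (ler_norm _)) // ltrDl.
Qed.

Lemma cdisc_bounded r s g : s < r -> (forall z, disc r z -> {for z, continuous g}) ->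
  exists2 B, 0 <= B & forall z, cdisc s z -> `|g z| <= B.
Proof.
move=> sr cg; apply: compact_continuous_bounded; first exact: cdisc_compact.
by move=> z zs; apply: cg; exact: le_lt_trans sr.
Qed.

Lemma disc_open r : open (@disc R r).
Proof.
rewrite /disc -[X in open X]/(@cmod R @^-1` [set x | x < r]).
by apply: open_comp; [move=> w _; exact: cmod_continuous|exact: open_lt].
Qed.

Lemma cmod_near s d z w : cdisc s z -> cmod (w - z) <= d -> cdisc (s + d) w.
Proof.
rewrite /cdisc /= => zs wd; rewrite -[w](subrK z) addrC.
exact: le_trans (cmodD _ _) (lerD zs wd).
Qed.

(** At the top order this is the assumed Hölder condition on a compact disc. At lower orders the
    derivative is of class C^1, hence Lipschitz there, and a distance of at most 1 is bounded by its
    [nu]-th power. *)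
Lemma near_holder r nu N f (i : multi_index) s d : 0 < nu <= 1 ->
  Cknu N nu (disc r) f -> (midx_size i <= N)%N -> 0 < d <= 1 -> s + d < r ->
  exists2 A, 0 <= A & forall z w, cdisc s z -> cmod (w - z) <= d ->
    `|pd i f w - pd i f z| <= A * cmod (w - z) `^ nu.
Proof.
move=> /andP[nu0 nu1] [Cf Hf] iN /andP[d0 d1] sdr.
have zin z : cdisc s z -> cdisc (s + d) z.
  by move=> zs; apply: le_trans zs _; rewrite lerDl ltW.
have ind w : cdisc (s + d) w -> disc r w by move=> H; exact: le_lt_trans sdr.
move: iN; rewrite leq_eqVlt => /orP[/eqP iN|iN].
  have [C HC] := Hf i iN (cdisc (s + d)) (@cdisc_compact (s + d)) ind.
  exists `|C| => // z w zs wd; apply: le_trans (HC _ _ _ (zin _ zs)) _.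
    exact: cmod_near wd.
  by apply: ler_wpM2r; [exact: powR_ge0|exact: ler_norm].
have Ci : Ck 1 (disc r) (pd i f) by apply: Ck_pd; apply: Ck_le Cf.
have bB b : exists2 B, 0 <= B & forall z, cdisc (s + d) z -> `|dd b (pd i f) z| <= B.
  apply: cdisc_bounded sdr _ => z zr.
  exact: (@Ck_continuous R 0 (disc r) _ z (@Ck_dd R b 0 _ _ Ci) zr).
have [B1 B10 H1] := bB false; have [B2 B20 H2] := bB true.
exists (2 * (B1 + B2)); first by rewrite mulr_ge0 // addr_ge0.
move=> z w zs wd; have B0 : 0 <= B1 + B2 by exact: addr_ge0.
apply: le_trans (@lipschitz_coord R _ (fun b => dd b (pd i f)) _ _ _ B0 _) _.
  move=> b v vw; have vd : cdisc (s + d) v.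
    by apply: cmod_near zs _; exact: le_trans wd.
  split; first by apply: Ck_is_derive Ci _; exact: ind.
  case: b; first by apply: le_trans (H2 _ vd) _; rewrite lerDr.
  by apply: le_trans (H1 _ vd) _; rewrite lerDl.
apply: ler_wpM2l; first by rewrite mulr_ge0.
have := cmod_ge0 (w - z); rewrite le_eqVlt => /predU1P[<-|w0]; first exact: powR_ge0.
by apply: ger1_powR => //; rewrite w0 (le_trans wd).
Qed.

Lemma ex_bound_sum (I T : Type) (S : set T) (l : seq I) (P : pred I) (F : I -> T -> R) :
  (forall i, P i -> exists2 B, 0 <= B & forall x, S x -> `|F i x| <= B) ->
  exists2 B, 0 <= B & forall x, S x -> `|\sum_(i <- l | P i) F i x| <= B.
Proof.
move=> H; elim: l => [|i l [B B0 HB]].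
  by exists 0 => // x _; rewrite big_nil normr0.
case: (boolP (P i)) => Pi; last first.
  by exists B => // x Sx; rewrite big_cons (negbTE Pi) HB.
have [B' B'0 HB'] := H i Pi; exists (B' + B); first exact: addr_ge0.
move=> x Sx; rewrite big_cons Pi; apply: le_trans (ler_normD _ _) _.
by apply: lerD; [exact: HB'|exact: HB].
Qed.

Lemma tpoly_bounded (K : set (R * R)) (F : R * R -> multi_index -> R) N s rho :
  K `<=` cdisc s ->
  (forall i, (midx_size i < N)%N ->
     exists2 B, 0 <= B & forall z, K z -> `|F z i| <= B) ->
  exists2 B, 0 <= B & forall z zeta, K z -> cdisc rho zeta ->
    `|tpoly N (F z) z zeta| <= B.
Proof.
move=> Ks HF.
suff [B B0 HB] : exists2 B, 0 <= B & forall x, (K `*` cdisc rho) x ->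
    `|tpoly N (F x.1) x.1 x.2| <= B.
  by exists B => // z zeta Kz zr; exact: (HB (z, zeta)).
apply: ex_bound_sum => i _; apply: ex_bound_sum => j ij.
have [B B0 HB] := HF (i : nat, j : nat) ij.
pose D := (`|rho| + `|s|) ^+ i * (`|rho| + `|s|) ^+ j / (i`! * j`!)%:R.
have rs0 : 0 <= `|rho| + `|s| by exact: addr_ge0.
have D0 : 0 <= D by rewrite !mulr_ge0 ?invr_ge0 // exprn_ge0.
exists (D * B); first exact: mulr_ge0.
move=> [z zeta] [/= Kz zr]; rewrite normrM; apply: ler_pM => //; last exact: HB.
rewrite normrM [X in _ * X]ger0_norm ?invr_ge0 //; apply: ler_wpM2r; first by rewrite invr_ge0.
have cb b : `|coord b zeta - coord b z| <= `|rho| + `|s|.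
  apply: le_trans (ler_normB _ _) _; apply: lerD.
    by apply: le_trans (coord_le_cmod b _) (le_trans zr (ler_norm _)).
  by apply: le_trans (coord_le_cmod b _) (le_trans (Ks _ Kz) (ler_norm _)).
rewrite normrM !normrX; apply: ler_pM; rewrite ?exprn_ge0 //; apply: lerXn2r;
  rewrite ?nnegrE //; [exact: (cb false)|exact: (cb true)].
Qed.

Lemma powR_le0_anti (x D e : R) : 0 < x <= D -> e <= 0 -> D `^ e <= x `^ e.
Proof.
move=> /andP[x0 xD] e0; rewrite -[e]opprK !(powRN _ (- e)).
have D0 : 0 < D by exact: lt_le_trans xD.
rewrite lef_pV2 ?posrE ?powR_gt0 //; by apply: ge0_ler_powR; rewrite ?nnegrE ?oppr_ge0 // ltW.
Qed.

Lemma gt0_powRD (x a c : R) : 0 < x -> x `^ (a + c) = x `^ a * x `^ c.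
Proof. by move=> x0; rewrite powRD // (gt_eqF x0) implybT. Qed.

(** The integer power is kept apart because it cancels the |w|^(-m) of the kernel. For m <= 1
    nothing is subtracted: [f] is bounded, and |zeta - z|^(m + nu - 2) is bounded below on bounded
    sets. For m >= 2 Taylor's formula serves near [z]; far from [z] the extended [f] and the
    polynomial are bounded. *)
Lemma remainder_bound r nu N f (B : R) m s rho : 0 < nu <= 1 ->
  Cknu N nu (disc r) f -> (m <= N.+2)%N -> 0 < s < r -> r < 1 ->
  0 < rho -> 0 <= B -> (forall z, disc r z -> `|f z| <= B) ->
  exists2 A, 0 <= A & forall z zeta, cdisc s z -> cdisc rho zeta -> zeta != z ->
    `|patch (fun=> 0) (disc r) f zeta - tpoly m.-1 (fun i => pd i f z) z zeta|
      <= A * (cmod (zeta - z) ^+ m * cmod (zeta - z) `^ (nu - 2)).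
Proof.
move=> nu01 Hf mN /andP[s0 sr] r1 rho0 B0 HB.
pose F := patch (fun=> 0) (disc r) f.
have FB zeta : `|F zeta| <= B.
  rewrite /F patchE; case: ifPn => [/set_mem/HB //|_]; by rewrite normr0.
pose D := rho + s.
have D0 : 0 < D by exact: addr_gt0.
have wD z zeta : cdisc s z -> cdisc rho zeta -> zeta != z -> 0 < cmod (zeta - z) <= D.
  move=> zs zr zz; rewrite cmod_gt0 subr_eq0 zz /=; apply: le_trans (cmodD _ _) _.
  by rewrite cmodN; apply: lerD.
case/andP: (nu01) => nu0 nu1.
have nu2 : nu - 2 <= 0 by lra.
case: m mN => [|[|M]] mN /=.
- exists (B / D `^ (nu - 2)); first by rewrite divr_ge0 // powR_ge0.
  move=> z zeta zs zr zz; rewrite tpoly0 subr0; apply: le_trans (FB _) _.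
  rewrite mul1r mulrAC ler_pdivlMr ?powR_gt0 //; apply: ler_wpM2l => //.
  by apply: powR_le0_anti => //; exact: wD.
- exists (B / D `^ (nu - 1)); first by rewrite divr_ge0 // powR_ge0.
  move=> z zeta zs zr zz; rewrite tpoly0 subr0; apply: le_trans (FB _) _.
  have /andP[w0 wd] := wD _ _ zs zr zz.
  have -> : cmod (zeta - z) ^+ 1 * cmod (zeta - z) `^ (nu - 2) = cmod (zeta - z) `^ (nu - 1).
    rewrite expr1 -{1}(powRr1 (ltW w0)) -gt0_powRD //.
    by congr powR; lra.
  rewrite mulrAC ler_pdivlMr ?powR_gt0 //; apply: ler_wpM2l => //.
  apply: powR_le0_anti; first by rewrite w0.
  lra.
have MN : (M <= N)%N := mN.
(* Half of the gap keeps the discs of radius [d] about points of [cdisc s] inside [disc r]; [d <= 1]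
   comes from [r < 1]. *)
pose d := (r - s) / 2.
have d0 : 0 < d by rewrite /d; lra.
have d01 : 0 < d <= 1 by rewrite /d; apply/andP; split; lra.
have sdr : s + d < r by rewrite /d; lra.
have [_ Cf] : True /\ Ck N (disc r) f by case: Hf.
have [A A0 HA] : exists2 A, 0 <= A & forall i, midx_size i = M -> forall z w,
    cdisc s z -> cmod (w - z) <= d -> `|pd i f w - pd i f z| <= A * cmod (w - z) `^ nu.
  (* There are M + 1 multi-indices of size M; the sum of their constants serves all of them. *)
  have hi (k : nat) : exists A : R, 0 <= A /\ ((k <= M)%N -> forall z w,
      cdisc s z -> cmod (w - z) <= d ->
      `|pd (k, (M - k)%N) f w - pd (k, (M - k)%N) f z| <= A * cmod (w - z) `^ nu).
    case: (leqP k M) => kM; last by exists 0.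
    have [|A A0 HA] := near_holder (i := (k, (M - k)%N)) nu01 Hf _ d01 sdr.
      by rewrite /midx_size /= subnKC.
    by exists A; split.
  have [A' HA'] := choice hi.
  exists (\sum_(k < M.+1) A' k); first by apply: sumr_ge0 => k _; case: (HA' k).
  move=> [k l] kl z w zs wd.
  have kM : (k <= M)%N by rewrite -kl leq_addr.
  have -> : l = (M - k)%N by rewrite -kl /midx_size /= addKn.
  apply: le_trans ((HA' k).2 kM z w zs wd) _; apply: ler_wpM2r; first exact: powR_ge0.
  rewrite -ltnS in kM; rewrite (bigD1 (Ordinal kM)) //= lerDl.
  by apply: sumr_ge0 => i _; case: (HA' i).
have [B' B'0 HB'] : exists2 B, 0 <= B & forall z zeta, cdisc s z -> cdisc rho zeta ->
    `|tpoly M.+1 (fun i => pd i f z) z zeta| <= B.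
  apply: (@tpoly_bounded (cdisc s) (fun z i => pd i f z) _ s) => // i; rewrite ltnS => iM.
  apply: cdisc_bounded sr _ => z zr.
  have Ci : Ck 0 (disc r) (pd i f).
    by apply: Ck_pd; rewrite add0n; apply: Ck_le Cf; exact: leq_trans iM MN.
  exact: (@Ck_continuous R 0 (disc r) _ z Ci zr).
(* Lower bound of y^(M+2) y^(nu-2) for d < y <= D, used far from [z]. *)
pose L := d ^+ M.+2 * D `^ (nu - 2).
have L0 : 0 < L by rewrite mulr_gt0 ?exprn_gt0 ?powR_gt0.
exists (2 ^+ M * A + (B + B') / L).
  by rewrite addr_ge0 ?mulr_ge0 ?exprn_ge0 ?invr_ge0 ?addr_ge0 // ltW.
move=> z zeta zs zr zz; have /andP[w0 wd] := wD _ _ zs zr zz.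
set y := cmod (zeta - z) in w0 wd *.
have yp : 0 <= y ^+ M.+2 * y `^ (nu - 2) by rewrite mulr_ge0 ?exprn_ge0 ?powR_ge0 // ltW.
have [yd|yd] := leP y d.
- have zU w : cmod (w - z) <= d -> disc r w.
    by move=> H; apply: le_lt_trans sdr; apply: cmod_near H.
  rewrite (_ : patch _ _ _ zeta = f zeta); last by rewrite patchE mem_set //; exact: zU.
  apply: le_trans (@taylor_holder R nu A _ z d (@disc_open r) (ltW nu0) A0 zU M f _ _ _ yd) _.
  + exact: Ck_le MN Cf.
  + by move=> i iM w; exact: HA.
  rewrite -/y mulrDl (_ : y ^+ M * y `^ nu = y ^+ M.+2 * y `^ (nu - 2)).
    by rewrite lerDl mulr_ge0 // divr_ge0 ?addr_ge0 // ltW.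
  have -> : nu = 2%:R + (nu - 2) by lra.
  rewrite gt0_powRD // powR_mulrn ?ltW // mulrA -exprD addn2.
  by congr (_ * powR _ _); lra.
- rewrite mulrDl; apply: le_trans (_ : (B + B') / L * (y ^+ M.+2 * y `^ (nu - 2)) <= _); last first.
    by rewrite lerDr mulr_ge0 // mulr_ge0 // exprn_ge0.
  apply: le_trans (ler_normB _ _) _.
  apply: le_trans (lerD (FB zeta) (HB' _ _ zs zr)) _.
  rewrite mulrAC ler_pdivlMr //; apply: ler_wpM2l; first exact: addr_ge0.
  apply: ler_pM; rewrite ?exprn_ge0 ?powR_ge0 ?(ltW d0) //.
    by apply: lerXn2r; rewrite ?nnegrE ?ltW.
  by apply: powR_le0_anti => //; rewrite w0.
Qed.

End RemainderBound.

(** * Measure and integrability in the plane *)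

Section PlaneMeasure.
Context {R : realType}.
Implicit Types (z w zeta : R * R) (b : bool).

Local Notation mR := (measurableTypeR R).
Local Notation plane := (mR * mR)%type.
Local Notation mu := (@lebesgue_measure R).

Lemma measurable_box z (e : R) : measurable (box z e : set plane).
Proof.
rewrite (_ : box z e = `]z.1 - e, z.1 + e[ `*` `]z.2 - e, z.2 + e[); last first.
  apply/seteqP; split=> w.
    move=> H; split; rewrite /= in_itv /= -ltr_distlC distrC;
      [exact: (H false)|exact: (H true)].
  by move=> [] /=; rewrite !in_itv /= -!ltr_distlC => H1 H2 [] /=; rewrite distrC.
by apply: measurableX; exact: measurable_itv.
Qed.

(** The product sigma-algebra is generated by rectangles, so [U] is written as the countable union
    of the boxes with rational centre and radius 1/(n+1) that it contains. *)
Lemma open_measurable_plane (U : set (R * R)) : open U -> measurable (U : set plane).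
Proof.
move=> oU.
pose B (p q : rat) (n : nat) : set plane :=
  if `[< box (ratr p, ratr q) n.+1%:R^-1 `<=` U >] then box (ratr p, ratr q) n.+1%:R^-1
  else set0.
rewrite (_ : U = \bigcup_p \bigcup_q \bigcup_n B p q n).
  apply: bigcupT_measurable_rat => p; apply: bigcupT_measurable_rat => q.
  apply: bigcupT_measurable => n; rewrite /B; case: ifP => _; last exact: measurable0.
  exact: measurable_box.
apply/seteqP; split=> w; last first.
  by move=> [p _ [q _ [n _]]]; rewrite /B; case: asboolP => // H; exact: H.
move=> Uw; have [e e0 wU] := open_box oU Uw.
have e2 : 0 < e / 2 by rewrite divr_gt0.
have [n ne] := ltr_add_invr e2; rewrite add0r in ne.
have n0 : 0 < n.+1%:R^-1 :> R by rewrite invr_gt0.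
have [p pw] : exists p : rat, `|w.1 - ratr p| < n.+1%:R^-1.
  have /rat_in_itvoo[p] : w.1 - n.+1%:R^-1 < w.1 + n.+1%:R^-1.
    by rewrite ltrBlDr -addrA ltrDl addr_gt0.
  by rewrite in_itv /= -ltr_distlC => H; exists p.
have [q qw] : exists p : rat, `|w.2 - ratr p| < n.+1%:R^-1.
  have /rat_in_itvoo[q] : w.2 - n.+1%:R^-1 < w.2 + n.+1%:R^-1.
    by rewrite ltrBlDr -addrA ltrDl addr_gt0.
  by rewrite in_itv /= -ltr_distlC => H; exists q.
exists p => //; exists q => //; exists n => //; rewrite /B asboolT.
  by case.
move=> v Hv; apply: wU => -[]; rewrite -[e](_ : e / 2 + e / 2 = _); try lra.
  apply: le_lt_trans (ler_distD (ratr q) _ _) _; apply: ltrD.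
    by apply: lt_trans ne; exact: (Hv true).
  by rewrite distrC; exact: lt_trans ne.
apply: le_lt_trans (ler_distD (ratr p) _ _) _; apply: ltrD.
  by apply: lt_trans ne; exact: (Hv false).
by rewrite distrC; exact: lt_trans ne.
Qed.

Lemma measurable_plane_set1 z : measurable ([set z] : set plane).
Proof.
rewrite -(setCK [set z]); apply: measurableC; apply: open_measurable_plane.
apply: closed_openC; apply: compact_closed; last exact: compact_set1.
exact: norm_hausdorff.
Qed.

Lemma continuous_on_open_measurable (U : set (R * R)) (g : R * R -> R) : open U ->
  (forall z, U z -> {for z, continuous g}) -> measurable_fun (U : set plane) g.
Proof.
move=> oU cg; apply: (measurability _ (RGenOpens.measurableE R)).
move=> _ [_ [a [b ->] <-]]; apply: open_measurable_plane.
rewrite openE => z [Uz gz]; apply: filterI; first exact: open_nbhs_nbhs.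
by apply: cg => //; apply: open_nbhs_nbhs; split => //; exact: interval_open.
Qed.

Lemma continuous_measurable_plane (g : R * R -> R) :
  (forall z, {for z, continuous g}) -> measurable_fun (setT : set plane) g.
Proof. by move=> cg; apply: continuous_on_open_measurable => //; exact: openT. Qed.

(** Meant for kernels with a single singularity: singletons are measurable, so the value at that
    point does not matter. *)
Lemma measurable_off_point z (g : R * R -> R) :
  (forall w, w != z -> {for w, continuous g}) -> measurable_fun (setT : set plane) g.
Proof.
move=> cg; rewrite -(setvU [set z]); apply/measurable_funU.
- by apply: measurableC; exact: measurable_plane_set1.
- exact: measurable_plane_set1.
split; last exact: measurable_fun_set1.
apply: continuous_on_open_measurable => [|w wz].
  apply: closed_openC; apply: compact_closed; last exact: compact_set1.
  exact: norm_hausdorff.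
by apply: cg; apply/eqP.
Qed.

Lemma measurable_disc r : measurable (disc r : set plane).
Proof. by apply: open_measurable_plane; exact: disc_open. Qed.

Definition square (s : R) : set plane := `[- s, s] `*` `[- s, s].

Lemma measurable_square s : measurable (square s).
Proof. by apply: measurableX; exact: measurable_itv. Qed.

Lemma disc_square s : disc s `<=` square s.
Proof.
move=> w ws; split; rewrite /= in_itv /= -ler_norml; apply: le_trans (ltW ws);
  [exact: (coord_le_cmod false)|exact: (coord_le_cmod true)].
Qed.

Lemma area_disc_lty r : (@area R (disc r) < +oo)%E.
Proof.
have H : (@area R (disc r) <= @area R (square r))%E.
  apply: le_measure; rewrite ?inE; [exact: measurable_disc|exact: measurable_square|].
  exact: disc_square.
apply: (le_lt_trans H); rewrite /area product_measure1E; [|exact: measurable_itv..].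
have I : (mu `[(- r)%R, r]%classic < +oo)%E.
  by rewrite lebesgue_measure_itv /=; case: ifP => // _; rewrite -EFinB ltry.
by rewrite lte_mul_pinfty // ge0_fin_numE.
Qed.

Lemma integrable_disc_bounded r (g : plane -> R) B : measurable_fun (disc r) g ->
  (forall z, disc r z -> `|g z| <= B) ->
  (@area R).-integrable (disc r) (EFin \o g).
Proof.
move=> mg gB; apply: measurable_bounded_integrable => //.
- exact: measurable_disc.
- exact: area_disc_lty.
- exists `|B|; split; first exact: num_real.
  by move=> M BM z /gB H /=; apply: le_trans H (le_trans (ler_norm _) (ltW BM)).
Qed.

End PlaneMeasure.

(** * Power singularities on the line *)

Section SingularIntegral.
Context {R : realType}.
Local Notation mR := (measurableTypeR R).
Local Notation plane := (mR * mR)%type.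
Local Notation mu := (@lebesgue_measure R).
Local Open Scope ereal_scope.

(** Lebesgue measure is determined by its values on half-open intervals, so its image under a
    translation is itself. *)
Lemma ge0_integral_shift (f : mR -> \bar R) (a : R) :
  measurable_fun (setT : set mR) f -> (forall x, 0 <= f x) ->
  \int[mu]_x f (x - a)%R = \int[mu]_x f x.
Proof.
move=> mf f0; pose phi : mR -> mR := fun x => (x - a)%R.
have mphi : measurable_fun (setT : set mR) phi by apply: measurable_funB.
have E A : measurable A -> pushforward mu phi A = mu A.
  move=> mA; apply/esym/lebesgue_measure_unique => //= _ [[u v]] _ <-.
  rewrite /pushforward (_ : phi @^-1` _ = `]u + a, v + a]%classic)%R; last first.
    by apply/seteqP; split=> x; rewrite /phi /= !in_itv /= ltrBrDr lerBlDr.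
  rewrite !lebesgue_measure_itv /= !lte_fin -!EFinB.
  by rewrite ltrD2r; case: ifP => // _; congr (_%:E)%R; ring.
have := @ge0_integral_pushforward _ _ mR mR R phi mphi mu setT f measurableT mf (fun x _ => f0 x).
rewrite preimage_setT => <-; by apply: eq_measure_integral => A mA _; exact: E.
Qed.

Lemma ge0_integral_flip (f : mR -> \bar R) (a : R) :
  measurable_fun (setT : set mR) f -> (forall x, 0 <= f x) ->
  \int[mu]_x f (a - x)%R = \int[mu]_x f x.
Proof.
move=> mf f0; pose phi : mR -> mR := fun x => (a - x)%R.
have mphi : measurable_fun (setT : set mR) phi by apply: measurable_funB.
have E A : measurable A -> pushforward mu phi A = mu A.
  move=> mA; apply/esym/lebesgue_measure_unique => //= _ [[u v]] _ <-.
  rewrite /pushforward (_ : phi @^-1` _ = `[a - v, a - u[%classic)%R; last first.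
    by apply/seteqP; split=> x; rewrite /phi /= !in_itv /= => /andP[? ?]; apply/andP; split; lra.
  rewrite !lebesgue_measure_itv /= !lte_fin -!EFinB.
  by rewrite ltrD2l ltrN2; case: ifP => // _; congr (_%:E)%R; ring.
have := @ge0_integral_pushforward _ _ mR mR R phi mphi mu setT f measurableT mf (fun x _ => f0 x).
rewrite preimage_setT => <-; by apply: eq_measure_integral => A mA _; exact: E.
Qed.

(** The integrand is unbounded near 0, so the fundamental theorem is applied on [1/(i+1), M] with
    the primitive x^c / c, and monotone convergence exhausts the interval. *)
Lemma integral_powR_le (c M : R) : (0 < c < 1)%R -> (0 < M)%R ->
  \int[mu]_(x in `[0%R, M]) (x `^ (c - 1))%:E <= (M `^ c / c)%:E.
Proof.
move=> /andP[c0 c1] M0.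
have mf : measurable_fun (setT : set mR) (fun x : mR => (x `^ (c - 1))%:E).
  by apply/measurable_EFinP; exact: measurable_powR.
rewrite -integral_itv_obnd_cbnd; last exact: measurable_funTS.
pose F (i : nat) : set mR := `[(i.+1%:R^-1)%R, M]%classic.
have FE : `]0%R, M]%classic = \bigcup_i F i.
  apply/seteqP; split=> x /=.
    rewrite in_itv /= => /andP[x0 xM]; have [i] := ltr_add_invr x0; rewrite add0r => ix.
    by exists i => //; rewrite /F /= in_itv /= xM (ltW ix).
  move=> [i _]; rewrite /F /= !in_itv /= => /andP[ix ->]; rewrite andbT.
  by apply: lt_le_trans ix; rewrite invr_gt0.
rewrite FE.
have cv := @ge0_nondecreasing_set_cvg_integral _ mR R F (fun x => (x `^ (c - 1))%:E) mu.
have {}cv : \int[mu]_(x in F i) (x `^ (c - 1))%:E @[i --> \oo] -->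
    \int[mu]_(x in \bigcup_i F i) (x `^ (c - 1))%:E.
  apply: cv.
  - move=> i j ij; apply/subsetPset => x; rewrite /F /= !in_itv /= => /andP[ix ->].
    rewrite andbT; apply: le_trans ix; rewrite lef_pV2 ?posrE //.
    by rewrite ler_nat ltnS.
  - by move=> i; exact: measurable_itv.
  - by move=> i; exact: measurable_funTS.
  - by move=> i x _; rewrite lee_fin powR_ge0.
rewrite -(cvg_lim _ cv) //; apply: lime_le; first exact: cvgP cv.
apply: nearW => i; have i0 : (0 < i.+1%:R^-1 :> R)%R by rewrite invr_gt0.
(* Early intervals are empty or reduced to the point [M], and contribute 0. *)
have [iM|iM] := leP M (i.+1%:R^-1)%R.
  have : F i `<=` [set M].
    move=> x; rewrite /F /= in_itv /= => /andP[ix xM]; apply/eqP.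
    by rewrite eq_le xM (le_trans iM).
  move=> H; apply: le_trans (_ : \int[mu]_(x in [set M]) (x `^ (c - 1))%:E <= _).
    apply: ge0_subset_integral => //; [exact: measurable_itv|exact: measurable_funTS|].
    by move=> x _; rewrite lee_fin powR_ge0.
  rewrite integral_set1 lee_fin divr_ge0 ?powR_ge0 // ltW //.
pose G (x : R) := (c^-1 *: x `^ c)%R.
have dG (x : R) : (0 < x)%R -> is_derive x 1%R G (x `^ (c - 1))%R.
  move=> x0; have D := is_deriveZ c^-1 (is_derive1_powR c x0).
  by apply: (is_derive_eq D); rewrite /GRing.scale /= mulrA mulVf ?mul1r // gt_eqF.
have cG (x : R) : (0 < x)%R -> {for x, continuous G}.
  by move=> x0; apply/differentiable_continuous/derivable1_diffP; case: (dG x x0).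
rewrite /F (@continuous_FTC2 R (fun x => x `^ (c - 1))%R G) //.
- rewrite -EFinB lee_fin /G /GRing.scale /= [(c^-1 * _)%R]mulrC lerBlDr lerDl.
  by rewrite mulr_ge0 ?powR_ge0 // invr_ge0 ltW.
- apply: continuous_in_subspaceT => x; rewrite inE /= in_itv /= => /andP[ix _].
  have x0 : (0 < x)%R by exact: lt_le_trans ix.
  apply/differentiable_continuous/derivable1_diffP.
  by case: (is_derive1_powR (c - 1) x0).
- split=> [x||].
  + by rewrite in_itv /= => /andP[ix _]; case: (dG x (lt_trans i0 ix)).
  + by apply: cvg_at_right_filter; exact: cG.
  + by apply: cvg_at_left_filter; apply: cG.
- move=> x; rewrite in_itv /= => /andP[ix _]; rewrite derive1E.
  by have [_ ->] := dG x (lt_trans i0 ix).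
Qed.

Definition sing (c : R) (t : R) : R := (`|t| `^ (c - 1))%R.

Lemma measurable_sing c (D : set mR) : measurable_fun D (sing c).
Proof.
apply: measurable_funTS.
have H := measurableT_comp (@measurable_powR R (c - 1)%R) (@normr_measurable R setT).
exact: H.
Qed.

Lemma sing_ge0 c t : (0 <= sing c t)%R. Proof. exact: powR_ge0. Qed.

(** The bound is uniform in the centre [x]: reflection and translation carry the two sides of the
    singularity to the fixed interval [0, L], whence the factor 2. *)
Lemma integral_sing_le (c M s : R) : (0 < c < 1)%R -> (0 < M)%R ->
  exists2 C : R, (0 <= C)%R & forall x : R, (`|x| <= s)%R ->
  \int[mu]_(t in `[(- M)%R, M]) (sing c (x - t))%:E <= C%:E.
Proof.
move=> c01 M0; pose L := (M + `|s|)%R.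
have L0 : (0 < L)%R by rewrite ltr_pwDl.
have c0 : (0 < c)%R by case/andP: c01.
pose g : mR -> \bar R := (fun t => (t `^ (c - 1))%:E) \_ `[0%R, L].
have mg : measurable_fun (setT : set mR) g.
  apply/(measurable_restrictT _ _).1; first exact: measurable_itv.
  by apply: measurable_funTS; apply/measurable_EFinP; exact: measurable_powR.
have g0 x : 0 <= g x by rewrite /g patchE; case: ifP => // _; rewrite lee_fin powR_ge0.
have ig : \int[mu]_x g x <= (L `^ c / c)%:E.
  by rewrite -integral_mkcond; exact: integral_powR_le.
exists (2 * (L `^ c / c))%R; first by rewrite mulr_ge0 // divr_ge0 ?powR_ge0 // ltW.
move=> x xs; pose h t := g (x - t)%R + g (t - x)%R.
have mshift : measurable_fun (setT : set mR) (fun t : mR => (t - x)%R : mR).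
  by apply: measurable_funB.
have mflip : measurable_fun (setT : set mR) (fun t : mR => (x - t)%R : mR).
  by apply: measurable_funB.
have m1 : measurable_fun (setT : set mR) (fun t : mR => g (x - t)%R).
  by exact: measurableT_comp mg mflip.
have m2 : measurable_fun (setT : set mR) (fun t : mR => g (t - x)%R).
  by exact: measurableT_comp mg mshift.
apply: (@le_trans _ _ (\int[mu]_(t in `[(- M)%R, M]) h t)).
  apply: ge0_le_integral => //.
  - by move=> t _; rewrite lee_fin sing_ge0.
  - apply/measurable_EFinP; apply: measurable_funTS.
    by apply: (measurableT_comp _ mflip); exact: measurable_sing.
  - by apply: measurable_funTS; exact: emeasurable_funD.
  move=> t /=; rewrite in_itv /= -ler_norml => tM.
  have xt : (`|x - t| <= L)%R.
    by apply: le_trans (ler_normB _ _) _; rewrite addrC lerD // (le_trans xs) // ler_norm.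
  have [xt0|xt0] := leP 0%R (x - t)%R.
    apply: le_trans (leeDl _ (g0 _)); rewrite /g patchE mem_set.
      by rewrite /sing ger0_norm.
    by rewrite /= in_itv /= xt0 -(ger0_norm xt0).
  apply: le_trans (leeDr _ (g0 _)); rewrite /g patchE mem_set.
    by rewrite /sing ltr0_norm // opprB.
  by rewrite /= in_itv /= -opprB -(ltr0_norm xt0) xt normr_ge0.
apply: le_trans (_ : \int[mu]_t h t <= _).
  apply: ge0_subset_integral => //; first exact: emeasurable_funD.
  by move=> t _; rewrite adde_ge0.
rewrite ge0_integralD // ge0_integral_flip // ge0_integral_shift //.
by rewrite mulr_natl mulr2n EFinD leeD.
Qed.

End SingularIntegral.

(** * Domination by a product of line singularities *)

Section SingularDomination.
Context {R : realType}.
Local Notation mR := (measurableTypeR R).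
Local Notation plane := (mR * mR)%type.
Local Notation mu := (@lebesgue_measure R).
Local Open Scope ereal_scope.

Definition sing2 (c : R) (z zeta : R * R) : R :=
  (sing c (z.1 - zeta.1) * sing c (z.2 - zeta.2))%R.

Lemma measurable_sing2 c z (D : set plane) : measurable D -> measurable_fun D (sing2 c z).
Proof.
move=> mD; apply: measurable_funTS; apply: measurable_funM.
  have H : measurable_fun (setT : set plane) (fun zeta => (z.1 - zeta.1)%R : mR).
    by apply: measurable_funB; [exact: measurable_cst|exact: measurable_fst].
  exact: (measurableT_comp (@measurable_sing R c setT) H).
have H : measurable_fun (setT : set plane) (fun zeta => (z.2 - zeta.2)%R : mR).
  by apply: measurable_funB; [exact: measurable_cst|exact: measurable_snd].
exact: (measurableT_comp (@measurable_sing R c setT) H).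
Qed.

Lemma sing2_ge0 c z zeta : (0 <= sing2 c z zeta)%R.
Proof. by rewrite mulr_ge0 ?sing_ge0. Qed.

(** The disc is enlarged to a square, on which Tonelli's theorem factors the integral into two line
    integrals, each bounded by [C] uniformly in the centre. *)
Lemma integral_sing2_le (c rho s : R) : (0 < c < 1)%R -> (0 < rho)%R ->
  exists2 C : R, (0 <= C)%R & forall z, cdisc s z ->
  \int[@area R]_(zeta in disc rho) (sing2 c z zeta)%:E <= C%:E.
Proof.
move=> c01 rho0; have [C C0 HC] := integral_sing_le s c01 rho0.
exists (C * C)%R; first exact: mulr_ge0.
move=> z zs; have zb b : (`|coord b z| <= s)%R by exact: le_trans (coord_le_cmod b z) zs.
have I0 : measurable (`[(- rho)%R, rho]%classic : set mR) by exact: measurable_itv.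
pose g (x : R) : mR -> \bar R := (fun t => (sing c (x - t))%:E) \_ `[(- rho)%R, rho].
have g0 x t : 0 <= g x t by rewrite /g patchE; case: ifP => // _; rewrite lee_fin sing_ge0.
have mg x : measurable_fun (setT : set mR) (g x).
  apply/(measurable_restrictT _ _).1; first exact: measurable_itv.
  apply/measurable_EFinP; apply: measurable_funTS.
  have mflip : measurable_fun (setT : set mR) (fun t : mR => (x - t)%R : mR).
    by apply: measurable_funB.
  exact: (measurableT_comp (@measurable_sing R c setT) mflip).
have ig b : \int[mu]_t g (coord b z) t <= C%:E.
  by rewrite -integral_mkcond; exact: HC.
have ig0 b : 0 <= \int[mu]_t g (coord b z) t by exact: integral_ge0.
pose G (zeta : plane) := g z.1 zeta.1 * g z.2 zeta.2.
have G0 zeta : 0 <= G zeta by rewrite mule_ge0.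
have mG : measurable_fun (setT : set plane) G.
  by apply: emeasurable_funM; apply: measurableT_comp.
apply: (@le_trans _ _ (\int[@area R]_zeta G zeta)).
  rewrite integral_mkcond; apply: ge0_le_integral => //.
  - by move=> zeta _; rewrite patchE; case: ifP => // _; rewrite lee_fin sing2_ge0.
  - apply/(measurable_restrictT _ _).1; first exact: measurable_disc.
    by apply/measurable_EFinP; apply: measurable_sing2; exact: measurable_disc.
  move=> zeta _; rewrite patchE; case: ifP => // /set_mem /disc_square[h1 h2].
  by rewrite /G /g !patchE !mem_set.
rewrite /area fubini_tonelli1 //.
rewrite /fubini_F /G /=.
under eq_integral do rewrite ge0_integralZl //.
rewrite ge0_integralZr //; last exact: (ig0 true).
by rewrite EFinM; apply: lee_pmul;
  [exact: (ig0 false)|exact: (ig0 true)|exact: (ig false)|exact: (ig true)].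
Qed.

(** Needed for the horizontal and vertical lines through the singularity, on which [cmod_powR_le]
    gives nothing. *)
Lemma area_line (b : bool) (x : R) : (@area R).-negligible [set zeta : plane | coord b zeta = x].
Proof.
have E : [set zeta : plane | coord b zeta = x] =
    (if b then [set: mR] else [set x]) `*` (if b then [set x] else [set: mR]).
  by case: b; apply/seteqP; split=> -[u v] //=; case.
rewrite E; exists ((if b then [set: mR] else [set x]) `*` (if b then [set x] else [set: mR])).
have m1 : measurable ([set x] : set mR) by exact: measurable_set1.
split=> //; first by case: b {E}; apply: measurableX.
rewrite /area product_measure1E; [|by case: b {E}..].
have S : mu [set x] = 0 by exact: lebesgue_measure_set1.
case: b {E}; first exact: etrans (congr1 (fun u => _ * u) S) (mule0 _).
exact: etrans (congr1 (fun u => u * _) S) (mul0e _).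
Qed.

(* Off the axes only: on them [sing c 0 = 0], since [0 `^ (c - 1) = 0]. *)
Lemma cmod_powR_le (c : R) (w : R * R) : (c < 1)%R -> w.1 != 0%R -> w.2 != 0%R ->
  (cmod w `^ (2 * (c - 1)) <= sing c w.1 * sing c w.2)%R.
Proof.
move=> c1 w1 w2; have h b : (0 < `|coord b w| <= cmod w)%R.
  by rewrite coord_le_cmod normr_gt0; case: b; rewrite ?w1 ?w2.
have c0 : (c - 1 <= 0)%R by lra.
have w0 : (0 < cmod w)%R by case/andP: (h true) => ? ?; apply: lt_le_trans; eassumption.
rewrite (_ : (2 * (c - 1) = (c - 1) + (c - 1))%R); last by ring.
rewrite gt0_powRD //; apply: ler_pM; rewrite ?powR_ge0 //; apply: powR_le0_anti => //.
  exact: (h false).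
exact: (h true).
Qed.

(** [C] depends neither on [z] nor on [g], and the bound is linear in [K]: a pointwise estimate with
    [K] proportional to s^c becomes a rate of convergence uniform in [z]. *)
Lemma sing_dominated (c rho s : R) : (0 < c < 1)%R -> (0 < rho)%R ->
  exists2 C : R, (0 <= C)%R & forall z (g : R * R -> R) (K : R), cdisc s z -> (0 <= K)%R ->
    measurable_fun (disc rho : set plane) g ->
    (forall zeta, disc rho zeta -> zeta != z ->
       (`|g zeta| <= K * cmod (z - zeta) `^ (2 * (c - 1)))%R) ->
    (@area R).-integrable (disc rho) (EFin \o g) /\
    (`|\int[@area R]_(zeta in disc rho) g zeta| <= K * C)%R.
Proof.
move=> c01 rho0; have [C C0 HC] := integral_sing2_le s c01 rho0; exists C => //.
move=> z g K zs K0 mg gK; have c1 : (c < 1)%R by case/andP: c01.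
have mD := @measurable_disc R rho.
have ineq : \int[@area R]_(zeta in disc rho) `|(g zeta)%:E| <= (K * C)%:E.
  apply: (@le_trans _ _ (\int[@area R]_(zeta in disc rho) (K%:E * (sing2 c z zeta)%:E))).
    apply: ae_ge0_le_integral => //.
    - by apply/measurable_EFinP; exact: measurableT_comp.
    - by move=> zeta _; rewrite mule_ge0 // lee_fin ?sing2_ge0.
    - by apply: measurable_funeM; apply/measurable_EFinP; exact: measurable_sing2.
    (* Off these two null lines the pointwise majorant applies. *)
    have := negligibleU (area_line false z.1) (area_line true z.2).
    apply: negligibleS => zeta /= H; apply: contrapT => /not_orP[n1 n2]; apply: H => zr.
    rewrite -EFinM lee_fin.
    have zz : zeta != z by apply/eqP => E; apply: n1; rewrite E.
    apply: le_trans (gK _ zr zz) _; apply: ler_wpM2l => //.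
    by apply: (@cmod_powR_le c (z - zeta)%R) => //=; rewrite subr_eq0 eq_sym; apply/eqP.
  rewrite ge0_integralZl //; last 2 first.
  - by apply/measurable_EFinP; exact: measurable_sing2.
  - by move=> zeta _; rewrite lee_fin sing2_ge0.
  rewrite EFinM; apply: lee_pmul => //; last exact: HC.
  by apply: integral_ge0 => zeta _; rewrite lee_fin sing2_ge0.
have gint : (@area R).-integrable (disc rho) (EFin \o g).
  apply/integrableP; split; first by apply/measurable_EFinP.
  by apply: le_lt_trans ineq _; rewrite ltry.
split=> //; apply: le_trans (le_normr_Rintegral mD gint) _.
rewrite /Rintegral -lee_fin fineK; first exact: ineq.
rewrite ge0_fin_numE; last exact: integral_ge0.
apply: le_lt_trans ineq _; exact: ltry.
Qed.

End SingularDomination.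

(** * Convolution with a smooth kernel *)

Section ConvolutionDerivative.
Context {R : realType}.
Implicit Types (z w zeta : R * R) (b : bool).
Local Notation mR := (measurableTypeR R).
Local Notation plane := (mR * mR)%type.

Lemma growth_translate (K : R * R -> R) z zeta v :
  (fun h : R => h^-1 *: (((fun z => K (z - zeta)) \o shift z) (h *: v) - K (z - zeta))) =
  (fun h : R => h^-1 *: ((K \o shift (z - zeta)) (h *: v) - K (z - zeta))).
Proof. by apply/funext => h /=; rewrite addrA. Qed.

Lemma dd_translate b (K : R * R -> R) zeta :
  dd b (fun z => K (z - zeta)) = (fun z => dd b K (z - zeta)).
Proof. by apply/funext => z; rewrite /dd /derive growth_translate. Qed.

Lemma is_derive_translate b (K : R * R -> R) z zeta d :
  is_derive (z - zeta) (dir b) K d -> is_derive z (dir b) (fun z => K (z - zeta)) d.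
Proof.
move=> [H1 H2]; constructor.
  by move: H1; rewrite /derivable growth_translate.
by move: H2; rewrite /derive growth_translate.
Qed.

Lemma pd_translate j (K : R * R -> R) zeta :
  pd j (fun z => K (z - zeta)) = (fun z => pd j K (z - zeta)).
Proof.
rewrite /pd; elim: j.1 => [|p IH] /=; last by rewrite IH; exact: (dd_translate false).
by elim: j.2 => [//|q IH] /=; rewrite IH; exact: (dd_translate true).
Qed.

(** Green's formula differentiates in zeta, while kernel derivatives refer to the argument z - zeta;
    this is the source of the sign. *)
Lemma is_derive_reflect b (K : R * R -> R) z zeta d :
  is_derive (z - zeta) (dir b) K d ->
  is_derive zeta (dir b) (fun zeta => K (z - zeta)) (- d).
Proof.
move=> /is_derive_dir D; apply/is_derive_dir.
have E : coord b (z - zeta) = coord b z - coord b zeta by case: (b).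
rewrite E in D.
have D1 : is_derive (coord b zeta) 1 (fun s : R => coord b z - s) (-1).
  have := is_deriveB (@is_derive_cst R R R (coord b z) (coord b zeta) 1)
    (@is_derive_id R R (coord b zeta) 1).
  by rewrite sub0r.
have D2 := @is_derive1_comp R (fun s => K (upd b (z - zeta) s)) (fun s => coord b z - s)
  (coord b zeta) _ _ D D1.
rewrite mulrN1 in D2; rewrite (_ : (fun s => _) =
  ((fun s => K (upd b (z - zeta) s)) \o (fun s => coord b z - s))) //.
by apply/funext => s /=; case: (b).
Qed.

Lemma continuous_reflect (K : R * R -> R) z : (forall w, {for w, continuous K}) ->
  forall zeta, {for zeta, continuous (fun zeta => K (z - zeta))}.
Proof.
move=> cK zeta; apply: (@continuous_comp _ _ _ (fun zeta => z - zeta) K); last exact: cK.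
by apply: cvgB; [exact: cvg_cst|exact: cvg_id].
Qed.

Variables (r B : R) (f : R * R -> R) (K : R * R -> R) (K' : bool -> R * R -> R).
Hypothesis mf : measurable_fun (disc r : set plane) f.
Hypothesis fB : forall z, disc r z -> `|f z| <= B.
Hypothesis cK : forall w, {for w, continuous K}.
Hypothesis cK' : forall b w, {for w, continuous (K' b)}.
Hypothesis dK : forall b w, is_derive w (dir b) K (K' b w).

Let W z := \int[@area R]_(zeta in disc r) (K (z - zeta) * f zeta).
Let W' b z := \int[@area R]_(zeta in disc r) (K' b (z - zeta) * f zeta).

Lemma kernel_bounded (k : R * R -> R) s : (forall w, {for w, continuous k}) ->
  exists2 C, 0 <= C & forall z zeta, cdisc s z -> disc r zeta ->
    `|k (z - zeta) * f zeta| <= C * `|B|.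
Proof.
move=> ck.
have [C C0 HC] := compact_continuous_bounded (@cdisc_compact R (s + r)) (fun z _ => ck z).
exists C => // z zeta zs zr; rewrite normrM; apply: ler_pM => //.
  by apply: HC; apply: le_trans (cmodD _ _) _; rewrite cmodN; apply: lerD => //; exact: ltW.
by apply: le_trans (fB zr) _; exact: ler_norm.
Qed.

Lemma measurable_convolution (k : R * R -> R) z : (forall w, {for w, continuous k}) ->
  measurable_fun (disc r : set plane) (fun zeta => k (z - zeta) * f zeta).
Proof.
move=> ck; apply: measurable_funM => //; apply: measurable_funTS.
by apply: continuous_measurable_plane; exact: continuous_reflect.
Qed.

Lemma convolution_integrable (k : R * R -> R) z : (forall w, {for w, continuous k}) ->
  (@area R).-integrable (disc r) (fun zeta => (k (z - zeta) * f zeta)%:E).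
Proof.
move=> ck; have [C C0 HC] := kernel_bounded (cmod z) ck.
apply: (@integrable_disc_bounded _ _ _ (C * `|B|)).
  exact: measurable_convolution.
by move=> zeta zr; apply: HC => //; rewrite /cdisc /=.
Qed.

(** Differentiation under the integral along one coordinate: for shifts smaller than 1 all arguments
    z - zeta stay in one compact disc, so a constant dominates the derivative. *)
Lemma convolution_is_derive b z : is_derive z (dir b) W (W' b z).
Proof.
apply/is_derive_dir; set a := coord b z.
pose F (x : R) (y : plane) := K (upd b z x - y) * f y.
have dF (x : R) (y : plane) : is_derive x 1 (F^~ y) (K' b (upd b z x - y) * f y).
  have /is_derive_upd D : is_derive (upd b z x) (dir b) (fun z => K (z - y)) (K' b (upd b z x - y)).
    exact: is_derive_translate.
  have D2 := is_deriveZ (f y) D.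
  rewrite (_ : F^~ y = (fun x => f y *: K (upd b z x - y))); last first.
    by apply/funext => u; rewrite /F mulrC.
  by apply: (is_derive_eq D2); rewrite /GRing.scale /= mulrC.
have Ea : `]a - 1, a + 1[%classic a by rewrite /= in_itv /=; apply/andP; split; lra.
have [C C0 HC] := kernel_bounded (cmod z + 1) (@cK' b).
have inz (x : R) : `]a - 1, a + 1[%classic x -> cdisc (cmod z + 1) (upd b z x).
  rewrite /= in_itv /= => /andP[x1 x2]; apply: (@cmod_near R _ 1 z); first by rewrite /cdisc /=.
  apply: le_trans (cmod_le_sum _) _.
  have : `|x - a| <= 1 by rewrite ler_norml; apply/andP; split; lra.
  by rewrite /a; case: (b) => /= H; rewrite subrr normr0 ?add0r ?addr0.
have intF (x : R) : `]a - 1, a + 1[%classic x -> (@area R).-integrable (disc r) (EFin \o F x).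
  by move=> _; exact: convolution_integrable.
have derF (x : R) (y : plane) : `]a - 1, a + 1[%classic x -> disc r y -> derivable (F^~ y) x 1.
  by move=> _ _; case: (dF x y).
have G0 (y : plane) : 0 <= cst (C * `|B|) y by rewrite mulr_ge0.
have intG : (@area R).-integrable (disc r) (EFin \o cst (C * `|B|)).
  apply: (@integrable_disc_bounded _ _ _ (C * `|B|)); first exact: measurable_cst.
  by move=> y _; rewrite ger0_norm // mulr_ge0.
have partE (x : R) (y : plane) : partial1of2 F x y = K' b (upd b z x - y) * f y.
  by rewrite partial1of2E; case: (dF x y).
have Gub (x : R) (y : plane) : `]a - 1, a + 1[%classic x -> disc r y ->
    `|partial1of2 F x y| <= cst (C * `|B|) y.
  by move=> xI yr; rewrite partE; apply: HC => //; exact: inz.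
have mD := @measurable_disc R r.
have der := @derivable_under_integral R _ _ (@area R) F _ mD a (a - 1) (a + 1) Ea intF derF
  (cst (C * `|B|)) G0 intG Gub.
have val := @differentiation_under_integral R _ _ (@area R) F _ mD a (a - 1) (a + 1) Ea intF derF
  (cst (C * `|B|)) G0 intG Gub.
constructor; first exact: der.
rewrite -derive1E val; apply: eq_Rintegral => y _.
by rewrite partE /a upd_coord.
Qed.

Lemma mul_four_add1 (x y : R) : x * (4 * y + 1) = 2 * y * (2 * x) + x.
Proof. ring. Qed.

(** The partial derivatives of [W] are bounded on a disc containing the unit disc about [z], so [W]
    is Lipschitz near [z]. *)
Lemma convolution_continuous z : {for z, continuous W}.
Proof.
apply/continuous_boxP => e e0.
have bb b : exists2 C, 0 <= C & forall v, cdisc (cmod z + 1) v -> `|W' b v| <= C.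
  have [C C0 HC] := kernel_bounded (cmod z + 1) (@cK' b).
  have D0 : 0 <= \int[@area R]_(zeta in disc r) (C * `|B|).
    by apply: Rintegral_ge0 => *; rewrite mulr_ge0.
  exists (\int[@area R]_(zeta in disc r) (C * `|B|)) => // v vz.
  have mD := @measurable_disc R r.
  apply: le_trans (le_normr_Rintegral mD _) _; first exact: convolution_integrable.
  apply: le_Rintegral => //.
  - apply: (@integrable_disc_bounded _ _ _ (C * `|B|)).
      by apply: measurableT_comp; [exact: normr_measurable|exact: measurable_convolution].
    by move=> zeta zr; rewrite normr_id; exact: HC.
  - apply: (@integrable_disc_bounded _ _ _ (C * `|B|)); first exact: measurable_cst.
    by move=> y _; rewrite ger0_norm // mulr_ge0.
  - by move=> zeta zr; exact: HC.
have [C1 C10 H1] := bb false; have [C2 C20 H2] := bb true.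
pose M := C1 + C2 + 1; have M0 : 0 < M by rewrite ltr_wpDl // addr_ge0.
(* A box of size [d] has |w - z| <= 2d <= 1, and the Lipschitz bound 2M · 2d is then less than
   [e]. *)
pose d := Num.min (1 / 2) (e / (4 * M + 1)).
have d0 : 0 < d.
  by rewrite lt_min !divr_gt0 // addr_gt0 // mulr_gt0.
exists d => // w wz.
have wd : cmod (w - z) <= 2 * d.
  apply: le_trans (cmod_le_sum _) _.
  have := wz false; have := wz true => /= h2 h1.
  by rewrite mulr_natl mulr2n; apply: lerD; exact: ltW.
have d1 : 2 * d <= 1 by rewrite mulrC -ler_pdivlMr // ge_min lexx.
have := @lipschitz_coord R W W' M z w (ltW M0).
have hyp : forall b v, cmod (v - z) <= cmod (w - z) ->
     is_derive v (dir b) W (W' b v) /\ `|W' b v| <= M.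
  move=> b v vw; split; first exact: convolution_is_derive.
  have vz : cdisc (cmod z + 1) v.
    apply: (@cmod_near R _ 1 z); first by rewrite /cdisc /=.
    by apply: le_trans vw (le_trans wd d1).
  case: b; first by apply: le_trans (H2 _ vz) _; rewrite /M; lra.
  by apply: le_trans (H1 _ vz) _; rewrite /M; lra.
move=> /(_ hyp) H; apply: le_lt_trans H _.
have M40 : 0 < 4 * M + 1 by rewrite addr_gt0 // mulr_gt0.
apply: (@le_lt_trans _ _ (2 * M * (2 * d))).
  by apply: ler_wpM2l => //; rewrite mulr_ge0 // ltW.
have dd : d * (4 * M + 1) <= e by rewrite -ler_pdivlMr // ge_min lexx orbT.
apply: lt_le_trans dd; rewrite [ltRHS](_ : _ = 2 * M * (2 * d) + d) ?ltrDl //.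
exact: mul_four_add1.
Qed.

End ConvolutionDerivative.

(** * Green's formula on a disc *)

Section Green.
Context {R : realType}.
Implicit Types (z w zeta : R * R) (b : bool) (a c m rho s t x : R).
Local Notation mR := (measurableTypeR R).
Local Notation plane := (mR * mR)%type.
Local Notation mu := (@lebesgue_measure R).

Lemma continuous_integrable (g : R -> R) a c : (forall x, {for x, continuous g}) ->
  mu.-integrable `[a, c] (EFin \o g).
Proof.
move=> cg; apply: continuous_compact_integrable; first exact: segment_compact.
by apply: continuous_in_subspaceT => x _; exact: cg.
Qed.

(** The primitive is the integral from [m], so its derivative is claimed to the right of [m]; the
    base point is to be placed below the whole range of use. *)
Lemma ex_primitive (g : R -> R) m : (forall x, {for x, continuous g}) ->
  exists G : R -> R, forall x, m < x -> is_derive x 1 G (g x).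
Proof.
move=> cg; exists (fun x => \int[mu]_(t in `[m, x]) g t) => x mx.
have xx : x < x + 1 by rewrite ltrDl.
have [||d1 d2] := @continuous_FTC1_closed R g m x (x + 1) xx _ mx _; last first.
  by constructor; [exact: d1|rewrite -derive1E; exact: d2].
- exact: cg.
- exact: continuous_integrable.
Qed.

Lemma FTC_is_derive (g G : R -> R) a c : a < c -> (forall x, {for x, continuous g}) ->
  (forall x, a <= x <= c -> is_derive x 1 G (g x)) ->
  (\int[mu]_(t in `[a, c]) (g t)%:E = (G c - G a)%:E)%E.
Proof.
move=> ac cg dG.
have cG x : a <= x <= c -> {for x, continuous G}.
  by move=> /dG[d _]; apply/differentiable_continuous/derivable1_diffP.
rewrite (@continuous_FTC2 R g G) //.
- by apply: continuous_in_subspaceT => x _; exact: cg.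
- split=> [x||].
  + by rewrite in_itv /= => /andP[ax xc]; case: (dG x); rewrite ?(ltW ax) ?(ltW xc).
  + by apply: cvg_at_right_filter; apply: cG; rewrite lexx ltW.
  + by apply: cvg_at_left_filter; apply: cG; rewrite lexx ltW.
- move=> x; rewrite in_itv /= derive1E => /andP[ax xc].
  by have [|_ ->] := dG x; rewrite ?(ltW ax) ?(ltW xc).
Qed.

Lemma same_increment (f g d : R -> R) a c : a <= c ->
  (forall x, a <= x <= c -> is_derive x 1 f (d x)) ->
  (forall x, a <= x <= c -> is_derive x 1 g (d x)) -> f c - f a = g c - g a.
Proof.
move=> ac df dg; pose h x := f x - g x.
have dh x : a <= x <= c -> is_derive x 1 h 0.
  by move=> xac; rewrite -(subrr (d x)); apply: is_deriveB; [exact: df|exact: dg].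
have [| |x xac] := @MVT_segment R h (fun _ => 0) a c ac.
- move=> x; rewrite in_itv /= => /andP[ax xc]; apply: dh.
  by rewrite (ltW ax) (ltW xc).
- apply: continuous_in_subspaceT => x; rewrite inE /= in_itv /= => /dh[d1 _].
  by apply/differentiable_continuous/derivable1_diffP.
rewrite mul0r /h; move: (f c) (f a) (g c) (g a) => p q p' q' H.
lra.
Qed.

(** [t] is the coordinate [b], the variable along a chord, and [s] labels the chord. *)
Definition swp b s t : R * R := if b then (s, t) else (t, s).

Lemma cmod_swp b s t : cmod (swp b s t) = Num.sqrt (s ^+ 2 + t ^+ 2).
Proof. by case: b; rewrite /cmod //= addrC. Qed.

Lemma continuous_swp b (f g : R -> R) (x : R) : {for x, continuous f} ->
  {for x, continuous g} -> {for x, continuous (fun s => swp b (f s) (g s))}.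
Proof. by move=> cf cg; case: b; [exact: (cvg_pair cf cg)|exact: (cvg_pair cg cf)]. Qed.

Lemma fubini_swp b (F : plane -> \bar R) : (@area R).-integrable setT F ->
  (\int[@area R]_zeta F zeta = \int[mu]_s \int[mu]_t F (swp b s t))%E.
Proof.
move=> iF; case: b => /=.
  by rewrite -(@integral12_prod_meas1 _ _ _ _ _ mu mu F iF).
by rewrite -(@integral21_prod_meas1 _ _ _ _ _ mu mu F iF).
Qed.

(** Increment of [u] between the ends of the chord labelled [s]. For |s| > rho the square root of a
    negative number is 0, so the increment vanishes and the function is continuous on the whole
    line. *)
Definition slice_jump b (u : R * R -> R) rho s : R :=
  u (swp b s (Num.sqrt (rho ^+ 2 - s ^+ 2))) - u (swp b s (- Num.sqrt (rho ^+ 2 - s ^+ 2))).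

Lemma continuous_slice_jump b (u : R * R -> R) rho s :
  (forall z, {for z, continuous u}) -> {for s, continuous (slice_jump b u rho)}.
Proof.
move=> cu; pose q s := Num.sqrt (rho ^+ 2 - s ^+ 2).
have cq : {for s, continuous q}.
  apply: (@continuous_comp _ _ _ (fun s => rho ^+ 2 - s ^+ 2) (@Num.sqrt R) s).
    by apply: cvgB; [exact: cvg_cst|apply: continuousX; exact: cvg_id].
  exact: sqrt_continuous.
apply: cvgB.
  apply: (@continuous_comp _ _ _ (fun s => swp b s (q s)) u s); last exact: cu.
  by apply: continuous_swp; [exact: cvg_id|exact: cq].
apply: (@continuous_comp _ _ _ (fun s => swp b s (- q s)) u s); last exact: cu.
by apply: continuous_swp; [exact: cvg_id|apply: cvgN; exact: cq].
Qed.

(** Fubini over the chords in direction [b]: on each chord, [u'] integrates to the increment of [u]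
    between its ends. *)
Lemma integral_disc_swp b (u u' : R * R -> R) rho : 0 < rho ->
  (forall z, {for z, continuous u}) -> (forall z, {for z, continuous u'}) ->
  (forall z, is_derive z (dir b) u (u' z)) ->
  (\int[@area R]_(zeta in disc rho) (u' zeta)%:E =
   \int[mu]_(s in `[(- rho)%R, rho]) (slice_jump b u rho s)%:E)%E.
Proof.
move=> rho0 cu cu' du.
have mu' := continuous_measurable_plane cu'.
have iu' : (@area R).-integrable (disc rho) (EFin \o u').
  have [B B0 HB] := compact_continuous_bounded (@cdisc_compact R rho) (fun z _ => cu' z).
  apply: (@integrable_disc_bounded _ _ _ B); first exact: measurable_funTS.
  by move=> z zr; apply: HB; exact: ltW.
rewrite integral_mkcond (@fubini_swp b); last first.
  by apply/(integrable_mkcond _ (@measurable_disc R rho)).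
pose h := slice_jump b u rho.
have inner s : (\int[mu]_t ((EFin \o u') \_ (disc rho)) (swp b s t) =
    ((fun s => (h s)%:E) \_ `](- rho)%R, rho[) s)%E.
  rewrite [RHS]patchE; case: ifPn => [/set_mem|/negP/negP sr]; last first.
    apply: integral0_eq => t _; rewrite patchE.
    case: ifPn => // /set_mem; rewrite /disc /= cmod_swp => H.
    exfalso; move: sr; rewrite notin_setE; apply.
    rewrite /= in_itv /= -ltr_norml; apply: le_lt_trans H.
    by rewrite -sqrtr_sqr ler_sqrt ?addr_ge0 ?sqr_ge0 // lerDl sqr_ge0.
  rewrite /= in_itv /= -ltr_norml => sr.
  pose q := rho ^+ 2 - s ^+ 2; pose c := Num.sqrt q.
  have q0 : 0 < q.
    by rewrite subr_gt0 -[ltLHS]real_normK ?num_real // ltr_pXn2r ?nnegrE // ltW.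
  have c0 : 0 < c by rewrite sqrtr_gt0.
  have -> : (fun t => ((EFin \o u') \_ (disc rho)) (swp b s t)) =
      (fun t => (u' (swp b s t))%:E) \_ `]- c, c[.
    apply/funext => t; rewrite !patchE; congr (if _ then _ else _).
    apply/idP/idP => /set_mem H; apply/mem_set; move: H;
      rewrite /disc /= cmod_swp in_itv /= -ltr_norml.
      rewrite -[ltRHS](gtr0_norm rho0) -sqrtr_sqr ltr_sqrt ?exprn_gt0 // => H.
      by rewrite -sqrtr_sqr ltr_sqrt // /q ltrBrDl.
    rewrite -[ltRHS](gtr0_norm c0) -!sqrtr_sqr.
    rewrite ltr_sqrt ?exprn_gt0 // (sqr_sqrtr (ltW q0)) /q ltrBrDl => H.
    by rewrite -[ltRHS](gtr0_norm rho0) -sqrtr_sqr ltr_sqrt ?exprn_gt0.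
  have cs t : {for t, continuous (fun t => u' (swp b s t))}.
    apply: (@continuous_comp _ _ _ (fun t => swp b s t) u' t); last exact: cu'.
    by apply: continuous_swp; [exact: cvg_cst|exact: cvg_id].
  have mcs : measurable_fun (setT : set mR) (fun t => (u' (swp b s t))%:E).
    by apply/measurable_EFinP; apply: continuous_measurable_fun => t; exact: cs.
  rewrite -integral_mkcond -(@integral_itv_bndoo R (- c) c _ true false);
    last exact: measurable_funTS.
  have cc : - c < c by rewrite -subr_gt0 opprK addr_gt0.
  have dG t : - c <= t <= c -> is_derive t 1 (fun t => u (swp b s t)) (u' (swp b s t)).
    move=> _; have E t' : swp b s t' = upd b (swp b s 0) t' by case: (b).
    rewrite (_ : (fun t => u (swp b s t)) = (fun t => u (upd b (swp b s 0) t))).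
      by apply/is_derive_upd; rewrite -E; exact: du.
    by apply/funext => t'; rewrite E.
  exact: (FTC_is_derive cc cs dG).
under eq_integral do rewrite inner.
rewrite -integral_mkcond -(@integral_itv_bndoo R (- rho) rho _ true false) //.
apply: measurable_funTS; apply/measurable_EFinP; apply: continuous_measurable_fun => s.
exact: continuous_slice_jump.
Qed.

End Green.

Section GreenFormula.
Context {R : realType}.
Implicit Types (z w zeta : R * R) (b : bool) (rho s t x : R).
Local Notation mu := (@lebesgue_measure R).

Definition trig b t : R := if b then sin t else cos t.

Lemma cmod_circle rho t : 0 <= rho -> cmod (circle_pt rho t) = rho.
Proof.
move=> rho0; rewrite /cmod /circle_pt /= !exprMn -mulrDr cos2Dsin2 mulr1.
by rewrite sqrtr_sqr ger0_norm.
Qed.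

Lemma coord_normal b rho t : 0 < rho -> coord b (normal (circle_pt rho t)) * rho = rho * trig b t.
Proof.
move=> rho0; rewrite /normal cmod_circle ?ltW //.
by case: b; rewrite /= divfK // gt_eqF.
Qed.

Lemma continuous_circle_pt rho t : {for t, continuous (@circle_pt R rho)}.
Proof.
have cc : {for t, continuous (fun t => rho * cos t)}.
  by apply: cvgM; [exact: cvg_cst|exact: continuous_cos].
have cs : {for t, continuous (fun t => rho * sin t)}.
  by apply: cvgM; [exact: cvg_cst|exact: continuous_sin].
exact: (cvg_pair cc cs).
Qed.

Lemma continuous_trig b t : {for t, continuous (trig b)}.
Proof. by case: b; [exact: continuous_sin|exact: continuous_cos]. Qed.

Lemma is_derive_addr (G : R -> R) (p x d : R) :
  is_derive (x + p) 1 G d -> is_derive x 1 (fun t => G (t + p)) d.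
Proof.
move=> D; have D1 : is_derive x 1 (fun t : R => t + p) 1.
  have := is_deriveD (@is_derive_id R R x 1) (@is_derive_cst R R R p x 1).
  by rewrite addr0.
have := @is_derive1_comp R G (fun t => t + p) x _ _ D D1.
by rewrite mulr1.
Qed.

Lemma is_derive_subl (G : R -> R) (q x d : R) :
  is_derive (q - x) 1 G d -> is_derive x 1 (fun t => G (q - t)) (- d).
Proof.
move=> D; have D1 : is_derive x 1 (fun t : R => q - t) (-1).
  have := is_deriveB (@is_derive_cst R R R q x 1) (@is_derive_id R R x 1).
  by rewrite sub0r.
have := @is_derive1_comp R G (fun t => q - t) x _ _ D D1.
by rewrite mulrN1.
Qed.

(* Both sides are increments of primitives: with [s = rho sin x], the slice
   integrals and the two half circles have the same derivative in [x]. *)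
Lemma green b (u u' : R * R -> R) rho : 0 < rho ->
  (forall z, {for z, continuous u}) -> (forall z, {for z, continuous u'}) ->
  (forall z, is_derive z (dir b) u (u' z)) ->
  \int[@area R]_(zeta in disc rho) u' zeta =
  circle_integral rho (fun zeta => u zeta * coord b (normal zeta)).
Proof.
move=> rho0 cu cu' du.
pose h := slice_jump b u rho.
have ch s : {for s, continuous h} by exact: continuous_slice_jump.
pose g t := u (circle_pt rho t) * (rho * trig b t).
have cg t : {for t, continuous g}.
  apply: cvgM; last by apply: cvgM; [exact: cvg_cst|exact: continuous_trig].
  apply: (@continuous_comp _ _ _ (@circle_pt R rho) u t); last exact: cu.
  exact: continuous_circle_pt.
(* [H] is used on [-rho, rho] and [G] at angles not below -pi/2, so these base points lie to the
   left of every argument. *)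
have [H dH] := ex_primitive (- rho - 1) ch.
have [G dG] := ex_primitive (- 10) cg.
have pi0 := pi_gt0 R; have pi2 : pi / 2 < 2 := pihalf_lt2 R.
have rr : - rho < rho by lra.
have LHS : \int[@area R]_(zeta in disc rho) u' zeta = H rho - H (- rho).
  rewrite /Rintegral (integral_disc_swp rho0 cu cu' du).
  have D s : - rho <= s <= rho -> is_derive s 1 H (h s).
    by move=> /andP[rs _]; apply: dH; lra.
  exact: (congr1 fine (FTC_is_derive rr ch D)).
have RHS : circle_integral rho (fun zeta => u zeta * coord b (normal zeta)) = G (2 * pi) - G 0.
  rewrite /circle_integral.
  under eq_Rintegral do rewrite -mulrA coord_normal //.
  have pp : 0 < 2 * pi :> R by lra.
  have D t : 0 <= t <= 2 * pi -> is_derive t 1 G (g t).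
    by move=> /andP[t0 _]; apply: dG; lra.
  exact: (congr1 fine (FTC_is_derive pp cg D)).
rewrite LHS RHS.
(* At s = rho sin x the ends of the chord have the angles x + 3pi/2 and pi/2 - x for vertical
   chords, x and pi - x for horizontal ones. *)
pose E x := if b then G (x + (pi / 2 + pi)) - G (pi / 2 - x) else G (x + 0) - G (pi - x).
(* As x runs over [-pi/2, pi/2] the two angles sweep the whole circle; for horizontal chords the
   quarter [-pi/2, 0] is carried to [3pi/2, 2pi] by periodicity. *)
have EE : E (pi / 2) - E (- (pi / 2)) = G (2 * pi) - G 0.
  have gp t : g (t + 2 * pi) = g t.
    rewrite /g /circle_pt mulr_natl cosD2pi sinD2pi; congr (_ * (_ * _)).
    by rewrite /trig cosD2pi sinD2pi.
  have P : G (0 + 2 * pi) - G (- (pi / 2) + 2 * pi) = G 0 - G (- (pi / 2)).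
    apply: (@same_increment R (fun t => G (t + 2 * pi)) G g); first lra.
      move=> x /andP[x1 x2]; rewrite -gp; apply: is_derive_addr; apply: dG; lra.
    by move=> x /andP[x1 x2]; apply: dG; lra.
  rewrite /E; case: (b).
    have -> : pi / 2 + (pi / 2 + pi) = 2 * pi :> R by lra.
    have -> : - (pi / 2) + (pi / 2 + pi) = pi :> R by lra.
    have -> : pi / 2 - - (pi / 2) = pi :> R by lra.
    by rewrite subrr; lra.
  move: P; rewrite !addr0 add0r.
  have -> : pi - pi / 2 = pi / 2 :> R by lra.
  have -> : pi - - (pi / 2) = - (pi / 2) + 2 * pi :> R by lra.
  by rewrite subrr; move: (G _) (G _) (G _) (G _) => p q p' q' ?; lra.
rewrite -EE.
have -> : H rho - H (- rho) = H (rho * sin (pi / 2)) - H (rho * sin (- (pi / 2))).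
  by rewrite sinN sin_pihalf mulrN mulr1.
apply: (@same_increment R (fun x => H (rho * sin x)) E (fun x => h (rho * sin x) * (rho * cos x))).
- lra.
- move=> x /andP[x1 x2].
  have D1 : is_derive x 1 (fun x => rho * sin x) (rho * cos x).
    by have := is_deriveZ rho (is_derive_sin x).
  apply: (@is_derive1_comp R H (fun x => rho * sin x) x) => //.
  apply: dH; have := sin_geN1 x => s1.
  have : rho * -1 <= rho * sin x by rewrite ler_pM2l.
  lra.
move=> x /andP[x1 x2].
have cos0 : 0 <= cos x by apply: cos_ge0_pihalf; rewrite x1 x2.
have sq : Num.sqrt (rho ^+ 2 - (rho * sin x) ^+ 2) = rho * cos x.
  rewrite exprMn -{1}[rho ^+ 2]mulr1 -mulrBr.
  rewrite (_ : 1 - sin x ^+ 2 = cos x ^+ 2); last by rewrite -(cos2Dsin2 x) addrK.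
  by rewrite -exprMn sqrtr_sqr ger0_norm // mulr_ge0 // ltW.
rewrite /h /slice_jump sq /E.
case: b {du h ch LHS RHS E EE H dH} @g cg dG => g cg dG /=.
- have D1 := is_derive_addr (dG (x + (pi / 2 + pi)) ltac:(lra)).
  have D2 := is_derive_subl (dG (pi / 2 - x) ltac:(lra)).
  apply: (is_derive_eq (is_deriveB D1 D2)).
  rewrite opprK /g /circle_pt /trig addrA !sinDpi !cosDpi sinDpihalf cosDpihalf.
  rewrite !sinB !cosB sin_pihalf cos_pihalf !mul0r !mul1r add0r subr0.
  rewrite !opprK !mulrN; ring.
- have D1 := is_derive_addr (dG (x + 0) ltac:(lra)).
  have D2 := is_derive_subl (dG (pi - x) ltac:(lra)).
  apply: (is_derive_eq (is_deriveB D1 D2)).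
  rewrite opprK /g /circle_pt /trig addr0.
  rewrite !sinB !cosB sinpi cospi !mul0r !mulN1r sub0r addr0 opprK !mulrN; ring.
Qed.

End GreenFormula.

(** * Integration by parts against Taylor polynomials *)

Section ByParts.
Context {R : realType}.
Implicit Types (z w zeta : R * R) (b : bool) (rho s t x : R) (j : multi_index)
  (e : nat -> multi_index) (F : multi_index -> R) (N : nat).

Lemma qs_pos s w : 0 < s -> 0 < qs s w.
Proof. by move=> s0; rewrite /qs ltr_wpDl // addr_ge0 // sqr_ge0. Qed.

Lemma pd_logk_continuous j s w : 0 < qs s w -> {for w, continuous (pd j (logk s))}.
Proof.
move=> q; have C : Ck 0 (qpos s) (pd j (logk s)) by apply: Ck_pd; exact: logk_Ck.
exact: (@Ck_continuous R 0 (qpos s) _ w C q).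
Qed.

Lemma pd_logk_is_derive j b s w : 0 < s ->
  is_derive w (dir b) (pd j (logk s)) (pd (j + mdir b) (logk s) w).
Proof.
move=> s0; have qw : qpos s w by exact: qs_pos.
have C : Ck 1 (qpos s) (pd j (logk s)) by apply: Ck_pd; exact: logk_Ck.
rewrite -(@dd_pd R b j (qpos s) (logk s) (@open_qpos R s) (logk_Ck _ s)) ?inE //.
exact: (@Ck_is_derive R b 0 _ _ w C qw).
Qed.

Lemma continuous_bigsum (T : topologicalType) (I : Type) (l : seq I) (P : pred I)
    (f : I -> T -> R) (p : T) :
  (forall i, P i -> {for p, continuous (f i)}) ->
  {for p, continuous (fun y => \sum_(i <- l | P i) f i y)}.
Proof.
move=> H; elim: l => [|i l IH].
  rewrite (_ : (fun y => _) = cst 0); first exact: cvg_cst.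
  by apply/funext => y; rewrite big_nil.
rewrite (_ : (fun y => _) = (fun y => (if P i then f i y else 0) +
    \sum_(i <- l | P i) f i y)); last first.
  by apply/funext => y; rewrite big_cons; case: (P i); rewrite ?add0r.
by apply: cvgD; last exact: IH; case: (boolP (P i)) => Pi; [exact: H|exact: cvg_cst].
Qed.

Lemma continuous_tpoly N F z zeta : {for zeta, continuous (tpoly N F z)}.
Proof.
apply: continuous_bigsum => i _; apply: continuous_bigsum => k _.
have c1 : {for zeta, continuous (fun x : R * R => (x.1 - z.1) ^+ i)}.
  by apply: continuousX; apply: cvgB; [exact: (@continuous_coord _ false)|exact: cvg_cst].
have c2 : {for zeta, continuous (fun x : R * R => (x.2 - z.2) ^+ k)}.
  by apply: continuousX; apply: cvgB; [exact: (@continuous_coord _ true)|exact: cvg_cst].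
by apply: cvgM; last exact: cvg_cst; apply: cvgM; last exact: cvg_cst; exact: cvgM c1 c2.
Qed.

Lemma continuous_integrable_disc rho (u : R * R -> R) :
  (forall z, {for z, continuous u}) -> (@area R).-integrable (disc rho) (EFin \o u).
Proof.
move=> cu; have [B B0 HB] := compact_continuous_bounded (@cdisc_compact R rho) (fun z _ => cu z).
apply: (@integrable_disc_bounded _ _ _ B).
  by apply: measurable_funTS; exact: continuous_measurable_plane.
by move=> z zr; apply: HB; exact: ltW.
Qed.

(** Green's formula for the kernel times the polynomial: the kernel contributes its zeta-derivative
    with a minus sign, so one derivative passes to the polynomial and lowers its degree. *)
Lemma by_parts_step j b s rho N F z : 0 < s -> 0 < rho ->
  \int[@area R]_(zeta in disc rho) (pd (j + mdir b) (logk s) (z - zeta) * tpoly N F z zeta) =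
  - circle_integral rho (fun zeta =>
      pd j (logk s) (z - zeta) * tpoly N F z zeta * coord b (normal zeta))
  + \int[@area R]_(zeta in disc rho)
      (pd j (logk s) (z - zeta) * tpoly N.-1 (fun i => F (i + mdir b)) z zeta).
Proof.
move=> s0 rho0.
have ck i w : {for w, continuous (pd i (logk s))} by apply: pd_logk_continuous; exact: qs_pos.
pose k i zeta := pd i (logk s) (z - zeta).
have ckr i zeta : {for zeta, continuous (k i)} by apply: continuous_reflect => w; exact: ck.
pose u zeta := k j zeta * tpoly N F z zeta.
pose v1 zeta := k j zeta * tpoly N.-1 (fun i => F (i + mdir b)) z zeta.
pose v2 zeta := k (j + mdir b) zeta * tpoly N F z zeta.
have cu zeta : {for zeta, continuous u} by apply: cvgM; [exact: ckr|exact: continuous_tpoly].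
have cv1 zeta : {for zeta, continuous v1} by apply: cvgM; [exact: ckr|exact: continuous_tpoly].
have cv2 zeta : {for zeta, continuous v2} by apply: cvgM; [exact: ckr|exact: continuous_tpoly].
have cu' zeta : {for zeta, continuous (fun zeta => v1 zeta - v2 zeta)}.
  by apply: cvgB; [exact: cv1|exact: cv2].
have du zeta : is_derive zeta (dir b) u (v1 zeta - v2 zeta).
  have D := is_deriveM (is_derive_reflect (pd_logk_is_derive j b (z - zeta) s0))
     (is_derive_tpoly b N F z zeta).
  by apply: (is_derive_eq D); rewrite scalerN /v1 /v2 /GRing.scale /= [in X in _ - X]mulrC.
have := green rho0 cu cu' du.
have mD := @measurable_disc R rho.
rewrite RintegralB //;
  [|exact: continuous_integrable_disc cv1|exact: continuous_integrable_disc cv2].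
rewrite -/(v1 _) => <-.
by rewrite opprB subrK.
Qed.

Lemma theta0 e : theta e 0 = 0.
Proof. by rewrite /theta big_geq. Qed.

Lemma thetaS e (t : nat) : theta e t.+1 = theta e t + e t.+1.
Proof. by rewrite /theta big_nat_recr. Qed.

Lemma phiS m e (t : nat) : (t.+1 < m)%N -> phi m e t = e t.+2 + phi m e t.+1.
Proof. by move=> tm; rewrite /phi big_ltn // ltnS. Qed.

Lemma phi_last m e : phi m e m.-1 = 0.
Proof. by rewrite /phi big_geq //; case: m. Qed.

Lemma size_theta m e (t : nat) : (forall tau, (1 <= tau <= m)%N -> exists b, e tau = mdir b) ->
  (t <= m)%N -> midx_size (theta e t) = t.
Proof.
move=> he; elim: t => [|t IH] tm; first by rewrite theta0.
have [b eb] := he t.+1 tm.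
by rewrite thetaS midx_sizeD eb midx_size_mdir IH ?addn1 // ltnW.
Qed.

Lemma size_phi m e (t : nat) : (forall tau, (1 <= tau <= m)%N -> exists b, e tau = mdir b) ->
  (t < m)%N -> midx_size (phi m e t) = (m - t.+1)%N.
Proof.
move=> he tm; have : theta e m = theta e t.+1 + phi m e t.
  by rewrite /theta /phi -big_cat_nat.
move=> /(congr1 midx_size); rewrite midx_sizeD !(size_theta he) // => E.
by apply/eqP; rewrite -(eqn_add2l t.+1) subnKC // -E.
Qed.

(** With [s = 0] and [F] the derivatives of [f] at a point [z] of the disc, this is
    [boundary_integrand]. *)
Definition bterm s m e F tau z zeta : R :=
  pd (theta e tau) (logk s) (z - zeta) *
  tpoly tau (fun i => F (phi m e tau + i)) z zeta *
  dot_midx (normal zeta) (e tau.+1).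

Lemma dot_mdir (v : R * R) b : dot_midx v (mdir b) = coord b v.
Proof. by case: b; rewrite /dot_midx /= ?mulr0 ?mulr1 ?addr0 ?add0r. Qed.

(** Each integration by parts moves the last direction of the kernel derivative into the
    coefficients of the polynomial, until the polynomial is zero. The induction runs backwards, from
    the zero polynomial up to [F] itself, where the shift [phi m e m.-1] is 0. *)
Lemma by_parts m e F z rho s : 0 < s -> 0 < rho ->
  (forall tau, (1 <= tau <= m)%N -> exists b, e tau = mdir b) ->
  \int[@area R]_(zeta in disc rho)
     (pd (theta e m) (logk s) (z - zeta) * tpoly m.-1 F z zeta) =
  - \sum_(1 <= tau < m) circle_integral rho (bterm s m e F tau z).
Proof.
move=> s0 rho0 he.
have z0 (k : R * R -> R) (F' : multi_index -> R) :
    \int[@area R]_(zeta in disc rho) (k zeta * tpoly 0 F' z zeta) = 0.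
  transitivity (\int[@area R]_(zeta in disc rho) 0 : R).
    by apply: eq_Rintegral => zeta _; rewrite tpoly0 mulr0.
  by rewrite Rintegral_cst ?mul0r //; exact: measurable_disc.
case: m he => [|m] he; first by rewrite big_geq // oppr0 z0.
suff H (t : nat) : (t <= m)%N -> \int[@area R]_(zeta in disc rho)
    (pd (theta e t.+1) (logk s) (z - zeta) * tpoly t (fun i => F (phi m.+1 e t + i)) z zeta) =
    - \sum_(1 <= tau < t.+1) circle_integral rho (bterm s m.+1 e F tau z).
  rewrite -H // -[in LHS]/(m.+1.-1).
  by apply: eq_Rintegral => zeta _; rewrite phi_last; congr (_ * _);
    apply: eq_tpoly => i _; rewrite add0r.
elim: t => [|t IH] tm; first by rewrite big_geq // oppr0 z0.
have [b eb] := he t.+2 ltac:(by []).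
rewrite thetaS eb by_parts_step // big_nat_recr //= opprD addrC -IH 1?ltnW //.
congr (_ + _); last first.
  congr (- _); rewrite /circle_integral; apply: eq_Rintegral => x _.
  by rewrite -dot_mdir -eb.
apply: eq_Rintegral => zeta _; congr (_ * _); apply: eq_tpoly => i _.
have -> : phi m.+1 e t = mdir b + phi m.+1 e t.+1 by rewrite -eb; apply: phiS.
by congr F; rewrite [i + _]addrC addrA [_ + mdir b]addrC.
Qed.

End ByParts.

(** * The limit of vanishing regularization *)

Section RegularizedLimit.
Context {R : realType}.
Local Notation mR := (measurableTypeR R).
Local Notation plane := (mR * mR)%type.
Local Notation mu := (@lebesgue_measure R).
Implicit Types (z w zeta : R * R) (s t x : R) (tau : nat).
Variables (r nu B rho : R) (N m : nat) (f : R * R -> R) (e : nat -> multi_index).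
Hypotheses (r0 : 0 < r) (r1 : r < 1) (nu01 : 0 < nu <= 1) (rrho : r < rho).
Hypotheses (Hf : Cknu N nu (disc r) f) (mN : (m <= N.+2)%N).
Hypotheses (mf : measurable_fun (disc r : set plane) f).
Hypotheses (B0 : 0 <= B) (fB : forall z, disc r z -> `|f z| <= B).
Hypothesis he : forall tau, (1 <= tau <= m)%N -> exists b, e tau = mdir b.

Let Fp := patch (fun=> 0) (disc r) f.
Let k s zeta := pd (theta e m) (logk s) zeta.
Let T z zeta := tpoly m.-1 (fun i => pd i f z) z zeta.
Let c := nu / 4.
Let CB s tau z := circle_integral rho (bterm s m e (fun i => pd i f z) tau z).
Let rho0 : 0 < rho. Proof. exact: lt_trans rrho. Qed.
Let c0 : 0 < c. Proof. by rewrite /c divr_gt0 //; case/andP: nu01. Qed.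
Let c1 : c < 1. Proof. by case/andP: nu01; rewrite /c; lra. Qed.

(** Kernel error times remainder bound, brought to the exponent [2 * (c - 1)] that [sing_dominated]
    expects. *)
Lemma kernel_diff_powR (C A s : R) (w : R * R) (p : nat) : 0 <= C -> 0 <= s -> w != 0 ->
  C * (s / cmod w ^+ 2) `^ c / cmod w ^+ p * (A * (cmod w ^+ p * cmod w `^ (nu - 2))) =
  C * A * s `^ c * cmod w `^ (2 * (c - 1)).
Proof.
move=> C0 s0 w0; have y0 : 0 < cmod w by rewrite cmod_gt0.
have -> : (s / cmod w ^+ 2) `^ c = s `^ c * cmod w `^ (- (2 * c)).
  rewrite powRM ?invr_ge0 ?exprn_ge0 ?cmod_ge0 //; congr (_ * _).
  by rewrite -powR_invn ?cmod_ge0 // -powRrM mulNr.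
have -> : 2 * (c - 1) = - (2 * c) + (nu - 2) by rewrite /c; lra.
rewrite (gt0_powRD (- (2 * c)) (nu - 2) y0); have : cmod w ^+ p != 0 by rewrite expf_neq0 // gt_eqF.
move: (s `^ c) (cmod w `^ (- (2 * c))) (cmod w `^ (nu - 2)) (cmod w ^+ p) => u v v' q q0.
by field.
Qed.

Let measurable_Fp (D : set plane) : measurable D -> measurable_fun D Fp.
Proof.
move=> mD; apply: measurable_funTS.
have H := (measurable_restrictT _ (@measurable_disc R r)).1 mf.
exact: H.
Qed.

Let FpB zeta : `|Fp zeta| <= B.
Proof. by rewrite /Fp patchE; case: ifPn => [/set_mem/fB //|_]; rewrite normr0. Qed.

Let measurable_FpT z (D : set plane) : measurable D ->
  measurable_fun D (fun zeta => Fp zeta - T z zeta).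
Proof.
move=> mD; apply: measurable_funB; first exact: measurable_Fp.
by apply: measurable_funTS; apply: continuous_measurable_plane => zeta; exact: continuous_tpoly.
Qed.

Let kcont s w : 0 < s -> {for w, continuous (k s)}.
Proof. by move=> s0; apply: pd_logk_continuous; exact: qs_pos. Qed.

Let bounded_mul_integrable z s (g : plane -> R) M : 0 < s -> measurable_fun (disc rho) g ->
  (forall zeta, disc rho zeta -> `|g zeta| <= M) ->
  (@area R).-integrable (disc rho) (EFin \o (fun zeta => k s (z - zeta) * g zeta)).
Proof.
move=> s0 mg gM; apply: (convolution_integrable (B := M) mg gM z) => w; exact: kcont.
Qed.

Let FpT_bounded z : exists M, forall zeta, disc rho zeta -> `|Fp zeta - T z zeta| <= M.
Proof.
have [M M0 HM] := compact_continuous_bounded (@cdisc_compact R rho)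
  (fun zeta _ => @continuous_tpoly R m.-1 (fun i => pd i f z) z zeta).
exists (B + M) => zeta zr; apply: le_trans (ler_normB _ _) _.
by apply: lerD; [exact: FpB|apply: HM; exact: ltW].
Qed.

(** The integrands at s and at 0 differ by kernel error times Taylor remainder, which is s^c times
    the standard singularity with constants uniform in [z]. *)
Let area_limit s0 : 0 < s0 < r -> exists2 C, 0 <= C & forall z, cdisc s0 z ->
  (@area R).-integrable (disc rho) (EFin \o (fun zeta => k 0 (z - zeta) * (Fp zeta - T z zeta))) /\
  forall s, 0 < s <= 1 ->
  `|\int[@area R]_(zeta in disc rho) (k s (z - zeta) * (Fp zeta - T z zeta)) -
    \int[@area R]_(zeta in disc rho) (k 0 (z - zeta) * (Fp zeta - T z zeta))| <= C * s `^ c.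
Proof.
move=> s0r; have mD := @measurable_disc R rho.
have c01 : 0 < c < 1 by rewrite c0 c1.
have c01' : 0 < c <= 1 by rewrite c0 ltW.
have [A A0 HA] := remainder_bound nu01 Hf mN s0r r1 rho0 B0 fB.
have [C C0 HC] := @pd_logk_cvg R (theta e m) c c01'.
have [C' C'0 HC'] := sing_dominated s0 c01 rho0.
exists (C * A * C'); first by rewrite !mulr_ge0.
move=> z zs.
pose D s zeta := (k s (z - zeta) - k 0 (z - zeta)) * (Fp zeta - T z zeta).
have mk s : 0 <= s -> measurable_fun (setT : set plane) (fun zeta => k s (z - zeta)).
  move=> sge0; apply: (@measurable_off_point R z) => zeta zz.
  apply: (@continuous_comp _ _ _ (fun zeta => z - zeta) (k s)).
    by apply: cvgB; [exact: cvg_cst|exact: cvg_id].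
  by apply: pd_logk_continuous; apply: qs_gt0 => //; rewrite subr_eq0 eq_sym.
have HD s : 0 < s -> (@area R).-integrable (disc rho) (EFin \o D s) /\
    `|\int[@area R]_(zeta in disc rho) D s zeta| <= C * A * s `^ c * C'.
  move=> sgt0; apply: (HC' z) => //; first by rewrite !mulr_ge0 // powR_ge0.
    apply: measurable_funM; last exact: measurable_FpT.
    by apply: measurable_funTS; apply: measurable_funB; apply: mk; rewrite ?(ltW sgt0).
  move=> zeta zr zz; rewrite normrM.
  have w0 : z - zeta != 0 by rewrite subr_eq0 eq_sym.
  have h1 := HC s (z - zeta) (ltW sgt0) w0; rewrite (size_theta he) // in h1.
  have h2 := HA z zeta zs (ltW zr) zz; rewrite cmod_distC in h2.
  rewrite -(@kernel_diff_powR C A s (z - zeta) m C0 (ltW sgt0) w0).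
  by apply: ler_pM.
have [M HM] := FpT_bounded z.
have ik s : 0 < s -> (@area R).-integrable (disc rho)
    (EFin \o (fun zeta => k s (z - zeta) * (Fp zeta - T z zeta))).
  by move=> sgt0; exact: (@bounded_mul_integrable z s _ M sgt0 (@measurable_FpT z _ mD) HM).
have i0 : (@area R).-integrable (disc rho)
    (EFin \o (fun zeta => k 0 (z - zeta) * (Fp zeta - T z zeta))).
  (* The limit integrand is the integrable one at s = 1 minus the dominated difference, which gives
     its integrability. *)
  pose KT s zeta := k s (z - zeta) * (Fp zeta - T z zeta).
  have -> : EFin \o (fun zeta => k 0 (z - zeta) * (Fp zeta - T z zeta)) =
     ((EFin \o KT 1%R) \- (EFin \o D 1%R))%E.
    by apply/funext => zeta /=; rewrite -EFinB /D /KT; congr (_%:E); ring.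
  by apply: integrableB => //; [exact: ik|exact: (HD 1 ltr01).1].
split=> // s /andP[sgt0 _]; rewrite -RintegralB //; last exact: ik.
have -> : \int[@area R]_(x in disc rho)
     (k s (z - x) * (Fp x - T z x) - k 0 (z - x) * (Fp x - T z x)) =
   \int[@area R]_(zeta in disc rho) D s zeta.
  by apply: eq_Rintegral => zeta _; rewrite /D mulrBl.
by apply: le_trans (HD s sgt0).2 _; rewrite mulrAC.
Qed.

Let pdf_bounded s0 i : s0 < r -> (midx_size i <= N)%N ->
  exists2 M, 0 <= M & forall z, cdisc s0 z -> `|pd i f z| <= M.
Proof.
move=> s0r iN; apply: cdisc_bounded s0r _ => z zr.
have Cf : Ck N (disc r) f by case: Hf.
have Ci : Ck 0 (disc r) (pd i f) by apply: Ck_pd; rewrite add0n; apply: Ck_le Cf.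
exact: (@Ck_continuous R 0 (disc r) _ z Ci zr).
Qed.

(** Points of [cdisc s0] keep the distance rho - s0 from the circle, so the kernels are regular on
    it and their error is at most a constant times s^c. *)
Let circle_limit s0 tau : 0 < s0 < r -> (1 <= tau < m)%N ->
  exists2 C, 0 <= C & forall z, cdisc s0 z ->
  circle_integrable rho (bterm 0 m e (fun i => pd i f z) tau z) /\
  forall s, 0 < s <= 1 -> `|CB s tau z - CB 0 tau z| <= C * s `^ c.
Proof.
move=> /andP[s00 s0r] /andP[tau1 taum].
have c01' : 0 < c <= 1 by rewrite c0 ltW.
have [b eb] := he (tau := tau.+1) taum.
have [C C0 HC] := @pd_logk_cvg R (theta e tau) c c01'.
have [M M0 HM] : exists2 M, 0 <= M & forall z zeta, cdisc s0 z -> cdisc rho zeta ->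
    `|tpoly tau (fun i => pd (phi m e tau + i) f z) z zeta| <= M.
  apply: (@tpoly_bounded R (cdisc s0) (fun z i => pd (phi m e tau + i) f z) _ s0) => // i itau.
  (* |phi_tau| = m - tau - 1 and |i| < tau, so at most m - 2 <= N derivatives of [f] occur. *)
  apply: pdf_bounded => //; rewrite midx_sizeD (size_phi he) //.
  move: itau taum mN; clear; lia.
pose d := rho - s0; have d0 : 0 < d by rewrite subr_gt0 (lt_trans s0r).
have far z t : cdisc s0 z -> d <= cmod (z - circle_pt rho t).
  move=> zs; rewrite /d lerBlDr -[leLHS](cmod_circle t (ltW rho0)) -[circle_pt _ _](subrK z).
  apply: le_trans (cmodD _ _) _; rewrite subrK cmod_distC; exact: lerD.
pose g s z t := pd (theta e tau) (logk s) (z - circle_pt rho t) *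
   tpoly tau (fun i => pd (phi m e tau + i) f z) z (circle_pt rho t) * (rho * trig b t).
have gE s z t : bterm s m e (fun i => pd i f z) tau z (circle_pt rho t) * rho = g s z t.
  by rewrite /bterm /g eb dot_mdir -[LHS]mulrA coord_normal.
have cg s z t : 0 <= s -> cdisc s0 z -> {for t, continuous (g s z)}.
  move=> sge0 zs; apply: cvgM.
    apply: cvgM.
      apply: (@continuous_comp _ _ _ (fun t => z - circle_pt rho t) (pd (theta e tau) (logk s))).
        by apply: cvgB; [exact: cvg_cst|exact: continuous_circle_pt].
      apply: pd_logk_continuous; apply: qs_gt0 => //.
      by rewrite -cmod_eq0 gt_eqF // (lt_le_trans d0) // far.
    apply: (@continuous_comp _ _ _ (@circle_pt R rho)
      (tpoly tau (fun i => pd (phi m e tau + i) f z) z)).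
      exact: continuous_circle_pt.
    exact: continuous_tpoly.
  by apply: cvgM; [exact: cvg_cst|exact: continuous_trig].
have ig s z : 0 <= s -> cdisc s0 z -> mu.-integrable `[0, 2 * pi] (EFin \o g s z).
  by move=> sge0 zs; apply: continuous_integrable => t; exact: cg.
have CBE s z : CB s tau z = \int[mu]_(t in `[0, 2 * pi]) g s z t.
  by apply: eq_Rintegral => t _; rewrite gE.
pose L := C * (d ^- 2) `^ c / d ^+ tau * M * rho.
have L0 : 0 <= L by rewrite !mulr_ge0 ?invr_ge0 ?exprn_ge0 ?powR_ge0 // ltW.
pose I := \int[mu]_(t in `[0, 2 * pi]) (1 : R).
have I0 : 0 <= I by apply: Rintegral_ge0.
exists (L * I); first exact: mulr_ge0.
move=> z zs; split.
  rewrite /circle_integrable (_ : (fun t => _) = EFin \o g 0 z); first exact: ig.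
  by apply/funext => t /=; rewrite gE.
move=> s /andP[sgt0 _].
have mI : measurable (`[0, 2 * pi]%classic : set mR) by exact: measurable_itv.
rewrite !CBE -(RintegralB mI (ig s z (ltW sgt0) zs) (ig 0 z (lexx 0) zs)).
have dint : mu.-integrable `[0, 2 * pi] (EFin \o (fun t => g s z t - g 0 z t)).
  apply: continuous_integrable => t; apply: cvgB; last exact: cg.
  by apply: cg => //; exact: ltW.
apply: le_trans (le_normr_Rintegral mI dint) _.
have cint (a : R) : mu.-integrable `[0, 2 * pi] (EFin \o (fun _ => a)).
  by apply: continuous_integrable => t; exact: cvg_cst.
rewrite mulrAC -[leRHS](@RintegralZl _ _ _ mu `[0, 2 * pi] (fun _ => 1) (L * s `^ c) mI (cint 1)).
apply: le_Rintegral => //.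
  exact: (integrable_norm dint).
move=> t _; rewrite mulr1 /g -!mulrBl.
set w := z - circle_pt rho t.
have w0 : w != 0 by rewrite -cmod_eq0 gt_eqF // (lt_le_trans d0) // far.
have dw : d <= cmod w by exact: far.
have y0 : 0 < cmod w by exact: lt_le_trans dw.
have h1 := HC s w (ltW sgt0) w0; rewrite (size_theta he) ?(ltnW taum) // in h1.
have cr : cdisc rho (circle_pt rho t) by rewrite /cdisc /= cmod_circle // ltW.
have h2 := HM z _ zs cr.
have -> : L * s `^ c = (C * (s `^ c * (d ^- 2) `^ c) / d ^+ tau) * M * rho by rewrite /L; ring.
rewrite !normrM; apply: ler_pM => //.
  apply: ler_pM => //.
  apply: le_trans h1 _; apply: ler_pM;
    rewrite ?mulr_ge0 ?invr_ge0 ?exprn_ge0 ?powR_ge0 ?cmod_ge0 //.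
    apply: ler_wpM2l => //; rewrite -powRM ?(ltW sgt0) ?invr_ge0 ?exprn_ge0 ?(ltW d0) //.
    apply: ge0_ler_powR; first exact: ltW.
    - by rewrite nnegrE divr_ge0 ?exprn_ge0 ?(ltW sgt0) ?(ltW y0).
    - by rewrite nnegrE divr_ge0 ?exprn_ge0 ?(ltW sgt0) ?(ltW d0).
    apply: ler_wpM2l; first exact: ltW.
    by rewrite lef_pV2 ?posrE ?exprn_gt0 // lerXn2r // ?nnegrE ltW.
  by rewrite lef_pV2 ?posrE ?exprn_gt0 // lerXn2r // ?nnegrE ltW.
rewrite (gtr0_norm rho0) ger_pMr //; case: (b) => /=; rewrite ler_norml.
  by rewrite sin_geN1 sin_le1.
by rewrite cos_geN1 cos_le1.
Qed.

Let W s z := \int[@area R]_(zeta in disc r) (k s (z - zeta) * f zeta).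

(** The extended [f] is split into Taylor remainder plus polynomial, and [by_parts] turns the
    polynomial part into circle integrals. *)
Let W_decomp s z : 0 < s ->
  W s z = \int[@area R]_(zeta in disc rho) (k s (z - zeta) * (Fp zeta - T z zeta))
          - \sum_(1 <= tau < m) CB s tau z.
Proof.
move=> s0; have mD := @measurable_disc R rho.
have [M HM] := FpT_bounded z.
have -> : W s z = \int[@area R]_(zeta in disc rho) (k s (z - zeta) * Fp zeta).
  rewrite /W Rintegral_mkcond [RHS]Rintegral_mkcond; apply: eq_Rintegral => zeta _.
  rewrite !patchE /Fp patchE; case: ifPn => [/set_mem zr|_].
    by rewrite mem_set //; exact: lt_trans rrho.
  by case: ifP => // _; rewrite mulr0.
rewrite -(by_parts (fun i => pd i f z) z s0 rho0 he) -RintegralD //.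
- by apply: eq_Rintegral => zeta _; rewrite /T /k; ring.
- exact: (@bounded_mul_integrable z s _ M s0 (@measurable_FpT z _ mD) HM).
- apply: continuous_integrable_disc => zeta; apply: cvgM; last exact: continuous_tpoly.
  by apply: continuous_reflect => w; exact: kcont.
Qed.

Lemma regularized_limit s0 : 0 < s0 < r -> exists2 C, 0 <= C & forall z, cdisc s0 z ->
  [/\ (@area R).-integrable (disc rho)
        (EFin \o (fun zeta => pd (theta e m) (logk 0) (z - zeta) *
           (patch (fun=> 0) (disc r) f zeta - tpoly m.-1 (fun i => pd i f z) z zeta))),
      forall tau, (1 <= tau < m)%N ->
        circle_integrable rho (bterm 0 m e (fun i => pd i f z) tau z) &
      forall s, 0 < s <= 1 ->
      `|\int[@area R]_(zeta in disc r) (pd (theta e m) (logk s) (z - zeta) * f zeta) -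
        (\int[@area R]_(zeta in disc rho) (pd (theta e m) (logk 0) (z - zeta) *
           (patch (fun=> 0) (disc r) f zeta - tpoly m.-1 (fun i => pd i f z) z zeta))
         - \sum_(1 <= tau < m) circle_integral rho (bterm 0 m e (fun i => pd i f z) tau z))|
      <= C * s `^ (nu / 4)].
Proof.
move=> s0r; have [C1 C10 H1] := area_limit s0r.
(* [s] is made part of the point and the differences are divided by s^c, so that [ex_bound_sum]
   yields one constant for the whole sum. *)
have [C2 C20 H2] : exists2 C, 0 <= C & forall p : (R * R) * R,
    [set p : (R * R) * R | cdisc s0 p.1 /\ 0 < p.2 <= 1] p ->
    `|\sum_(1 <= tau < m | (1 <= tau < m)%N) (CB p.2 tau p.1 - CB 0 tau p.1) / p.2 `^ c| <= C.
  apply: ex_bound_sum => tau htau; have [C C0 HC] := circle_limit s0r htau.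
  exists C => // -[z s] [/= zs s01]; have s0' : 0 < s `^ c by rewrite powR_gt0; case/andP: s01.
  by rewrite normrM normfV (gtr0_norm s0') ler_pdivrMr //; exact: (HC z zs).2.
exists (C1 + C2); first exact: addr_ge0.
move=> z zs; split.
- exact: (H1 z zs).1.
- by move=> tau htau; have [C C0 HC] := circle_limit s0r htau; exact: (HC z zs).1.
move=> s s01; have sgt0 : 0 < s by case/andP: s01.
have s0' : 0 < s `^ c by rewrite powR_gt0.
rewrite -/(W s z) W_decomp //.
have h1 := (H1 z zs).2 s s01.
have := H2 (z, s) (conj zs s01); rewrite -big_nat -mulr_suml normrM normfV (gtr0_norm s0').
rewrite ler_pdivrMr // sumrB /= => h2.
rewrite mulrDl; set X := \int[_]_(_ in _) _ in h1 *; set Y := \int[_]_(_ in _) _ in h1 *.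
rewrite [X in `|X|](_ : _ = (X - Y) -
    (\sum_(1 <= tau < m) CB s tau z - \sum_(1 <= tau < m) CB 0 tau z)).
  by apply: le_trans (ler_normB _ _) _; exact: lerD.
by rewrite /CB; ring.
Qed.

End RegularizedLimit.

(** * Derivatives of the potential *)

Section Assembly.
Context {R : realType}.
Local Notation mR := (measurableTypeR R).
Local Notation plane := (mR * mR)%type.
Implicit Types (z w zeta : R * R) (b : bool) (j : multi_index).
Variables (r nu B : R) (N : nat) (f : R * R -> R).
Hypotheses (r0 : 0 < r) (r1 : r < 1) (nu01 : 0 < nu <= 1).
Hypotheses (Hf : Cknu N nu (disc r) f).
Hypotheses (mf : measurable_fun (disc r : set plane) f).
Hypotheses (B0 : 0 <= B) (fB : forall z, disc r z -> `|f z| <= B).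

Let rhs m (e : nat -> multi_index) rho z : R :=
  \int[@area R]_(zeta in disc rho) (pd (theta e m) (logk 0) (z - zeta) *
     (patch (fun=> 0) (disc r) f zeta - tpoly m.-1 (fun i => pd i f z) z zeta))
  - \sum_(1 <= tau < m) circle_integral rho (bterm 0 m e (fun i => pd i f z) tau z).

Let W j s z : R := \int[@area R]_(zeta in disc r) (pd j (logk s) (z - zeta) * f zeta).

(** The sorted ordering: [j.1] steps in the first direction, all later ones in the second. *)
Definition edir j (tau : nat) : multi_index := mdir (j.1 < tau)%N.

Lemma theta_edir j : theta (edir j) (midx_size j) = j.
Proof.
case: j => p q; rewrite /midx_size /=.
have P t : (t <= p)%N -> theta (edir (p, q)) t = (t, 0)%N.
  elim: t => [|t IH] tp; first by rewrite theta0.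
  have E : edir (p, q) t.+1 = mdir false by rewrite /edir ltnNge tp.
  by rewrite thetaS (IH (ltnW tp)) E addm_mdir.
suff H k : theta (edir (p, q)) (p + k) = (p, k) by exact: H.
elim: k => [|k IH]; first by rewrite addn0; exact: P.
have E : edir (p, q) (p + k).+1 = mdir true by rewrite /edir ltnS leq_addr.
by rewrite addnS thetaS IH E addm_mdir.
Qed.

(** Candidate for the derivative of order [j] of the potential, with one fixed ordering and radius;
    on the disc, [j = 0] gives the potential itself. *)
Let G j z := (2 * pi)^-1 * rhs (midx_size j) (edir j) (r + 1) z.

Let small_powR (C eps c : R) : 0 <= C -> 0 < eps -> 0 < c ->
  exists2 s1, 0 < s1 <= 1 & forall s, 0 < s <= s1 -> C * s `^ c <= eps.
Proof.
move=> C0 eps0 c0; pose d := eps / (C + 1).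
have C1 : 0 < C + 1 by rewrite ltr_wpDl.
have d0 : 0 < d by rewrite divr_gt0.
exists (Num.min 1 (d `^ c^-1)); first by rewrite lt_min ltr01 powR_gt0 //= ge_min lexx.
move=> s /andP[s0]; rewrite le_min => /andP[_ sd].
have : s `^ c <= d.
  apply: (@le_trans _ _ ((d `^ c^-1) `^ c)).
    by apply: ge0_ler_powR; rewrite ?nnegrE ?powR_ge0 // ltW.
  by rewrite -powRrM mulVf ?gt_eqF // powRr1 // ltW.
move=> sd'; apply: (@le_trans _ _ (C * d)); first exact: ler_wpM2l.
by rewrite /d mulrA ler_pdivrMr // mulrC ler_wpM2l ?ltW // ltrDl.
Qed.

Let mid_radius z : disc r z -> exists2 s0, 0 < s0 < r & disc s0 z.
Proof.
rewrite /disc /= => zr; exists ((cmod z + r) / 2).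
  by have y0 := cmod_ge0 z; apply/andP; split; lra.
lra.
Qed.

Let limit m e rho z : (m <= N.+2)%N ->
  (forall tau, (1 <= tau <= m)%N -> exists b, e tau = mdir b) -> r < rho -> disc r z ->
  [/\ (@area R).-integrable (disc rho)
        (EFin \o (fun zeta => pd (theta e m) (logk 0) (z - zeta) *
           (patch (fun=> 0) (disc r) f zeta - tpoly m.-1 (fun i => pd i f z) z zeta))),
      forall tau, (1 <= tau < m)%N ->
        circle_integrable rho (bterm 0 m e (fun i => pd i f z) tau z) &
      forall eps, 0 < eps -> exists2 s1, 0 < s1 & forall s, 0 < s <= s1 ->
        `|W (theta e m) s z - rhs m e rho z| <= eps].
Proof.
move=> mN he rrho zr; have [s0 s0r zs0] := mid_radius zr.
have [C C0 HC] := regularized_limit r0 r1 nu01 rrho Hf mN mf B0 fB he s0r.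
have [h1 h2 h3] := HC z (ltW zs0); split=> // eps eps0.
have c0 : 0 < nu / 4 by rewrite divr_gt0 //; case/andP: nu01.
have [s1 /andP[s10 s11] H] := small_powR C0 eps0 c0; exists s1 => // s /andP[s0' ss1].
apply: le_trans (h3 s _) (H s _); last by rewrite s0' ss1.
by rewrite s0' (le_trans ss1).
Qed.

Let edirP j m : forall tau, (1 <= tau <= m)%N -> exists b, edir j tau = mdir b.
Proof. by move=> tau _; exists (j.1 < tau)%N. Qed.

Let rr1 : r < r + 1. Proof. by rewrite ltrDl. Qed.

Let lucvg_W j : (midx_size j <= N.+2)%N ->
  lucvg (disc r) (fun s z => (2 * pi)^-1 * W j s z) (G j).
Proof.
move=> jN z zr; have [s0 s0r zs0] := mid_radius zr.
have [C C0 HC] := regularized_limit r0 r1 nu01 rr1 Hf jN mf B0 fB (@edirP j _) s0r.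
have [d d0 dH] := open_box (@disc_open R s0) zs0.
exists d => // eps eps0.
have c0 : 0 < nu / 4 by rewrite divr_gt0 //; case/andP: nu01.
have pi0 : 0 <= (2 * pi)^-1 :> R by rewrite invr_ge0 mulr_ge0 // ltW // pi_gt0.
have [s1 /andP[s10 s11] H] := small_powR (mulr_ge0 pi0 C0) eps0 c0.
exists s1 => // s w /andP[s0' ss1] zw.
have [_ _ h3] := HC w (ltW (dH _ zw)).
apply: le_trans (H s _); last by rewrite s0' ss1.
rewrite /G -mulrBr normrM (ger0_norm pi0) -mulrA; apply: ler_wpM2l => //.
have s01 : 0 < s <= 1 by rewrite s0' (le_trans ss1).
have := h3 s s01; rewrite -/(rhs (midx_size j) (edir j) (r + 1) w) theta_edir.
exact.
Qed.

Let kcont j s w : 0 < s -> {for w, continuous (pd j (logk s))}.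
Proof. by move=> s0; apply: pd_logk_continuous; exact: qs_pos. Qed.

Let W_derive b j s z : 0 < s ->
  is_derive z (dir b) (fun z => (2 * pi)^-1 * W j s z) ((2 * pi)^-1 * W (j + mdir b) s z).
Proof.
move=> s0.
have D := convolution_is_derive mf fB (fun w => @kcont j s w s0)
  (K' := fun b => pd (j + mdir b) (logk s)) (fun b w => @kcont (j + mdir b) s w s0)
  (fun b w => pd_logk_is_derive j b w s0) b z.
exact: (is_deriveZ (2 * pi)^-1 D).
Qed.

Let W_continuous j s z : 0 < s -> {for z, continuous (fun z => (2 * pi)^-1 * W j s z)}.
Proof.
move=> s0.
have D : {for z, continuous (W j s)}.
  exact: (convolution_continuous mf fB (fun w => @kcont j s w s0)
    (K' := fun b => pd (j + mdir b) (logk s)) (fun b w => @kcont (j + mdir b) s w s0)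
    (fun b w => pd_logk_is_derive j b w s0)).
by apply: cvgM; [exact: cvg_cst|exact: D].
Qed.

Let G_continuous j z : (midx_size j <= N.+2)%N -> disc r z -> {for z, continuous (G j)}.
Proof.
move=> jN zr; have L := lucvg_W jN.
exact: (lucvg_continuous L (fun s z s0 _ => @W_continuous j s z s0) zr).
Qed.

(** The regularized integrals for [j] have those for [j + mdir b] as derivatives, and both converge
    locally uniformly to the respective [G]. *)
Let G_derive b j z : (midx_size j < N.+2)%N -> disc r z ->
  is_derive z (dir b) (G j) (G (j + mdir b) z).
Proof.
move=> jN zr; have jN1 : (midx_size (j + mdir b)%R <= N.+2)%N.
  by rewrite midx_sizeD midx_size_mdir addn1.
exact: (lucvg_is_derive (@disc_open R r) (lucvg_W (ltnW jN)) (lucvg_W jN1)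
  (fun s w s0 _ => @W_derive b j s w s0) (G_continuous jN1 zr) zr).
Qed.

Let G_Ck k j : (k + midx_size j <= N.+2)%N -> Ck k (disc r) (G j).
Proof.
elim: k j => [|k IH] j kj.
  by split=> // z zr; exact: G_continuous.
have jN : (midx_size j < N.+2)%N by apply: leq_trans kj; rewrite addSn ltnS leq_addl.
apply/CkS; split=> [z zr|b]; first exact: G_continuous (ltnW jN) zr.
split=> [z zr|]; first by have [] := G_derive b jN zr.
apply: (@eq_Ck R k _ (G (j + mdir b))); first exact: disc_open.
  by move=> z; rewrite inE => zr; have [_ <-] := G_derive b jN zr.
by apply: IH; rewrite midx_sizeD midx_size_mdir addnA addn1 -addSn.
Qed.

Let pd_G j : (midx_size j <= N.+2)%N -> {in disc r, pd j (G (0, 0)%N) =1 G j}.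
Proof.
have oD := @disc_open R r.
case: j => p q; elim: p => [|p IH].
  elim: q => [//|q IH] qN z zr.
  have jN : (midx_size (0%N, q) < N.+2)%N := qN.
  rewrite (_ : pd (0, q.+1)%N (G (0, 0)%N) = dd true (pd (0, q)%N (G (0, 0)%N))) //.
  rewrite (eq_dd true oD (IH (ltnW qN)) zr).
  rewrite inE in zr; have [_ E] := G_derive true jN zr.
  by rewrite /dd E addm_mdir.
move=> qN z zr; have jN : (midx_size (p, q) < N.+2)%N := qN.
rewrite (_ : pd (p.+1, q)%N (G (0, 0)%N) = dd false (pd (p, q)%N (G (0, 0)%N))) //.
rewrite (eq_dd false oD (IH (ltnW qN)) zr).
rewrite inE in zr; have [_ E] := G_derive false jN zr.
by rewrite /dd E addm_mdir.
Qed.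

Let log_potentialE : {in disc r, G (0, 0)%N =1 log_potential r f}.
Proof.
move=> z; rewrite inE => zr; rewrite /G /rhs /log_potential big_geq // subr0; congr (_ * _).
rewrite Rintegral_mkcond [RHS]Rintegral_mkcond; apply: eq_Rintegral => zeta _.
rewrite !patchE log_kernelE tpoly0 subr0 theta0.
case: (boolP (zeta \in disc r)) => [/set_mem zr'|_].
  rewrite (_ : zeta \in disc (r + 1)) //.
  by apply/mem_set; exact: lt_trans rr1.
by case: ifP => // _; rewrite mulr0.
Qed.

(** Order 0 of the general limit: the polynomial is zero, and on [disc r] its integrand is that of
    the potential. *)
Lemma log_integrable z : disc r z ->
  (@area R).-integrable (disc r) (fun zeta => (log_kernel zeta z * f zeta)%:E).
Proof.
move=> zr; have [h1 _ _] := limit (m := 0) (e := edir (0, 0)%N) (leq0n _) (@edirP _ _) rr1 zr.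
have h2 : (@area R).-integrable (disc r)
        (EFin \o (fun zeta => pd (theta (edir (0, 0)%N) 0) (logk 0) (z - zeta) *
           (patch (fun=> 0) (disc r) f zeta - tpoly 0 (fun i => pd i f z) z zeta))).
  apply: integrableS h1; [exact: measurable_disc|exact: measurable_disc|].
  by move=> w wr; exact: lt_trans rr1.
apply: eq_integrable h2; first exact: measurable_disc.
move=> zeta /set_mem zr'; rewrite /= theta0 tpoly0 subr0 patchE mem_set //.
by rewrite log_kernelE.
Qed.

Lemma log_potential_Ck : Ck N.+2 (disc r) (log_potential r f).
Proof.
apply: (eq_Ck (@disc_open R r) log_potentialE).
by apply: G_Ck => //; rewrite [midx_size _]/= addn0.
Qed.

(** [G j] and the right side for the given [e] and [rho] are both limits, as s tends to 0, of the
    same regularized derivative at [z], hence equal. *)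
Lemma log_potential_pd e rho z :
  (forall tau, (1 <= tau <= N.+2)%N -> exists b, e tau = mdir b) ->
  r < rho -> disc r z ->
  [/\ (@area R).-integrable (disc rho)
        (fun zeta => (area_integrand r N.+2 (theta e N.+2) f z zeta)%:E),
      forall tau, (1 <= tau < N.+2)%N ->
        circle_integrable rho (boundary_integrand N.+2 e f tau z) &
      pd (theta e N.+2) (log_potential r f) z =
        (2 * pi)^-1 *
          (\int[@area R]_(zeta in disc rho) area_integrand r N.+2 (theta e N.+2) f z zeta)
        - (2 * pi)^-1 *
          \sum_(1 <= tau < N.+2) circle_integral rho (boundary_integrand N.+2 e f tau z)].
Proof.
move=> he rrho zr.
have [h1 h2 h3] := limit (leqnn _) he rrho zr.
have AE zeta : area_integrand r N.+2 (theta e N.+2) f z zeta =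
    pd (theta e N.+2) (logk 0) (z - zeta) *
      (patch (fun=> 0) (disc r) f zeta - tpoly N.+1 (fun i => pd i f z) z zeta).
  rewrite /area_integrand taylorE subSS subn1 /=; congr (_ * _).
  by rewrite (_ : log_kernel zeta = (fun z => logk 0 (z - zeta))) ?pd_translate //;
    apply/funext => w; exact: log_kernelE.
have BE tau : (1 <= tau < N.+2)%N ->
    boundary_integrand N.+2 e f tau z = bterm 0 N.+2 e (fun i => pd i f z) tau z.
  move=> tauN; apply/funext => zeta; rewrite /boundary_integrand /bterm.
  congr (_ * _ * _).
    by rewrite (_ : log_kernel zeta = (fun z => logk 0 (z - zeta))) ?pd_translate //;
      apply/funext => w; exact: log_kernelE.
  rewrite taylorE subn1 prednK; last by case/andP: tauN.
  apply: eq_tpoly => i itau.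
  have zr' : z \in disc r by rewrite inE.
  (* The two successive derivatives of [f] merge because |phi_tau| = N + 1 - tau and |i| < tau leave
     the total order at most N. *)
  apply: (pd_pd (@disc_open R r) _ zr'); apply: Ck_le (Hf.1).
  by rewrite (size_phi he); move: itau tauN; clear; lia.
split.
- rewrite (_ : (fun zeta => _) = EFin \o (fun zeta => pd (theta e N.+2) (logk 0) (z - zeta) *
    (patch (fun=> 0) (disc r) f zeta - tpoly N.+1 (fun i => pd i f z) z zeta))).
    exact: h1.
  by apply/funext => zeta /=; rewrite AE.
- by move=> tau tauN; rewrite BE //; exact: h2.
pose j := theta e N.+2.
have jN : midx_size j = N.+2 by exact: size_theta he (leqnn _).
have jN' : (midx_size j <= N.+2)%N by rewrite jN.
have -> : pd j (log_potential r f) z = G j z.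
  have zr' : z \in disc r by rewrite inE.
  by rewrite -(pd_G jN' zr'); apply/esym; exact: (eq_pd j (@disc_open R r) log_potentialE zr').
have -> : \int[@area R]_(zeta in disc rho) area_integrand r N.+2 (theta e N.+2) f z zeta =
    \int[@area R]_(zeta in disc rho) (pd (theta e N.+2) (logk 0) (z - zeta) *
      (patch (fun=> 0) (disc r) f zeta - tpoly N.+1 (fun i => pd i f z) z zeta)).
  by apply: eq_Rintegral => zeta _; exact: AE.
have -> : \sum_(1 <= tau < N.+2) circle_integral rho (boundary_integrand N.+2 e f tau z) =
    \sum_(1 <= tau < N.+2) circle_integral rho (bterm 0 N.+2 e (fun i => pd i f z) tau z).
  by apply: eq_big_nat => tau /BE ->.
rewrite -mulrBr /G; congr (_ * _).
have [_ _ h4] := limit jN' (@edirP j _) rr1 zr.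
rewrite theta_edir in h4.
apply/eqP; rewrite -subr_eq0 -normr_le0; apply/ler_addgt0Pr => eps eps0; rewrite add0r.
have eps20 : 0 < eps / 2 by rewrite divr_gt0.
have [s1 s10 H1] := h3 _ eps20; have [s2 s20 H2] := h4 _ eps20.
pose s := Num.min s1 s2; have s0 : 0 < s by rewrite lt_min s10 s20.
have {}H1 := H1 s; have {}H2 := H2 s.
rewrite s0 ge_min lexx in H1; rewrite s0 ge_min lexx orbT in H2.
have := H1 isT; have := H2 isT; rewrite -/(rhs N.+2 e rho z).
move: (rhs _ _ _ _) (rhs _ _ _ _) (W _ _ _) => x y u.
rewrite !ler_norml => /andP[? ?] /andP[? ?]; apply/andP; split; lra.
Qed.

End Assembly.

Theorem proposition3p4 (R : realType) (r : R) (n : nat) (nu : R)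
    (f : R * R -> R)
    (hr0 : 0 < r) (hr1 : r < 1) (hn : (3 <= n)%N)
    (hnu0 : 0 < nu) (hnu1 : nu <= 1)
    (hbd : [bounded f z | z in disc r])
    (hint : (@area R).-integrable (disc r) (fun z => (f z)%:E))
    (hf : Cknu (n - 2) nu (disc r) f) :
  (forall z, disc r z ->
     (@area R).-integrable (disc r) (fun zeta => (log_kernel zeta z * f zeta)%:E)) /\
  Ck n (disc r) (log_potential r f) /\
  forall (j : multi_index) (e : nat -> multi_index),
    midx_size j = n ->
    (forall tau : nat, (1 <= tau <= n)%N ->
       e tau = (1%N, 0%N) \/ e tau = (0%N, 1%N)) ->
    j = \sum_(1 <= tau < n.+1) e tau ->
    forall rho : R, r < rho ->
    forall z : R * R, disc r z ->
      (@area R).-integrable (disc rho)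
        (fun zeta => (area_integrand r n j f z zeta)%:E) /\
      (forall tau : nat, (1 <= tau < n)%N ->
         circle_integrable rho (boundary_integrand n e f tau z)) /\
      pd j (log_potential r f) z =
        (2 * pi)^-1 *
          (\int[@area R]_(zeta in disc rho) area_integrand r n j f z zeta)
        - (2 * pi)^-1 *
          \sum_(1 <= tau < n) circle_integral rho (boundary_integrand n e f tau z).
Proof.
have [B B0 fB] : exists2 B : R, 0 <= B & forall z, disc r z -> `|f z| <= B.
  case: hbd => [M [_ MB]]; exists (`|M| + 1); first by rewrite addr_ge0.
  by apply: MB; rewrite (le_lt_trans (ler_norm _)) // ltrDl.
have mf : measurable_fun (disc r : set (measurableTypeR R * measurableTypeR R)) f.
  by apply/measurable_EFinP; exact: measurable_int hint.
have nu01 : 0 < nu <= 1 by rewrite hnu0 hnu1.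
case: n hn hf => [|[|N]] // _; rewrite subSS subSS subn0 => hf.
split; first by move=> z; exact: (log_integrable hr0 hr1 nu01 hf mf B0 fB).
split; first exact: (log_potential_Ck hr0 hr1 nu01 hf mf B0 fB).
move=> j e _ he jE rho rrho z zr.
have he' tau : (1 <= tau <= N.+2)%N -> exists b, e tau = mdir b.
  by move=> /he[] ->; [exists false|exists true].
have -> : j = theta e N.+2 by [].
by have [] := log_potential_pd hr0 hr1 nu01 hf mf B0 fB he' rrho zr.
Qed.
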